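(* Let $p$ be any prime and $G=\mathbb{Z}/p$. Let $L$ be any finitely generated $\mathbb{Z}G$-lattice and let $\Gamma=L\rtimes G$ be the associated semidirect product group. Then for each $k\ge 0$ $$H^k(\Gamma,\mathbb{Z})\cong\bigoplus_{i+j=k}H^i\big(G,\wedge^j(L^* )\big),$$ where $\wedge^j(L^* )$ denotes the $j$-th exterior power (over $\mathbb{Z}$, with the induced $G$-action) of the dual module $L^*=\mathrm{Hom}(L,\mathbb{Z})$.
   Context: A $\mathbb{Z}G$-lattice is a $\mathbb{Z}G$-module whose underlying abelian group is free abelian. The semidirect product $L\rtimes G$ is formed using the given action of $G$ on the abelian group $L$. The group $\Gamma$ acts trivially on the coefficients $\mathbb{Z}$. The dual $L^*=\mathrm{Hom}_{\mathbb{Z}}(L,\mathbb{Z})$ carries the usual contragredient $G$-action. *)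

(* Defs.v *)
From HB Require Import structures.
From mathcomp Require Import all_boot all_order all_fingroup all_algebra.
From mathcomp Require Import generic_quotient ring_quotient.
From mathcomp Require Import boolp functions.
From mathcomp Require Import freeg.

Set Implicit Arguments.
Unset Strict Implicit.
Unset Printing Implicit Defensive.

Import GRing.Theory.

Local Open Scope ring_scope.
Local Open Scope quotient_scope.

Definition zmod_isom (U V : zmodType) : Prop :=
  exists f : {additive U -> V}, bijective f.

Section DirectSum.
Variables (I : finType) (V : I -> zmodType).

(* I is finite, so that the direct sum is the product. *)
Definition dirsum : Type := forall i, V i.
Implicit Types u v w : dirsum.

HB.instance Definition _ := Choice.copy dirsum (forall i, V i).

Definition dirsum_add u v : dirsum := fun i => u i + v i.
Definition dirsum_opp u : dirsum := fun i => - u i.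

Fact dirsum_addA : associative dirsum_add.
Proof.
by move=> u v w; apply/functional_extensionality_dep => i; apply: addrA.
Qed.
Fact dirsum_addC : commutative dirsum_add.
Proof.
by move=> u v; apply/functional_extensionality_dep => i; apply: addrC.
Qed.
Fact dirsum_add0 : left_id (fun=> 0) dirsum_add.
Proof. by move=> u; apply/functional_extensionality_dep => i; apply: add0r. Qed.
Fact dirsum_addN : left_inverse (fun=> 0) dirsum_opp dirsum_add.
Proof. by move=> u; apply/functional_extensionality_dep => i; apply: addNr. Qed.

HB.instance Definition _ := GRing.isZmodule.Build dirsum
  dirsum_addA dirsum_addC dirsum_add0 dirsum_addN.

End DirectSum.

Section ZSpan.
Variables (V : zmodType) (P : V -> Prop).

(* The smallest subgroup of V containing P. *)
Definition zspan : {pred V} := fun x =>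
  `[< forall S : {pred V}, zmod_closed S -> (forall y, P y -> y \in S) ->
      x \in S >].

Fact zspan_zmod_closed : zmod_closed zspan.
Proof.
split=> [|x y /asboolP xP /asboolP yP]; first by apply/asboolP => S [].
apply/asboolP => S S_cl SP; have [_ SB] := S_cl.
by apply: SB; [apply: xP | apply: yP].
Qed.

HB.instance Definition _ := GRing.isZmodClosed.Build V zspan zspan_zmod_closed.

Lemma sub_zspan y : P y -> y \in zspan.
Proof. by move=> Py; apply/asboolP => S _; apply. Qed.

End ZSpan.

HB.mixin Record isGModule (G : groupType) V of GRing.Zmodule V := {
  gmod_act : G -> V -> V;
  gmod_actD : forall g, {morph gmod_act g : x y / x + y};
  gmod_act1 : forall x, gmod_act 1%g x = x;
  gmod_actM : forall g h x, gmod_act (g * h)%g x = gmod_act g (gmod_act h x)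
}.

#[short(type="gmodType")]
HB.structure Definition GModule (G : groupType) :=
  {V of isGModule G V & GRing.Zmodule V}.

Section GModuleTheory.
Variables (G : groupType) (M : gmodType G).

Fact gmod_act_is_zmod_morphism (g : G) : zmod_morphism (gmod_act g : M -> M).
Proof.
move=> x y; have gN z : gmod_act g (- z) = - gmod_act g z :> M.
  apply: (addIr (gmod_act g z)); rewrite -gmod_actD !addNr.
  by apply: (addIr (gmod_act g 0)); rewrite -gmod_actD !add0r.
by rewrite gmod_actD gN.
Qed.

HB.instance Definition _ (g : G) :=
  GRing.isZmodMorphism.Build M M (gmod_act g) (gmod_act_is_zmod_morphism g).

End GModuleTheory.

Definition free_abelian (V : zmodType) : Prop :=
  exists K : choiceType, zmod_isom {freeg K} V.

Definition finitely_generated (G : groupType) (M : gmodType G) : Prop :=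
  exists s : seq M, forall S : {pred M},
    zmod_closed S -> (forall (g : G) x, x \in S -> gmod_act g x \in S) ->
    {subset s <= S} -> forall x, x \in S.

Definition triv_gmod (G : groupType) (V : zmodType) : Type := V.

Section Trivial.
Variables (G : groupType) (V : zmodType).

HB.instance Definition _ := GRing.Zmodule.on (triv_gmod G V).

Definition triv_gact (_ : G) (x : triv_gmod G V) : triv_gmod G V := x.

HB.instance Definition _ := @isGModule.Build G (triv_gmod G V) triv_gact
  (fun _ _ _ => erefl) (fun _ => erefl) (fun _ _ _ => erefl).

End Trivial.

Section Semidirect.
Variables (G : groupType) (L : gmodType G).

Definition semidirect : Type := (L * G)%type.
HB.instance Definition _ := Choice.on semidirect.
Implicit Types a b c : semidirect.

Definition semidirect_one : semidirect := (0, 1%g).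
Definition semidirect_mul a b : semidirect :=
  (a.1 + gmod_act a.2 b.1, (a.2 * b.2)%g).
Definition semidirect_inv a : semidirect :=
  (- gmod_act a.2^-1%g a.1, a.2^-1%g).

Fact semidirect_mulA : associative semidirect_mul.
Proof.
by move=> a b c; congr pair; rewrite /= ?mulgA // gmod_actM raddfD addrA.
Qed.
Fact semidirect_mul1 : left_id semidirect_one semidirect_mul.
Proof. by case=> x g; congr pair; rewrite /= ?mul1g // gmod_act1 add0r. Qed.
Fact semidirect_mulr1 : right_id semidirect_one semidirect_mul.
Proof. by case=> x g; congr pair; rewrite /= ?mulg1 // raddf0 addr0. Qed.
Fact semidirect_mulV :
  left_inverse semidirect_one semidirect_inv semidirect_mul.
Proof. by case=> x g; congr pair; rewrite /= ?mulVg // addNr. Qed.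
Fact semidirect_mulrV :
  right_inverse semidirect_one semidirect_inv semidirect_mul.
Proof.
case=> x g; congr pair; rewrite /= ?mulgV // raddfN /=.
by rewrite -gmod_actM mulgV gmod_act1 subrr.
Qed.

HB.instance Definition _ := isGroup.Build semidirect
  semidirect_mulA semidirect_mul1 semidirect_mulr1
  semidirect_mulV semidirect_mulrV.

End Semidirect.

Section Dual.
Variables (G : groupType) (L : gmodType G).

Definition dual : Type := {additive L -> int}.
HB.instance Definition _ := gen_eqMixin dual.
HB.instance Definition _ := gen_choiceMixin dual.
Implicit Types u v w : dual.

Lemma dualP u v : (forall x, u x = v x) -> u = v.
Proof.
case: u v => [u [[uP]]] [v [[vP]]] /= /funext uv; rewrite {}uv in uP *.
by rewrite (Prop_irrelevance uP vP).
Qed.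

Definition dual_zero : dual := \0.
Definition dual_add u v : dual := u \+ v.
Definition dual_opp u : dual := \- u.

Fact dual_addA : associative dual_add.
Proof. by move=> u v w; apply/dualP => x; apply: addrA. Qed.
Fact dual_addC : commutative dual_add.
Proof. by move=> u v; apply/dualP => x; apply: addrC. Qed.
Fact dual_add0 : left_id dual_zero dual_add.
Proof. by move=> u; apply/dualP => x; apply: add0r. Qed.
Fact dual_addN : left_inverse dual_zero dual_opp dual_add.
Proof. by move=> u; apply/dualP => x; apply: addNr. Qed.

HB.instance Definition _ := GRing.isZmodule.Build dual
  dual_addA dual_addC dual_add0 dual_addN.

Definition dual_gact (g : G) u : dual := u \o gmod_act g^-1%g.

Fact dual_gactD g : {morph dual_gact g : u v / u + v}.
Proof. by move=> u v; apply/dualP. Qed.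
Fact dual_gact1 u : dual_gact 1%g u = u.
Proof. by apply/dualP => x /=; rewrite invg1 gmod_act1. Qed.
Fact dual_gactM g h u : dual_gact (g * h)%g u = dual_gact g (dual_gact h u).
Proof. by apply/dualP => x /=; rewrite invMg gmod_actM. Qed.

HB.instance Definition _ := @isGModule.Build G dual dual_gact
  dual_gactD dual_gact1 dual_gactM.

End Dual.

Section Exterior.
Variables (j : nat) (M : zmodType).

(* The generator <<x>> stands for x 0 /\ ... /\ x (j - 1). *)
Variant ext_rel : {freeg ('I_j -> M)} -> Prop :=
| ExtAdd (x y z : 'I_j -> M) (i : 'I_j) of
    x i = y i + z i & (forall l, l != i -> x l = y l /\ x l = z l) :
    ext_rel (<<x>> - <<y>> - <<z>>)
| ExtAlt (x : 'I_j -> M) (i l : 'I_j) of i != l & x i = x l :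
    ext_rel <<x>>.

Definition ext_power : Type := Quotient.quot (zspan ext_rel).
HB.instance Definition _ := GRing.Zmodule.on ext_power.
HB.instance Definition _ :=
  ZmodQuotient.copy ext_power (Quotient.quot (zspan ext_rel)).

End Exterior.

Section ExteriorAction.
Variables (j : nat) (G : groupType) (M : gmodType G).
Local Notation F := {freeg ('I_j -> M)}.
Local Notation E := (ext_power j M).

(* g (x 0 /\ ... /\ x (j - 1)) = g (x 0) /\ ... /\ g (x (j - 1)) *)
Definition ext_lift (g : G) : F -> F := fglift (fun x => << gmod_act g \o x >>).
HB.instance Definition _ g :=
  GRing.isZmodMorphism.Build F F (ext_lift g) (lift_is_additive _).

Definition ext_gact (g : G) (e : E) : E := \pi_E (ext_lift g (repr e)).

Lemma ext_liftU g x : ext_lift g <<x>> = << gmod_act g \o x >>.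
Proof. by rewrite /ext_lift liftU scale1r. Qed.

Lemma ext_lift_zspan g u :
  u \in zspan (@ext_rel j M) -> ext_lift g u \in zspan (@ext_rel j M).
Proof.
move=> /asboolP/(_ [pred v | ext_lift g v \in zspan (@ext_rel j M)]); apply.
  split=> [|v w]; first by rewrite !inE raddf0 rpred0.
  by rewrite !inE raddfB; apply: rpredB.
move=> _ [x y z i xE xl|x i l il xE]; rewrite !inE ?raddfB.
  rewrite /= !ext_liftU; apply: sub_zspan.
  apply: (ExtAdd (i := i)) => [|l /xl[/= <- <-] //].
  by rewrite /= xE raddfD.
by rewrite /= ext_liftU; apply: sub_zspan; apply: (ExtAlt il); rewrite /= xE.
Qed.

Lemma ext_gact_pi g u : ext_gact g (\pi_E u) = \pi_E (ext_lift g u).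
Proof.
rewrite /ext_gact; apply/eqP; rewrite -Quotient.idealrBE -raddfB.
by apply: ext_lift_zspan; rewrite Quotient.idealrBE reprK.
Qed.

Lemma ext_lift_eq (f h : {additive F -> F}) :
  (forall x, f <<x>> = h <<x>>) -> f =1 h.
Proof.
move=> fh u; rewrite -[u]freeg_sumE !raddf_sum; apply: eq_bigr => x _.
have -> : << coeff x u *g x >> = << x >> *~ coeff x u.
  apply/eqP/freeg_eqP => y.
  by rewrite raddfMz /= !coeffU mul1r -mulrzr intz mulrC.
by rewrite !raddfMz fh.
Qed.

Fact ext_gactD g : {morph ext_gact g : x y / x + y}.
Proof.
elim/quotW=> u; elim/quotW=> v.
by rewrite -[X in ext_gact g X]raddfD !ext_gact_pi raddfD [LHS]raddfD.
Qed.
Fact ext_gact1 e : ext_gact 1%g e = e.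
Proof.
elim/quotW: e => u; rewrite ext_gact_pi; congr \pi.
apply: (ext_lift_eq (f := ext_lift 1%g) (h := idfun)) => x /=.
by rewrite ext_liftU; congr << _ >>; apply/funext => i; apply: gmod_act1.
Qed.
Fact ext_gactM g h e : ext_gact (g * h)%g e = ext_gact g (ext_gact h e).
Proof.
elim/quotW: e => u; rewrite [ext_gact h _]ext_gact_pi !ext_gact_pi; congr \pi.
apply: (ext_lift_eq (f := ext_lift (g * h)%g) (h := ext_lift g \o ext_lift h)).
move=> x /=; rewrite !ext_liftU; congr << _ >>.
by apply/funext => i; apply: gmod_actM.
Qed.

HB.instance Definition _ := @isGModule.Build G E ext_gact
  ext_gactD ext_gact1 ext_gactM.

End ExteriorAction.

(* H^n(G, M) is computed from the standard (homogeneous bar) resolution of Z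
   over ZG: an n-cochain is a G-equivariant map from G^(n+1) to M. *)
Section Cohomology.
Variables (G : groupType) (M : gmodType G).

Definition equivariant n : {pred ('I_n.+1 -> G) -> M} := fun f =>
  `[< forall g x, f (fun i => g * x i)%g = gmod_act g (f x) >].
Arguments equivariant : clear implicits.

Fact equivariant_zmod_closed n : zmod_closed (equivariant n).
Proof.
split=> [|f h /asboolP fP /asboolP hP]; apply/asboolP => g x.
  by rewrite [RHS]raddf0.
by rewrite [LHS](congr2 (fun a b => a - b) (fP g x) (hP g x)) -raddfB.
Qed.
HB.instance Definition _ n := GRing.isZmodClosed.Build _ (equivariant n)
  (@equivariant_zmod_closed n).

Record cochain n := Cochain {
  cochain_fun :> ('I_n.+1 -> G) -> M;
  _ : cochain_fun \in equivariant n
}.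
HB.instance Definition _ n := [isSub for @cochain_fun n].
HB.instance Definition _ n := [Choice of cochain n by <:].
HB.instance Definition _ n := [SubChoice_isSubZmodule of cochain n by <:].

Definition cdiff_fun n (f : cochain n) (x : 'I_n.+2 -> G) : M :=
  \sum_(i < n.+2) f (x \o fintype.lift i) *~ (-1) ^+ i.

Fact cdiff_equivariant n (f : cochain n) : cdiff_fun f \in equivariant n.+1.
Proof.
apply/asboolP => g x; rewrite raddf_sum; apply: eq_bigr => i _.
by rewrite raddfMz; congr (_ *~ _); case: f => f /= /asboolP; apply.
Qed.
Definition cdiff n (f : cochain n) : cochain n.+1 :=
  Cochain (cdiff_equivariant f).

Fact cdiff_is_zmod_morphism n : zmod_morphism (@cdiff n).
Proof.
move=> f h; apply/val_inj/funext => x.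
rewrite [RHS](_ : _ = cdiff_fun f x - cdiff_fun h x) // /= /cdiff_fun -sumrB.
by apply: eq_bigr => i _; rewrite -mulrzBl.
Qed.
HB.instance Definition _ n := GRing.isZmodMorphism.Build _ _ (@cdiff n)
  (@cdiff_is_zmod_morphism n).

Definition is_cocycle n : {pred cochain n} := fun f => cdiff f == 0.
Arguments is_cocycle : clear implicits.

Fact is_cocycle_zmod_closed n : zmod_closed (is_cocycle n).
Proof.
split=> [|f h /eqP fP /eqP hP]; apply/eqP; first exact: raddf0.
by rewrite raddfB /= fP hP subrr.
Qed.
HB.instance Definition _ n := GRing.isZmodClosed.Build _ (is_cocycle n)
  (@is_cocycle_zmod_closed n).

Record cocycle n := Cocycle {
  cocycle_val :> cochain n;
  _ : cocycle_val \in is_cocycle n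
}.
HB.instance Definition _ n := [isSub for @cocycle_val n].
HB.instance Definition _ n := [Choice of cocycle n by <:].
HB.instance Definition _ n := [SubChoice_isSubZmodule of cocycle n by <:].

Definition bounds n : cochain n -> Prop :=
  match n with
  | 0 => fun f => f = 0
  | _.+1 => fun f => exists h, f = cdiff h
  end.

Definition is_coboundary n : {pred cocycle n} := fun f => `[< bounds (val f) >].
Arguments is_coboundary : clear implicits.

Fact is_coboundary_zmod_closed n : zmod_closed (is_coboundary n).
Proof.
case: n => [|n]; split=> [|f h].
- exact/asboolP.
- by move=> /asboolP/= fP /asboolP/= hP; apply/asboolP; rewrite /= fP hP subrr.
- by apply/asboolP; exists 0; rewrite !raddf0.
- move=> /asboolP/= [f' fE] /asboolP/= [h' hE]; apply/asboolP.
  by exists (f' - h'); rewrite !raddfB /= fE hE.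
Qed.
HB.instance Definition _ n := GRing.isZmodClosed.Build _ (is_coboundary n)
  (@is_coboundary_zmod_closed n).

Definition cohomology n : Type := Quotient.quot (is_coboundary n).
HB.instance Definition _ n := GRing.Zmodule.on (cohomology n).
HB.instance Definition _ n :=
  ZmodQuotient.copy (cohomology n) (Quotient.quot (is_coboundary n)).

End Cohomology.

(* Main.v *)
(* The cochains of Gamma = L x| G that are invariant under L and supported on
   lists of length n + 1 form coinduced G-modules, and the n-th cohomology of
   this complex of G-modules is wedge^n(L^* ), by evaluation of cocycles on the
   cubes spanned by n vectors of L.  The resulting filtration of H^*(Gamma, Z)
   splits as soon as every alternating form is represented by a cocycle that
   depends additively and G-equivariantly on it.  By transfer from the trivial
   group it suffices to do this up to factors prime to p = #|G|.

   Up to such factors, L is a direct sum of modules Z, ZG and augmentation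
   ideals of ZG: a maximal summand of this kind exhausts L, since g - 1, with g
   a generator of G, is nilpotent modulo p.  Sums are handled by cup products.  On a lattice of rank
   less than p, a form b of degree j is represented by the cocycle
     (x_0, ..., x_j) |-> b (x_1 - x_0, ..., x_j - x_(j-1)),
   whose restriction to L is j! b.  The same cocycle works on ZG in degrees less
   than p.  For the determinant, in degree p, the obstruction to equivariance
   lies in cohomology with coefficients in exterior powers of degrees strictly
   between 0 and p, which are induced modules: the sum of the indices of
   g_1 /\ ... /\ g_j is a grading by Z/p that G permutes freely. *)
Require Import Defs.
From HB Require Import structures.
From mathcomp Require Import all_boot all_order all_fingroup all_algebra.
From mathcomp Require Import generic_quotient.
From mathcomp Require Import boolp functions freeg zify ring.
From mathcomp Require Import cyclic.

Set Implicit Arguments.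
Unset Strict Implicit.
Unset Printing Implicit Defensive.
Import GRing.Theory.
Local Open Scope ring_scope.
Local Open Scope quotient_scope.

(** Let Z^n be the G-module of L-invariant cocycles of degree n. The cochain modules being acyclic,
    an equivariant section of the projection of Z^n onto the n-th exterior power E_n gives H^i(G,
    Z^n) = H^i(G, E_n) + H^(i+1)(G, Z^(n-1)); iterating from i = 0 yields the sum of the theorem.
    Cocycles built from a basis of L are additive in the form but not equivariant. The sum of their
    translates over G is equivariant and restricts to p times the form; a Bezout combination with a
    section that restricts to m times the form, m prime to p, restricts to the form itself. So j! is
    harmless for j < p, and the real obstacle is ZG in degree p. The obstruction there descends
    through all lower degrees, and degree 0 carries the module Z, which is not induced: requiring
    cochains to vanish on the subgroup G removes that degree. When p = 2 a generator changes the
    sign of the determinant, hence the twist by a character. The decomposition of L stays over Z: a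
    retraction is replaced by two maps whose composite is multiplication by an integer prime to p,
    and inverses by adjugates. *)

(** * Deciding equations in abelian groups *)

Inductive zexp := ZVar of nat | ZAdd of zexp & zexp | ZOpp of zexp | ZZero.

Fixpoint zeval (V : zmodType) (env : seq V) e : V :=
  match e with
  | ZVar i => nth 0 env i
  | ZAdd a b => zeval env a + zeval env b
  | ZOpp a => - zeval env a
  | ZZero => 0
  end.

Fixpoint zcoef i e : int :=
  match e with
  | ZVar k => if k == i then 1%Z else 0%Z
  | ZAdd a b => intZmod.addz (zcoef i a) (zcoef i b)
  | ZOpp a => intZmod.oppz (zcoef i a)
  | ZZero => 0%Z
  end.

Lemma zeval_coef (V : zmodType) (env : seq V) e :
  zeval env e = \sum_(i < size env) env`_i *~ zcoef i e.
Proof.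
elim: e => [k|a IHa b IHb|a IH|] /=.
- have [k_lt|k_ge] := ltnP k (size env).
    rewrite (bigD1 (Ordinal k_lt)) //= eqxx mulr1z big1 ?addr0 // => i ik.
    by case: eqP => [kE|_] //; case/eqP: ik; apply: val_inj.
  rewrite nth_default // big1 // => i _.
  by case: eqP => // kE; have:= ltn_ord i; rewrite -kE ltnNge k_ge.
- by rewrite IHa IHb -big_split /=; apply: eq_bigr => i _; rewrite -mulrzDr.
- by rewrite IH -sumrN; apply: eq_bigr => i _; rewrite -mulrNz.
- by rewrite big1 // => i _; rewrite mulr0z.
Qed.

Lemma zeval_eq (V : zmodType) (env : seq V) a b :
  all (fun i => zcoef i a == zcoef i b) (iota 0 (size env)) ->
  zeval env a = zeval env b.
Proof.
move=> /allP ab; rewrite !zeval_coef; apply: eq_bigr => i _; congr (_ *~ _).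
by apply/eqP; apply: (ab i); rewrite mem_iota add0n ltn_ord.
Qed.

Ltac zlookup x env :=
  match env with
  | ?y :: _ => let _ := match goal with _ => unify x y end in constr:(0%N)
  | _ :: ?env' => let n := zlookup x env' in constr:(S n)
  end.

Ltac zatoms e env :=
  match e with
  | GRing.add ?a ?b => let env := zatoms a env in zatoms b env
  | GRing.opp ?a => zatoms a env
  | GRing.zero => env
  | _ => match env with
         | _ => let n := zlookup e env in env
         | _ => constr:(e :: env)
         end
  end.

Ltac zreify e env :=
  match e with
  | GRing.add ?a ?b =>
      let a := zreify a env in let b := zreify b env in constr:(ZAdd a b)
  | GRing.opp ?a => let a := zreify a env in constr:(ZOpp a)
  | GRing.zero => constr:(ZZero)
  | _ => let n := zlookup e env in constr:(ZVar n)
  end.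

(* Decides equations in abelian groups. *)
Ltac abel :=
  match goal with
  | |- @eq ?V ?a ?b =>
      let env := zatoms a (@nil V) in
      let env := zatoms b env in
      let a' := zreify a env in
      let b' := zreify b env in
      apply: (@zeval_eq _ env a' b'); vm_compute; reflexivity
  end.

(** * Cochains on lists *)

Section ListCochains.
Variables (T : Type) (M : zmodType).
Implicit Types (f : seq T -> M) (s : seq T).

(* The homogeneous bar differential, a cochain of degree n being read on lists of
   length n + 1; it is augmented, f [::] playing the role of degree -1. *)
Fixpoint ld f s : M :=
  if s is g :: s' then f s' - ld (fun r => f (g :: r)) s' else 0.

(** The usual triangulation of the prism between s and its image under [t]: the alternating sum of f
    over g_0, ..., g_i, t g_i, ..., t g_n. *)
Fixpoint prism (t : T -> T) f s : M :=
  if s is g :: s' then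
    f (g :: t g :: map t s') - prism t (fun r => f (g :: r)) s'
  else 0.

Lemma ldB f1 f2 s : ld (fun r => f1 r - f2 r) s = ld f1 s - ld f2 s.
Proof.
elim: s f1 f2 => [|g s IH] f1 f2 /=; first by rewrite subr0.
by rewrite IH; abel.
Qed.

Lemma ld_eq_size n f1 f2 :
  (forall s, size s = n -> f1 s = f2 s) ->
  forall s, size s = n.+1 -> ld f1 s = ld f2 s.
Proof.
move=> f12 s; elim: s n f1 f2 f12 => [|g s IH] n f1 f2 f12 //= [sn].
rewrite f12 //; congr (_ - _); case: n sn f12 => [|n] sn f12.
  by rewrite (size0nil sn).
by apply: (IH n) => // r rn; apply: f12; rewrite /= rn.
Qed.

Lemma ld0 s : ld (fun=> 0) s = 0.
Proof. by elim: s => [|g s IH] //=; rewrite IH subr0. Qed.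

Lemma ld_eq0_size n f :
  (forall s, size s = n -> f s = 0) -> forall s, size s = n.+1 -> ld f s = 0.
Proof. by move=> f0 s sn; rewrite (ld_eq_size (f2 := fun=> 0) f0 sn) ld0. Qed.

Lemma ldN f s : ld (fun r => - f r) s = - ld f s.
Proof. by elim: s f => [|g s IH] f /=; rewrite ?oppr0 // IH opprD. Qed.

Lemma ldD f1 f2 s : ld (fun r => f1 r + f2 r) s = ld f1 s + ld f2 s.
Proof.
rewrite -[X in _ + X]opprK -ldN -ldB.
by congr ld; apply/funext => r; rewrite opprK.
Qed.

Definition ltrunc n f s := if size s == n then f s else 0.

Lemma ld_ltrunc n f s : ld (ltrunc n f) s = ltrunc n.+1 (ld f) s.
Proof.
rewrite /ltrunc; case: s => [|g s] //; rewrite [size _]/= eqSS.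
case: (eqVneq (size s) n) => [sn|sn].
  by apply: (ld_eq_size (n := n)) => [r ->|]; rewrite ?eqxx //= sn.
apply: (ld_eq0_size (n := size s)) => // r rs.
by rewrite rs (negPf sn).
Qed.

Lemma ld_ld f s : ld (ld f) s = 0.
Proof.
elim: s f => [|g s IH] f //=.
by rewrite ldB IH subr0 subrr.
Qed.

Lemma ld_map (t : T -> T) f s : ld (fun r => f (map t r)) s = ld f (map t s).
Proof. by elim: s f => [|g s IH] f //=; rewrite (IH (fun r => f (t g :: r))). Qed.

Lemma prismB t f1 f2 s :
  prism t (fun r => f1 r - f2 r) s = prism t f1 s - prism t f2 s.
Proof.
elim: s f1 f2 => [|g s IH] f1 f2 /=; first by rewrite subr0.
by rewrite IH; abel.
Qed.

Lemma prism_eq_size t n f1 f2 :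
  (forall s, size s = n.+1 -> f1 s = f2 s) ->
  forall s, size s = n -> prism t f1 s = prism t f2 s.
Proof.
move=> f12 s; elim: s n f1 f2 f12 => [|g s IH] [|n] f1 f2 f12 //= [sn].
rewrite f12 /= ?size_map ?sn //; congr (_ - _).
by apply: (IH n) => // r rn; apply: f12; rewrite /= rn.
Qed.

Lemma prism0 t s : prism t (fun=> 0) s = 0.
Proof. by elim: s => [|g s IH] //=; rewrite IH subr0. Qed.

Lemma prism_homotopy t f s :
  ld (prism t f) s + prism t (ld f) s = f (map t s) - f s.
Proof.
elim: s f => [|g s IH] f; first by rewrite /= subrr addr0.
rewrite [prism t (ld f) _]/= [ld (prism t f) _]/= ldB.
rewrite (ld_map t (fun r => f (g :: t g :: r))) prismB.
have -> : f (map t (g :: s)) - f (g :: s) = f (map t (g :: s)) - f (g :: map t s)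
    + (f (g :: map t s) - f (g :: s)) by rewrite addrA subrK.
rewrite -[X in _ = _ + X](IH (fun r => f (g :: r))) /=.
set A := prism t f s; set B := ld _ (map t s); set C := ld (prism _ _) s.
set D := prism t (ld _) s; set E := f (t g :: _); set F := f (g :: _).
by abel.
Qed.

Lemma map_prism (t u : T -> T) f s : (forall g, t (u g) = u (t g)) ->
  prism t f (map u s) = prism t (fun r => f (map u r)) s.
Proof.
move=> tu; elim: s f => [|g s IH] f //=.
rewrite (IH (fun r => f (u g :: r))); congr (f _ - _).
by rewrite tu -!map_comp; congr (_ :: _ :: _); apply: eq_map => x /=.
Qed.

End ListCochains.

Lemma morph_mulrz (U V : zmodType) (h : U -> V) :
  {morph h : x y / x - y} -> forall x k, h (x *~ k) = h x *~ k.
Proof.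
move=> hB x k; pose F := GRing.isZmodMorphism.Build U V h hB.
pose fa : {additive U -> V} := HB.pack h F.
exact: (raddfMz fa).
Qed.

Lemma ld_hom (T : Type) (M N : zmodType) (h : M -> N) (f : seq T -> M) s :
  {morph h : x y / x - y} -> h (ld f s) = ld (fun r => h (f r)) s.
Proof.
move=> hB; have h0 : h 0 = 0 by rewrite -[X in h X](subrr 0) hB subrr.
by elim: s f => [|g s IH] f //=; rewrite hB IH.
Qed.

Lemma prism_hom (T : Type) (M N : zmodType) (h : M -> N) t (f : seq T -> M) s :
  {morph h : x y / x - y} -> h (prism t f s) = prism t (fun r => h (f r)) s.
Proof.
move=> hB; have h0 : h 0 = 0 by rewrite -[X in h X](subrr 0) hB subrr.
by elim: s f => [|g s IH] f //=; rewrite hB IH.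
Qed.

Lemma ld_precomp (T U : Type) (M : zmodType) (t : U -> T) (f : seq T -> M) s :
  ld (fun r => f (map t r)) s = ld f (map t s).
Proof. by elim: s f => [|g s IH] f //=; rewrite (IH (fun r => f (t g :: r))). Qed.

Lemma prism_precomp (T U : Type) (M : zmodType) (t : U -> T) v w
    (f : seq T -> M) s : (forall g, t (v g) = w (t g)) ->
  prism v (fun r => f (map t r)) s = prism w f (map t s).
Proof.
move=> tv; elim: s f => [|g s IH] f //=.
rewrite (IH (fun r => f (t g :: r))) tv; congr (f _ - _).
by rewrite -!map_comp; congr (_ :: _ :: _); apply: eq_map => x /=.
Qed.

(** The isomorphism of the theorem depends on choices of cochains and is single-valued only on
    classes, so it is obtained as a relation. *)
Lemma zmod_isom_of_rel (X Y : zmodType) (R : X -> Y -> Prop) :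
  (forall x, exists y, R x y) -> (forall y, exists x, R x y) ->
  (forall x y x' y', R x y -> R x' y' -> R (x - x') (y - y')) ->
  (forall y, R 0 y -> y = 0) -> (forall x, R x 0 -> x = 0) ->
  zmod_isom X Y.
Proof.
move=> totX totY RB R0y Rx0.
have [f fP] := choice totX; have [h hP] := choice totY.
have f_uniq x y : R x y -> y = f x.
  by move=> /RB /(_ (fP x)); rewrite subrr => /R0y /subr0_eq.
have fB : zmod_morphism f by move=> x y; apply/esym/f_uniq/RB.
pose F := GRing.isZmodMorphism.Build X Y f fB.
pose fa : {additive X -> Y} := HB.pack f F.
exists fa; exists h => [x|y] /=; last by rewrite -(f_uniq _ _ (hP y)).
by have := RB _ _ _ _ (hP (f x)) (fP x); rewrite subrr => /Rx0 /subr0_eq.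
Qed.

(** * Cohomology from list cochains *)

Definition lst (T : Type) n (x : 'I_n -> T) : seq T := [seq x i | i <- enum 'I_n].

Lemma size_lst (T : Type) n (x : 'I_n -> T) : size (lst x) = n.
Proof. by rewrite size_map size_enum_ord. Qed.

Lemma lst_comp (T U : Type) (h : T -> U) n (x : 'I_n -> T) :
  lst (h \o x) = map h (lst x).
Proof. by rewrite /lst -[RHS]map_comp. Qed.

Lemma lstS (T : Type) n (x : 'I_n.+1 -> T) :
  lst x = x ord0 :: lst (x \o fintype.lift ord0).
Proof. by rewrite /lst enum_ordSl /= -map_comp. Qed.

Lemma lst_nth (T : Type) (x0 : T) n (s : seq T) :
  size s = n -> lst (fun i : 'I_n => nth x0 s i) = s.
Proof.
move=> sn; apply: (@eq_from_nth _ x0) => [|i]; rewrite size_lst // => i_lt.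
by rewrite (nth_map (Ordinal i_lt)) ?size_enum_ord // nth_enum_ord.
Qed.

Lemma nth_lst (T : Type) (x0 : T) n (x : 'I_n -> T) (i : 'I_n) :
  nth x0 (lst x) i = x i.
Proof. by rewrite (nth_map i) ?size_enum_ord // nth_ord_enum. Qed.

Lemma ld_lst (T : Type) (M : zmodType) n (f : seq T -> M) (x : 'I_n.+1 -> T) :
  \sum_(i < n.+1) f (lst (x \o fintype.lift i)) *~ (-1) ^+ i = ld f (lst x).
Proof.
elim: n f x => [|n IH] f x; rewrite big_ord_recl expr0 mulr1z lstS /=.
  by rewrite big_ord0 addr0 /lst enum_ord0 /= subr0.
congr (_ + _); rewrite -IH -sumrN; apply: eq_bigr => i _.
rewrite /= /bump add1n exprS mulN1r mulrNz; congr (- (f _ *~ _)).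
rewrite lstS /=; congr (x _ :: _); first exact: val_inj.
congr (map _ _); apply/funext => k /=; congr x; apply: val_inj => /=.
by rewrite /bump !add1n ltnS addnS.
Qed.

Section Represents.
Variables (G : groupType) (M : gmodType G).

Definition lequi (c : seq G -> M) :=
  forall g s, c [seq (g * x)%g | x <- s] = gmod_act g (c s).

Lemma lequiB c c' : lequi c -> lequi c' -> lequi (fun s => c s - c' s).
Proof. by move=> cE c'E g s; rewrite cE c'E raddfB. Qed.

Lemma lequi_ld c : lequi c -> lequi (ld c).
Proof.
move=> cE g s; rewrite -ld_map ld_hom; last exact: raddfB.
by congr ld; apply/funext => r; apply: cE.
Qed.

Lemma lequi_ltrunc n c : lequi c -> lequi (ltrunc n c).
Proof.
by move=> cE g s; rewrite /ltrunc size_map cE; case: ifP; rewrite ?raddf0.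
Qed.

Lemma lequi_act1 c (cE : lequi c) g s : c (g :: s) =
  gmod_act g (c (1%g :: [seq (g^-1 * x)%g | x <- s])).
Proof.
rewrite -cE /= mulg1 -map_comp; congr (c (_ :: _)).
by rewrite -[LHS]map_id; apply: eq_map => x /=; rewrite mulKVg.
Qed.

(** Functions on lists put cochains of all degrees in one type; f is tied to the class x only
    through its values in length n + 1. *)
Definition represents n (f : seq G -> M) (x : cohomology M n) : Prop :=
  lequi f /\ exists2 c : cocycle M n,
    x = \pi_(cohomology M n) c & forall y, c y = f (lst y).

Lemma represents_lequi n f (x : cohomology M n) : represents f x -> lequi f.
Proof. by case. Qed.

Lemma represents_exists n (x : cohomology M n) : exists f, represents f x.
Proof.
elim/quotW: x => c.
pose f s := if size s == n.+1 then c (fun i => nth 1%g s i) else 0.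
exists f; split=> [g s|]; last first.
  exists c => // y; rewrite /f size_lst eqxx; congr (cochain_fun (val c)).
  by apply/funext => i; rewrite nth_lst.
rewrite /f size_map; case: eqP => [sn|_]; last by rewrite raddf0.
have /asboolP cE := valP (val c).
rewrite -[RHS]cE; congr (cochain_fun (val c)); apply/funext => i.
by rewrite (nth_map 1%g) // sn.
Qed.

Lemma represents_cocycle n f (x : cohomology M n) :
  represents f x -> forall s, size s = n.+2 -> ld f s = 0.
Proof.
move=> [_ [c _ cf]] s sn; have /eqP cD := valP c.
have c0 : cdiff_fun (val c) (fun i => nth 1%g s i) = 0.
  by rewrite -[LHS]/(cdiff (val c) _) cD.
rewrite -[X in ld f X](lst_nth 1%g sn) -ld_lst -[RHS]c0; apply: eq_bigr => i _.
by rewrite -cf.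
Qed.

Lemma cocycle_represents n f : lequi f ->
  (forall s, size s = n.+2 -> ld f s = 0) ->
  exists x : cohomology M n, represents f x.
Proof.
move=> fE fD.
have fC : (fun y : 'I_n.+1 -> G => f (lst y)) \in @equivariant G M n.
  by apply/asboolP => g x; rewrite -fE -lst_comp.
have fZ : Cochain fC \in @is_cocycle G M n.
  apply/eqP; apply/val_inj/funext => x.
  transitivity (ld f (lst x)); last exact: (fD _ (size_lst _)).
  by rewrite -ld_lst.
by exists (\pi_(cohomology M n) (Cocycle fZ)); split=> //; exists (Cocycle fZ).
Qed.

Lemma representsB n f f' (x x' : cohomology M n) :
  represents f x -> represents f' x' ->
  represents (fun s => f s - f' s) (x - x').
Proof.
move=> [fE [c -> cf]] [f'E [c' -> cf']]; split; first exact: lequiB.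
exists (c - c'); first exact: esym (raddfB _ _ _).
by move=> y; rewrite -cf -cf'.
Qed.

(** The condition [h [::] = 0] makes degree 0 uniform with the others: there the augmented
    differential of h is [h [::]], so that only 0 is a coboundary. *)
Lemma represents0P n f (x : cohomology M n) : represents f x ->
  x = 0 <-> exists h : seq G -> M, [/\ lequi h, h [::] = 0 &
    forall s, size s = n.+1 -> f s = ld h s].
Proof.
move=> [fE [c -> cf]].
have c0 : \pi_(cohomology M n) c = 0 <-> bounds (val c).
  rewrite -[0](raddf0 (\pi_(cohomology M n))); split=> [/eqP|cB].
    by rewrite -Quotient.idealrBE subr0 => /asboolP.
  by apply/eqP; rewrite -Quotient.idealrBE subr0; apply/asboolP.
rewrite c0 {x c0}; case: n c cf => [|n] c cf /=; split.
- move=> cB; exists (fun=> 0); split=> // [g s|s sn]; first by rewrite raddf0.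
  by rewrite ld0 -[s](lst_nth 1%g sn) -cf cB.
- move=> [h [hE h0 hf]]; apply/val_inj/funext => y; rewrite [LHS]cf hf ?size_lst //.
  by rewrite lstS /lst enum_ord0 /= h0 subr0.
- move=> [h hc]; pose h' s := if size s == n.+1 then h (fun i => nth 1%g s i) else 0.
  exists h'; split=> // [g s|s sn].
    rewrite /h' size_map; case: eqP => [sn|_]; last by rewrite raddf0.
    have /asboolP hE := valP h.
    rewrite -[RHS]hE; congr (cochain_fun h); apply/funext => i.
    by rewrite (nth_map 1%g) // sn.
  rewrite -[s](lst_nth 1%g sn) -cf hc -ld_lst; apply: eq_bigr => i _.
  rewrite /h' size_lst eqxx; congr (cochain_fun h _ *~ _).
  by apply/funext => k; rewrite nth_lst.
- move=> [h [hE h0 hf]].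
  have hC : (fun y : 'I_n.+1 -> G => h (lst y)) \in @equivariant G M n.
    by apply/asboolP => g x; rewrite -hE -lst_comp.
  exists (Cochain hC); apply/val_inj/funext => x.
  by rewrite [LHS]cf hf ?size_lst // -ld_lst.
Qed.

End Represents.

(** * Splitting a filtered complex *)

(** G permutes nonempty lists freely: choose on lists that begin with 1 and transport the choice by
    the first entry. *)
Lemma lequi_lift (G : groupType) (X Y : gmodType G) (R : X -> Y -> Prop) n
    (c : seq G -> X) :
  lequi c -> (forall g x y, R x y -> R (gmod_act g x) (gmod_act g y)) ->
  (forall s, size s = n.+1 -> exists y, R (c s) y) ->
  exists b : seq G -> Y, [/\ lequi b, forall s, size s = n.+1 -> R (c s) (b s) &
    forall s, size s <> n.+1 -> b s = 0].
Proof.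
move=> cE RG cR.
have [s|f fP] := @choice (seq G) Y (fun s y => size s = n.+1 -> R (c s) y).
  have [sn|sn] := eqVneq (size s) n.+1; last by exists 0 => /eqP; rewrite (negPf sn).
  by have [y y_] := cR s sn; exists y.
pose b s := if s is g :: r then
  if size r == n then gmod_act g (f (1%g :: [seq (g^-1 * x)%g | x <- r])) else 0
  else 0.
exists b; split=> [g [|h r]|[|g r] //= [rn]|[|g r] //=].
- by rewrite raddf0.
- rewrite /= size_map; case: eqP => [_|_]; last by rewrite raddf0.
  rewrite gmod_actM -map_comp; congr (gmod_act g (gmod_act h (f (_ :: _)))).
  by apply: eq_map => x /=; rewrite invMg mulgA mulgVK.
- rewrite rn eqxx (lequi_act1 cE); apply: RG; apply: fP.
  by rewrite /= size_map rn.
- by case: eqP => // ->.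
Qed.

Section Filtered.
Variables (G : groupType) (C : gmodType G) (d : {additive C -> C}).
(** Meant for the L-invariant cochains on lists of length n, which have degree n - 1; hence [A 0] is
    zero and classes of degree l live in [A l.+1]. *)
Variable A : nat -> C -> Prop.
Hypothesis dG : forall g x, d (gmod_act g x) = gmod_act g (d x).
Hypothesis dd : forall x, d (d x) = 0.
Hypothesis A_0 : forall n, A n 0.
Hypothesis A_B : forall n x y, A n x -> A n y -> A n (x - y).
Hypothesis A_G : forall n g x, A n x -> A n (gmod_act g x).
Hypothesis A_d : forall n x, A n x -> A n.+1 (d x).
Hypothesis A_nil : forall x, A 0 x -> x = 0.
Hypothesis A_exact : forall n i (c : seq G -> C),
  lequi c -> (forall s, A n (c s)) -> (forall s, size s = i.+2 -> ld c s = 0) ->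
  exists a, [/\ lequi a, forall s, A n (a s) &
    forall s, size s = i.+1 -> c s = ld a s].

Lemma A_N n x : A n x -> A n (- x).
Proof. by move=> Ax; rewrite -[- x]add0r; apply: A_B. Qed.

Lemma A_D n x y : A n x -> A n y -> A n (x + y).
Proof. by move=> Ax Ay; rewrite -[y]opprK; apply/A_B/A_N. Qed.

Lemma A_ld n (c : seq G -> C) s : (forall s, A n (c s)) -> A n (ld c s).
Proof.
elim: s c => [|g s IH] c cA /=; first exact: A_0.
by apply: A_B => //; apply: IH.
Qed.

Lemma A_ltrunc n m (c : seq G -> C) : (forall s, size s = m -> A n (c s)) ->
  forall s, A n (ltrunc m c s).
Proof. by move=> cA s; rewrite /ltrunc; case: eqP => [/cA|_]. Qed.

Lemma A_exact_at n i (c : seq G -> C) : lequi c ->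
  (forall s, size s = i.+1 -> A n (c s)) ->
  (forall s, size s = i.+2 -> ld c s = 0) ->
  exists a, [/\ lequi a, forall s, A n (a s) &
    forall s, size s = i.+1 -> c s = ld a s].
Proof.
move=> cE cA c0; have [|||a [aE aA ca]] := @A_exact n i (ltrunc i.+1 c).
- exact: lequi_ltrunc.
- exact: A_ltrunc.
- by move=> s sn; rewrite ld_ltrunc /ltrunc sn eqxx c0.
- by exists a; split=> // s sn; rewrite -ca // /ltrunc sn eqxx.
Qed.

Lemma d_ld (c : seq G -> C) s : d (ld c s) = ld (fun r => d (c r)) s.
Proof. by apply: ld_hom; apply: raddfB. Qed.

Lemma lequi_d c : lequi c -> lequi (fun s => d (c s)).
Proof. by move=> cE g s; rewrite cE dG. Qed.

Variables (E : nat -> gmodType G) (sct : forall l, {additive E l -> C}).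
Hypothesis sctG : forall l g u, sct l (gmod_act g u) = gmod_act g (sct l u).
Hypothesis sctA : forall l u, A l.+1 (sct l u).
Hypothesis d_sct : forall l u, d (sct l u) = 0.
Hypothesis sct_surj : forall l z, A l.+1 z -> d z = 0 ->
  exists a u, A l a /\ z = d a + sct l u.
Hypothesis sct_inj : forall l a u, A l a -> sct l u = d a -> u = 0.

Lemma sct_ld l (c : seq G -> E l) s :
  sct l (ld c s) = ld (fun r => sct l (c r)) s.
Proof. by apply: ld_hom; apply: raddfB. Qed.

Lemma split_lift l i (c : seq G -> C) : lequi c ->
  (forall s, size s = i.+1 -> A l.+1 (c s) /\ d (c s) = 0) ->
  exists a (u : seq G -> E l), [/\ lequi a, forall s, A l (a s), lequi u,
    u [::] = 0 & forall s, size s = i.+1 -> c s = d (a s) + sct l (u s)].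
Proof.
move=> cE cA.
have [||a [aE aR a0]] := @lequi_lift G C C
    (fun x y => A l y /\ exists u, x = d y + sct l u) i c cE.
- move=> g x y [Ay [u ->]]; split; first exact: A_G.
  by exists (gmod_act g u); rewrite dG sctG raddfD.
- move=> s sn; have [sA s0] := cA s sn.
  by have [y [u [Ay ->]]] := sct_surj sA s0; exists y; split=> //; exists u.
have [||u [uE uR u0]] := @lequi_lift G C (E l) (fun x u => x = sct l u) i
    _ (lequiB cE (lequi_d aE)).
- by move=> g x u ->; rewrite sctG.
- by move=> s /aR [_ [u ->]]; exists u; rewrite addrC addKr.
exists a, u; split=> // [s||s sn]; last by rewrite -uR // addrC subrK.
  have [/aR[]//|/eqP/a0->] := eqVneq (size s) i.+1; exact: A_0.
exact: u0.
Qed.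

(* The class of c, a G-cocycle of degree i with values in the d-cocycles of
   A n, is successively moved down the filtration: u l is its component in
   H^(i + n - 1 - l)(G, E l). *)
Fixpoint splits n i (c : seq G -> C) (u : forall l, seq G -> E l) : Prop :=
  if n is n'.+1 then
    exists a, [/\ lequi a, forall s, A n' (a s),
      forall s, size s = i.+1 -> c s = d (a s) + sct n' (u n' s) &
      splits n' i.+1 (ld a) u]
  else forall s, size s = i.+1 -> c s = 0.

Lemma eq_splits n i c c' u u' :
  (forall s, size s = i.+1 -> c s = c' s) -> (forall l, (l < n)%N -> u l = u' l) ->
  splits n i c u -> splits n i c' u'.
Proof.
elim: n i c c' => [|n IH] i c c' cc' uu' /=.
  by move=> c0 s sn; rewrite -cc' ?c0.
move=> [a [aE aA ca ra]]; exists a; split=> // [s sn|].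
  by rewrite -cc' // ca // uu'.
by apply: IH ra => // l /ltnW l_lt; apply: uu'.
Qed.

Lemma splitsB n i c c' u u' : splits n i c u -> splits n i c' u' ->
  splits n i (fun s => c s - c' s) (fun l s => u l s - u' l s).
Proof.
elim: n i c c' => [|n IH] i c c' /=.
  by move=> c0 c'0 s sn; rewrite c0 // c'0 // subr0.
move=> [a [aE aA ca ra]] [a' [a'E a'A ca' ra']].
exists (fun s => a s - a' s); split=> [|s|s sn|].
- exact: lequiB.
- exact: A_B.
- rewrite ca // ca' // !raddfB /=. abel.
- by apply: eq_splits (IH _ _ _ ra ra') => // s sn; rewrite ldB.
Qed.

Definition cocyc n i (c : seq G -> C) :=
  [/\ lequi c, forall s, size s = i.+1 -> A n (c s) /\ d (c s) = 0 &
      forall s, size s = i.+2 -> ld c s = 0].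

Definition cocycE l i (u : seq G -> E l) :=
  lequi u /\ forall s, size s = i.+2 -> ld u s = 0.

Lemma splits_exists n i c : cocyc n i c ->
  exists2 u, splits n i c u &
    forall l, (l < n)%N -> cocycE (i + n - l.+1) (u l).
Proof.
elim: n i c => [|n IH] i c [cE cA c0].
  exists (fun _ _ => 0) => // s sn; exact: A_nil (cA s sn).1.
have [a [v [aE aA vE _ cav]]] := split_lift cE cA.
have dld s : size s = i.+2 -> d (ld a s) + sct n (ld v s) = 0.
  move=> sn; rewrite -(c0 s sn) d_ld sct_ld -ldD.
  by apply: ld_eq_size sn => r rn; rewrite cav.
(* By [dld], the section of [ld v s] is the d-boundary of [- ld a s], so [ld v s], which is its
   class, vanishes. *)
have v0 s : size s = i.+2 -> ld v s = 0.
  move=> sn; apply: (@sct_inj _ (- ld a s)); first exact/A_N/A_ld.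
  by apply/eqP; rewrite raddfN -subr_eq0 opprK addrC dld.
have [|u su uC] := IH i.+1 (ld a).
  split=> [|s sn|s _]; [exact: lequi_ld | split; first exact: A_ld | exact: ld_ld].
  by rewrite -(dld s sn) v0 // raddf0 addr0.
exists (dfwith u v) => [|l].
  exists a; split=> // [s sn|]; first by rewrite dfwith_in cav.
  by apply: eq_splits su => // l l_lt; rewrite dfwith_out // neq_ltn l_lt ?orbT.
rewrite ltnS leq_eqVlt => /predU1P[->|l_lt].
  by rewrite dfwith_in addnK; split.
rewrite dfwith_out; last by rewrite neq_ltn l_lt ?orbT.
by rewrite -addSnnS; apply: uC.
Qed.

(** Inverse to [splits_exists]: the cocycle found one level down bounds some a in the acyclic
    module, and [d a] plus the prescribed component is the cocycle one level up. *)
Lemma exists_splits n i u :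
  (forall l, (l < n)%N -> cocycE (i + n - l.+1) (u l)) ->
  exists2 c, cocyc n i c & splits n i c u.
Proof.
elim: n i => [|n IH] i uC.
  exists (fun=> 0) => //; split=> [g s|s _|s _]; rewrite ?raddf0 ?ld0 //.
have [|c [cE cA c0] cu] := IH i.+1.
  by move=> l l_lt; rewrite addSnnS; apply: uC; apply: ltnW.
have [a [aE aA ca]] := A_exact_at cE (fun s sn => (cA s sn).1) c0.
have [uE] := uC n (ltnSn n); rewrite addnS subSS addnK => u0.
exists (fun s => d (a s) - sct n (- u n s)).
  split=> [|s sn|s sn].
  - apply: lequiB; first exact: lequi_d.
    by move=> g s; rewrite uE -sctG -raddfN.
  - split; first by apply: A_B => //; apply: A_d.
    by rewrite raddfB /= dd d_sct subrr.
  - rewrite ldB -d_ld -ca // (cA s sn).2 sub0r -sct_ld.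
    by rewrite ldN u0 // !raddf0.
exists a; split=> // [s sn|]; first by rewrite raddfN opprK.
by apply: eq_splits cu => // s sn; rewrite ca.
Qed.

(** For i = 0, [ld b [:: g]] is [b [::]], so what is divided out in degree 0 is d of the invariants.
    For d-closed invariants this leaves the cohomology of Gamma. *)
Definition cob n i (c : seq G -> C) := exists b F,
  [/\ lequi b, forall s, s <> [::] -> A n (b s) /\ d (b s) = 0,
      [/\ A n.-1 F, forall g, gmod_act g F = F & b [::] = d F] &
      forall s, size s = i.+1 -> c s = ld b s].

Definition cobE l i (u : seq G -> E l) := exists h,
  [/\ lequi h, h [::] = 0 & forall s, size s = i.+1 -> u s = ld h s].

Lemma ld_dsct l (a : seq G -> C) (u : seq G -> E l) s :
  ld (fun r => d (a r) + sct l (u r)) s = d (ld a s) + sct l (ld u s).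
Proof.
by rewrite d_ld sct_ld ldD.
Qed.

Lemma cob_splits n i c u : splits n i c u -> cob n i c ->
  forall l, (l < n)%N -> cobE (i + n - l.+1) (u l).
Proof.
elim: n i c => [|n IH] i c //= [a [aE aA ca ra]].
move=> [b [F [bE bA [FA FG bF] cb]]].
have [a' [u' [a'E a'A u'E u'0 bau]]] : exists a' (u' : seq G -> E n),
    [/\ lequi a', forall s, A n (a' s), lequi u', u' [::] = 0 &
        forall s, size s = i -> b s = d (a' s) + sct n (u' s)].
  case: i {a aE aA ca ra cb} => [|i]; last first.
    by apply: split_lift => // s sn; apply: bA => s0; rewrite s0 in sn.
  (* In degree 0 the primitive of [b [::]] is the invariant F, with no component in [E n]. *)
  exists (fun s => if s is [::] then F else 0), (fun=> 0); split=> //.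
  - by move=> g [|h s] /=; rewrite ?FG ?raddf0.
  - by case=> [|h s] //; apply: A_0.
  - by move=> g s; rewrite raddf0.
  - by move=> s /size0nil ->; rewrite raddf0 addr0.
have eq_ld s : size s = i.+1 ->
    d (a s) + sct n (u n s) = d (ld a' s) + sct n (ld u' s).
  by move=> sn; rewrite -ca // cb // -ld_dsct; apply: ld_eq_size sn.
have uE s : size s = i.+1 -> u n s = ld u' s.
  move=> sn; apply: subr0_eq; apply: (@sct_inj _ (ld a' s - a s)).
    by apply: A_B => //; apply: A_ld.
  rewrite !raddfB /=; move: (eq_ld s sn) => /(congr1 (fun x => x - d (a s))).
  by rewrite [X in X - _ = _]addrC addrK => ->; abel.
have a0 s : size s = i.+1 -> d (a s - ld a' s) = 0.
  move=> sn; move: (eq_ld s sn); rewrite uE // => /addIr.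
  by rewrite raddfB /= => ->; rewrite subrr.
move=> l; rewrite ltnS leq_eqVlt => /predU1P[->|l_lt].
  by rewrite addnS subSS addnK; exists u'.
rewrite -addSnnS; apply: IH ra _ l l_lt.
(* [ld a] is also the differential of [a - ld a'], which is d-closed in length i + 1; the truncation
   discards the lengths where this is not known. *)
exists (ltrunc i.+1 (fun s => a s - ld a' s)), 0; split.
- by apply/lequi_ltrunc/lequiB => //; apply: lequi_ld.
- move=> s _; split; last first.
    by rewrite /ltrunc; case: eqP => [/a0|_]; rewrite ?raddf0.
  by apply: A_ltrunc => r _; apply: A_B => //; apply: A_ld.
- by rewrite raddf0; split=> [|g|]; rewrite ?raddf0 //; apply: A_0.
- by move=> s sn; rewrite ld_ltrunc /ltrunc sn eqxx ldB ld_ld subr0.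
Qed.

Lemma splits_cob n i c u : splits n i c u ->
  (forall l, (l < n)%N -> cobE (i + n - l.+1) (u l)) -> cob n i c.
Proof.
elim: n i c => [|n IH] i c /=.
  move=> c0 _; exists (fun=> 0), 0; split=> [g s|s _||s sn].
  - by rewrite raddf0.
  - by rewrite raddf0; split=> //; apply: A_0.
  - by rewrite raddf0; split=> // g; rewrite raddf0.
  - by rewrite c0 // ld0.
move=> [a [aE aA ca ra]] uB.
have [|b [F [bE bA _ ab]]] := IH _ _ ra.
  by move=> l l_lt; rewrite addSnnS; apply: uB; apply: ltnW.
have [u' [u'E u'0]] := uB n (ltnSn n); rewrite addnS subSS addnK => uu'.
have bA' s : size s = i.+1 -> A n (b s) /\ d (b s) = 0.
  by move=> sn; apply: bA => s0; rewrite s0 in sn.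
have [||a' [a'E a'A aba']] := @A_exact_at n i _ (lequiB aE bE).
- by move=> s sn; apply: A_B => //; case: (bA' s sn).
- by move=> s sn; rewrite ldB ab // subrr.
exists (fun s => d (a' s) + sct n (u' s)), (a' [::]); split.
- by move=> g s; rewrite a'E u'E dG sctG raddfD.
- move=> s _; split; first by apply: A_D => //; apply: A_d.
  by rewrite raddfD /= dd d_sct addr0.
- split=> // [g|]; first by rewrite -a'E.
  by rewrite u'0 raddf0 addr0.
- move=> s sn; rewrite ld_dsct -aba' // -uu' // ca // raddfB /=.
  by rewrite (bA' s sn).2 subr0.
Qed.

Section Assemble.
Variables (k : nat) (X : zmodType) (rep : C -> X -> Prop).

Definition inv_cocycle F :=
  [/\ A k.+1 F, d F = 0 & forall g, gmod_act g F = F].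
Hypothesis rep_exists : forall x, exists2 F, inv_cocycle F & rep F x.
Hypothesis exists_rep : forall F, inv_cocycle F -> exists x, rep F x.
Hypothesis repB : forall F F' x x', rep F x -> rep F' x' -> rep (F - F') (x - x').
Hypothesis rep0P : forall F x, rep F x -> x = 0 <->
  exists2 F', A k F' /\ (forall g, gmod_act g F' = F') & F = d F'.

Lemma cohomology_splitting :
  zmod_isom X (dirsum (fun j : 'I_k.+1 => cohomology (E j) (k - j))).
Proof.
pose R x (y : dirsum (fun j : 'I_k.+1 => cohomology (E j) (k - j))) :=
  exists F u, [/\ rep F x, splits k.+1 0 (fun=> F) u &
    forall j : 'I_k.+1, represents (u j) (y j)].
apply: (zmod_isom_of_rel (R := R)) => [x|y|||].
- have [F [FA Fd FG] Fx] := rep_exists x.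
  have [|u su uC] := @splits_exists k.+1 0 (fun=> F).
    by split=> [g s|s _|[|g [|h []]] //= _]; rewrite ?FG ?subr0 ?subrr.
  have yP (j : 'I_k.+1) : exists y : cohomology (E j) (k - j), represents (u j) y.
    have [uE u0] := uC j (ltn_ord j).
    by apply: cocycle_represents => // s sn; apply: u0; rewrite sn add0n subSS.
  exists (fun j => sval (cid (yP j))), F, u; split=> // j.
  exact: svalP (cid (yP j)).
- have uP l : exists u : seq G -> E l,
      forall l_lt : (l < k.+1)%N, represents u (y (Ordinal l_lt)).
    have [l_lt|l_ge] := EM (l < k.+1)%N; last first.
      by exists (fun=> 0) => l_lt; case: l_ge.
    have [u uy] := represents_exists (y (Ordinal l_lt)); exists u => l_lt'.
    by rewrite (bool_irrelevance l_lt' l_lt).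
  pose u l := sval (cid (uP l)).
  have uy (j : 'I_k.+1) : represents (u j) (y j).
    by case: j => l l_lt; apply: svalP (cid (uP l)) l_lt.
  have [|c [cE cA c0] cu] := @exists_splits k.+1 0 u.
    move=> l l_lt; split; first exact: represents_lequi (uy (Ordinal l_lt)).
    by move=> s sn; apply: represents_cocycle (uy (Ordinal l_lt)) _ _; rewrite sn add0n subSS.
  (* A G-cocycle of degree 0 is constant, so its value is an invariant. *)
  have c1 g : c [:: g] = c [:: 1%g].
    have := c0 [:: 1%g; g] erefl; rewrite /= !subr0.
    by move=> /subr0_eq/esym/esym.
  have F_inv : inv_cocycle (c [:: 1%g]).
    by have [] := cA [:: 1%g] erefl; split=> // g; rewrite -cE /= c1.
  have [x Fx] := exists_rep F_inv; exists x, (c [:: 1%g]), u; split=> //.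
  by apply: eq_splits cu => // [[|g []]] //= _; rewrite c1.
- move=> x y x' y' [F [u [Fx Fu uy]]] [F' [u' [F'x' Fu' uy']]].
  exists (F - F'), (fun l s => u l s - u' l s); split; first exact: repB.
    exact: splitsB.
  by move=> j; apply: representsB.
- move=> y [F [u [F0 Fu uy]]]; apply/functional_extensionality_dep => j.
  apply/(represents0P (uy j)).
  have [F' [F'A F'G] FF'] := (rep0P F0).1 erefl.
  have [|h hP] := @cob_splits k.+1 0 (fun=> F) u Fu _ j (ltn_ord j); last first.
    by exists h; move: hP; rewrite add0n subSS.
  exists (fun s => if s is [::] then F else 0), F'; split=> //.
  - by move=> g [|h s] /=; rewrite ?raddf0 // FF' -dG F'G.
  - by case=> [|g s] // _; rewrite raddf0; split=> //; apply: A_0.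
  - by case=> [|g []] //= _; rewrite subr0.
- move=> x [F [u [Fx Fu uy]]]; apply/(rep0P Fx).
  have [|b [F' [bE bA [F'A F'G bF'] Fb]]] := @splits_cob k.+1 0 (fun=> F) u Fu.
    move=> l l_lt; have [h hP] := (represents0P (uy (Ordinal l_lt))).1 erefl.
    by exists h; rewrite add0n subSS.
  by exists F'; rewrite // (Fb [:: 1%g]) //= subr0 bF'.
Qed.

End Assemble.
End Filtered.

(** * Evaluation of cocycles on a lattice *)

Section Evaluation.
Variables (L : zmodType) (Y : Type) (y0 : Y).
Implicit Types (x y b : L) (a : L * Y) (s : seq (L * Y)) (xs : seq L).
Implicit Types f h : seq (L * Y) -> int.

Definition tau x a : L * Y := (x + a.1, a.2).

(* Evaluation of a cochain on the cube spanned by xs, cut into simplices. *)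
Fixpoint lev xs f : int :=
  if xs is x :: xs' then lev xs' (prism (tau x) f) else f [:: (0, y0)].

Definition tinv x f := forall s, f (map (tau x) s) = f s.

Lemma tauD x y a : tau x (tau y a) = tau (x + y) a.
Proof. by rewrite /tau /= addrA. Qed.

Lemma tau0 a : tau 0 a = a.
Proof. by case: a => x g; rewrite /tau /= add0r. Qed.

Lemma map_tauD x y s : map (tau x) (map (tau y) s) = map (tau (x + y)) s.
Proof. by rewrite -map_comp; apply: eq_map => a /=; rewrite tauD. Qed.

Lemma map_tau0 s : map (tau 0) s = s.
Proof. by rewrite -[RHS]map_id; apply: eq_map => a; rewrite tau0. Qed.

Lemma tinv_prism x y f : tinv y f -> tinv y (prism (tau x) f).
Proof.
move=> fy s; rewrite map_prism => [|a]; last by rewrite !tauD addrC.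
by congr prism; apply/funext => r; apply: fy.
Qed.

Lemma tinv_ld x f : tinv x f -> tinv x (ld f).
Proof. by move=> fx s; rewrite -ld_map; congr ld; apply/funext => r; apply: fx. Qed.

Lemma tinvB x f h : tinv x f -> tinv x h -> tinv x (fun s => f s - h s).
Proof. by move=> fx hx s; rewrite fx hx. Qed.

Lemma levB xs f h : lev xs (fun s => f s - h s) = lev xs f - lev xs h.
Proof.
elim: xs f h => [|x xs IH] f h //=; rewrite -IH; congr lev.
by apply/funext => s; rewrite prismB.
Qed.

Lemma lev0 xs : lev xs (fun=> 0) = 0.
Proof.
by rewrite -[RHS](subrr (lev xs (fun=> 0))) -levB; congr lev.
Qed.

Lemma levN xs f : lev xs (fun s => - f s) = - lev xs f.
Proof.
rewrite -[RHS]sub0r -(lev0 xs) -levB; congr lev; apply/funext => s.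
by rewrite sub0r.
Qed.

Lemma levD xs f h : lev xs (fun s => f s + h s) = lev xs f + lev xs h.
Proof.
rewrite -[in RHS](opprK (lev xs h)) -levN -levB; congr lev; apply/funext => s.
by rewrite opprK.
Qed.

Lemma lev_eq_size xs f h : (forall s, size s = (size xs).+1 -> f s = h s) ->
  lev xs f = lev xs h.
Proof.
elim: xs f h => [|x xs IH] f h fh /=; first exact: fh.
by apply: IH => s; apply: prism_eq_size.
Qed.

Lemma prism_ld x f : tinv x f ->
  prism (tau x) (ld f) = fun s => - ld (prism (tau x) f) s.
Proof.
move=> fx; apply/funext => s; apply/eqP; rewrite -addr_eq0 addrC.
by rewrite prism_homotopy fx subrr.
Qed.

Lemma lev_ld xs f : (forall x, x \in xs -> tinv x f) -> f [::] = 0 ->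
  lev xs (ld f) = 0.
Proof.
elim: xs f => [|x xs IH] f fx f0 /=; first by rewrite f0 subr0.
rewrite prism_ld; last by apply: fx; rewrite mem_head.
rewrite levN IH ?oppr0 // => y yxs; apply: tinv_prism.
by apply: fx; rewrite inE yxs orbT.
Qed.

Definition dual_pair (bc bc' : L * {additive L -> int}) :=
  (bc.2 bc'.1 == 0) && (bc'.2 bc.1 == 0).

Fixpoint dual_system (bs : seq (L * {additive L -> int})) : Prop :=
  if bs is bc :: bs' then
    [/\ bc.2 bc.1 = 1, all (dual_pair bc) bs' & dual_system bs']
  else True.

(** Sum f along the direction b, starting from the hyperplane c = 0; the c-coordinate of the first
    vertex gives the number of summands. Translations that preserve c preserve the construction. *)
Lemma tinv_primitive b (c : {additive L -> int}) f : c b = 1 -> f [::] = 0 ->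
  exists h, [/\ forall s, h (map (tau b) s) - h s = f s, h [::] = 0 &
    forall x, c x = 0 -> tinv x f -> tinv x h].
Proof.
move=> cb f0.
pose P (z : int) (s : seq (L * Y)) : int := match z with
  | Posz n => \sum_(i < n) f (map (tau (- (b *+ i.+1))) s)
  | Negz n => - \sum_(i < n.+1) f (map (tau (b *+ i)) s)
  end.
pose h (s : seq (L * Y)) : int := if s is a :: _ then P (c a.1) s else 0.
have PS z s : P (1 + z) (map (tau b) s) - P z s = f s.
  case: z => [n|[|n]].
  - rewrite -PoszD add1n /P big_ord_recl map_tauD mulr1n addNr map_tau0 -addrA.
    rewrite -[RHS]addr0; congr (_ + _); rewrite -sumrB big1 // => i _.
    by rewrite map_tauD [b *+ _.+1]mulrSr opprD -addrA addNr addr0 subrr.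
  - by rewrite (_ : 1 + Negz 0 = Posz 0) // /P !big_ord_recl !big_ord0 mulr0n addr0 sub0r opprK map_tau0.
  - have -> : 1 + Negz n.+1 = Negz n by lia.
    rewrite /P.
    rewrite [in X in _ - X]big_ord_recl mulr0n map_tau0 opprK addrCA -[RHS]addr0.
    congr (_ + _); apply/eqP; rewrite addrC subr_eq0; apply/eqP.
    by apply: eq_bigr => i _; rewrite map_tauD mulrSr.
exists h; split=> //; first by case=> [|a s]; [rewrite f0 | rewrite -(PS (c a.1)) -cb -raddfD].
move=> x cx fx; case=> [//|a s].
rewrite -[RHS]/(P (c a.1) (a :: s)).
rewrite -[LHS]/(P (c (x + a.1)) (map (tau x) (a :: s))) raddfD cx add0r.
have fE y : f (map (tau y) (map (tau x) (a :: s))) = f (map (tau y) (a :: s)).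
  by rewrite map_tauD addrC -map_tauD fx.
by rewrite /P; case: (c a.1) => n; [|congr (- _)]; apply: eq_bigr => i _; apply: fE.
Qed.

(** Induction on the rank. A primitive a that is invariant under the other basis vectors fails to be
    b-invariant by a cocycle e, whose evaluations are those of f on cubes with an edge b. So e
    bounds some a', and correcting a by the differential of a primitive of a' in the direction b
    restores the invariance. *)
Lemma lev_exact bs f : dual_system bs ->
  (forall b, b \in unzip1 bs -> tinv b f) -> (forall s, ld f s = 0) ->
  (forall xs, subseq xs (unzip1 bs) -> lev xs f = 0) ->
  exists h, [/\ forall b, b \in unzip1 bs -> tinv b h, h [::] = 0 & f = ld h].
Proof.
elim: bs f => [|[b c] bs IH] f /=.
  (* The cone with apex (0, y0); evaluation on the empty cube is the value of f at this apex. *)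
  move=> _ _ f0 fe; exists (fun s => f ((0, y0) :: s)); split=> //.
    exact: (fe [::]).
  by apply/funext => s; apply: subr0_eq (f0 ((0, y0) :: s)).
move=> [/= cb cbs bsd] finv f0 fe.
have binv x : x \in unzip1 bs -> tinv x f.
  by move=> xbs; apply: finv; rewrite inE xbs orbT.
have [a [ainv a0 fa]] : exists h,
    [/\ forall x, x \in unzip1 bs -> tinv x h, h [::] = 0 & f = ld h].
  apply: IH => // xs xss; apply: fe.
  exact: subseq_trans xss (subseq_cons _ _).
pose e s := a (map (tau b) s) - a s.
have eE : e = fun s => ld (prism (tau b) a) s + prism (tau b) f s.
  by apply/funext => s; rewrite fa prism_homotopy.
have einv x : x \in unzip1 bs -> tinv x e.
  move=> xbs s; rewrite /e (ainv x xbs s); congr (_ - _).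
  by rewrite map_tauD addrC -map_tauD (ainv x).
have ld_e s : ld e s = 0.
  by rewrite /e ldB ld_map -fa finv ?mem_head // subrr.
have [|a' [a'inv a'0 ea']] := IH e bsd einv ld_e.
  move=> xs xss; rewrite eE levD lev_ld ?add0r //.
  - by apply: (fe (b :: xs)); rewrite /= eqxx.
  - by move=> x xxs; apply/tinv_prism/ainv; apply: (mem_subseq xss).
have [h [hb h0 hinv]] := tinv_primitive cb a'0.
have c0 x : x \in unzip1 bs -> c x = 0.
  elim: bs cbs {IH bsd finv fe binv ainv einv a'inv} => //= bc bs IHb.
  by case/andP=> /andP[/eqP cb' _] /IHb cbs; rewrite inE => /predU1P[->|/cbs].
exists (fun s => a s - ld h s); split.
- move=> x; rewrite inE => /predU1P[->|xbs] s; last first.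
    congr (_ - _); first exact: ainv.
    by apply/tinv_ld/hinv; [apply: c0 | apply: a'inv].
  apply/eqP; rewrite -subr_eq0; apply/eqP.
  have -> : a (map (tau b) s) = e s + a s by rewrite /e subrK.
  rewrite ea' -(ld_map (tau b)).
  transitivity (ld a' s - ld (fun r => h (map (tau b) r) - h r) s).
    by rewrite ldB; abel.
  have -> : (fun r => h (map (tau b) r) - h r) = a' by apply/funext => r.
  exact: subrr.
- by rewrite a0 subr0.
- by apply/funext => s; rewrite ldB ld_ld subr0 fa.
Qed.

End Evaluation.

(** * Alternating maps and exterior powers *)

Lemma nmod_morph0 (U V : zmodType) (h : U -> V) :
  {morph h : x y / x - y} -> h 0 = 0.
Proof. by move=> hB; rewrite -[X in h X](subrr 0) hB subrr. Qed.

Section Contraction.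
Variables (T : Type) (V : zmodType).
Implicit Types (f : T -> int) (b : seq T -> V) (s : seq T).

(* Contraction with a covector f, as in the Laplace expansion of a determinant. *)
Fixpoint lder f b s : V :=
  if s is x :: s' then b s' *~ f x - lder f (fun r => b (x :: r)) s' else 0.

Lemma lderB f b b' s : lder f (fun r => b r - b' r) s = lder f b s - lder f b' s.
Proof.
elim: s b b' => [|x s IH] b b' /=; first by rewrite subr0.
by rewrite IH mulrzBl; abel.
Qed.

Lemma lder0 f s : lder f (fun=> 0) s = 0.
Proof. by elim: s => [|x s IH] //=; rewrite IH mul0rz subr0. Qed.

Lemma eq_lder f b b' : b =1 b' -> lder f b =1 lder f b'.
Proof. by move=> /funext ->. Qed.

Lemma lderDl f g b s : lder (fun x => f x + g x) b s = lder f b s + lder g b s.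
Proof.
elim: s b => [|x s IH] b /=; first by rewrite addr0.
by rewrite IH mulrzDr; abel.
Qed.

Lemma eq_lder_size n f b b' : (forall s, size s = n -> b s = b' s) ->
  forall s, size s = n.+1 -> lder f b s = lder f b' s.
Proof.
move=> bb s; elim: s n b b' bb => [|x s IH] n b b' bb //= [sn].
rewrite bb //; congr (_ - _); case: n sn bb => [|n] sn bb.
  by rewrite (size0nil sn).
by apply: (IH n) => // r rn; apply: bb; rewrite /= rn.
Qed.

Lemma lder_lder f b s : lder f (lder f b) s = 0.
Proof.
elim: s b => [|x s IH] b //=.
rewrite lderB IH subr0; apply/eqP; rewrite subr_eq0; apply/eqP.
elim: s b {IH} => [|y s IH] b /=; first by rewrite mul0rz.
by rewrite mulrzBl -IH -!mulrzA [f x * _]mulrC.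
Qed.

Lemma lderN f b s : lder f (fun r => - b r) s = - lder f b s.
Proof.
rewrite -[RHS]sub0r -(lder0 f s) -lderB.
by apply: eq_lder => r; rewrite sub0r.
Qed.

Lemma lderD f b b' s : lder f (fun r => b r + b' r) s = lder f b s + lder f b' s.
Proof.
rewrite -[in RHS](opprK (lder f b' s)) -lderN -lderB.
by apply: eq_lder => r; rewrite opprK.
Qed.

End Contraction.

Lemma lder_hom (T : Type) (V W : zmodType) (h : V -> W) f (b : seq T -> V) s :
  {morph h : x y / x - y} -> h (lder f b s) = lder f (fun r => h (b r)) s.
Proof.
move=> hB; have h0 := nmod_morph0 hB.
elim: s b => [|x s IH] b //=; rewrite hB IH; congr (_ - _).
exact: morph_mulrz.
Qed.

Lemma lder_map (T U : Type) (V : zmodType) (h : U -> T) f (b : seq T -> V) s :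
  lder (fun x => f (h x)) (fun r => b (map h r)) s = lder f b (map h s).
Proof. by elim: s b => [|x s IH] b //=; rewrite (IH (fun r => b (h x :: r))). Qed.

Lemma lder_comm (T U : Type) (V : zmodType) (f : T -> int) (g : U -> int)
    (b : seq U -> seq T -> V) us xs :
  lder f (fun ys => lder g (fun vs => b vs ys) us) xs =
  lder g (fun vs => lder f (b vs) xs) us.
Proof.
elim: us b => [|u us IH] b /=; first exact: lder0.
rewrite lderB (IH (fun vs => b (u :: vs))); congr (_ - _).
rewrite (lder_hom (h := fun z => z *~ g u)) // => x y; exact: mulrzBl.
Qed.

Section Alternating.
Variables (X V : zmodType).
Implicit Types (b : seq X -> V) (s : seq X) (x y : X).

(** Defined on lists of all lengths, so that b may have components of several degrees. *)
Definition alternating b :=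
  (forall s1 s2 x y, b (s1 ++ (x + y) :: s2) = b (s1 ++ x :: s2) + b (s1 ++ y :: s2))
  /\ forall s1 s2 x, b (s1 ++ [:: x, x & s2]) = 0.

Lemma alternating_cons b x : alternating b -> alternating (fun s => b (x :: s)).
Proof.
by case=> bD b0; split=> [s1 s2 y z|s1 s2 y]; [apply: (bD (x :: s1)) | apply: (b0 (x :: s1))].
Qed.

Lemma alternating_swap b : alternating b -> forall s1 s2 x y,
  b (s1 ++ [:: x, y & s2]) = - b (s1 ++ [:: y, x & s2]).
Proof.
move=> [bD b0] s1 s2 x y; apply/eqP; rewrite -addr_eq0; apply/eqP.
have bD1 u v w : b (s1 ++ [:: w, u + v & s2]) =
    b (s1 ++ [:: w, u & s2]) + b (s1 ++ [:: w, v & s2]).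
  by move: (bD (rcons s1 w) s2 u v); rewrite !cat_rcons.
by move: (b0 s1 s2 (x + y)); rewrite bD !bD1 !b0 add0r addr0.
Qed.

Lemma alternating_z b : alternating b -> forall s1 s2 x k,
  b (s1 ++ (x *~ k) :: s2) = b (s1 ++ x :: s2) *~ k.
Proof.
move=> [bD _] s1 s2 x k; pose h y := b (s1 ++ y :: s2).
have hD : zmod_morphism h.
  by move=> u v; apply: (addIr (h v)); rewrite subrK -[LHS]bD subrK.
exact: (morph_mulrz hD).
Qed.

Lemma alternating_0 b : alternating b -> forall s1 s2, b (s1 ++ 0 :: s2) = 0.
Proof. by move=> ba s1 s2; rewrite -(mulr0z 0) alternating_z. Qed.

Lemma alternating_dup b : alternating b -> forall s1 s2 s3 x,
  b (s1 ++ x :: s2 ++ x :: s3) = 0.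
Proof.
move=> ba s1 s2 s3 x; elim: s2 s1 => [|y s2 IH] s1; first exact: ba.2.
rewrite /= alternating_swap //; have := IH (rcons s1 y).
by rewrite cat_rcons => ->; rewrite oppr0.
Qed.

Lemma alternatingB b b' : alternating b -> alternating b' ->
  alternating (fun s => b s - b' s).
Proof.
move=> [bD b0] [b'D b'0]; split=> [s1 s2 x y|s1 s2 x].
  by rewrite bD b'D; abel.
by rewrite b0 b'0 subr0.
Qed.

Lemma alternating_lder f b :
  (forall x y, f (x + y) = f x + f y) -> alternating b -> alternating (lder f b).
Proof.
move=> fD; split.
  move=> s1; elim: s1 b H => [|z s1 IH] b [bD b0] s2 x y /=.
    rewrite fD mulrzDr.
    have -> : (fun r => b (x + y :: r)) = fun r => b (x :: r) - (- b (y :: r)).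
      by apply/funext => r; rewrite opprK; apply: (bD [::]).
    by rewrite lderB lderN; abel.
  by rewrite bD mulrzDl IH; [abel | apply: alternating_cons].
move=> s1; elim: s1 b H => [|z s1 IH] b [bD b0] s2 x /=.
  have -> : (fun r => b [:: x, x & r]) = fun=> 0 by apply/funext => r; apply: (b0 [::]).
  by rewrite lder0 subr0 subrr.
by rewrite b0 mul0rz IH ?subr0 //; apply: alternating_cons.
Qed.

(** Terms with two entries c vanish. Since [proj] and [coproj] are sums of such rank-one terms, this
    peels off one basis vector at a time. *)
Lemma alternating_expand (T : Type) b (f : T -> int) (h : T -> X) (c : X)
    (s : seq T) :
  alternating b ->
  b (map (fun t => h t + c *~ f t) s) =
    b (map h s) + lder f (fun r => b (c :: map h r)) s.
Proof.
elim: s b => [|x s IH] b ba /=; first by rewrite addr0.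
rewrite (ba.1 [::]) (alternating_z ba [::]) /=.
rewrite (IH (fun r => b (h x :: r))); last exact: alternating_cons.
rewrite (IH (fun r => b (c :: r))); last exact: alternating_cons.
have -> : (fun r => b [:: c, c & map h r]) = fun=> 0.
  by apply/funext => r; apply: (ba.2 [::]).
have -> : (fun r => b [:: h x, c & map h r]) = fun r => - b [:: c, h x & map h r].
  by apply/funext => r; apply: (alternating_swap ba [::]).
by rewrite lder0 lderN addr0 addrAC addrA.
Qed.

End Alternating.

Lemma alternating_map (X Y V : zmodType) (h : Y -> X) (b : seq X -> V) :
  (forall x y, h (x + y) = h x + h y) ->
  alternating b -> alternating (fun s => b (map h s)).
Proof.
move=> hD [bD b0]; split=> [s1 s2 x y|s1 s2 x]; rewrite !map_cat /=.
  by rewrite hD bD.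
by rewrite b0.
Qed.

Section ExtPower.
Variables (j : nat) (M : zmodType).
Local Notation E := (ext_power j M).

(** The value 0 in wrong lengths makes this an alternating map on all lists. *)
Definition wdg (s : seq M) : E :=
  if size s == j then \pi_E << fun i : 'I_j => nth 0 s i >> else 0.

Lemma pi_ext_rel u : ext_rel u -> \pi_E u = 0.
Proof.
move=> u_rel; rewrite -[RHS](raddf0 (\pi_E)).
by apply/eqP; rewrite -Quotient.idealrBE subr0; apply: sub_zspan.
Qed.

Lemma wdg_size s : size s != j -> wdg s = 0.
Proof. by rewrite /wdg => /negPf ->. Qed.

Lemma alternating_wdg : alternating wdg.
Proof.
split=> [s1 s2 x y|s1 s2 x]; rewrite /wdg !size_cat /=; case: eqP => sj; rewrite ?addr0 //.
  have s1_lt : (size s1 < j)%N by rewrite -sj -addSnnS leq_addr.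
  suff /eqP : \pi_E (<< fun i : 'I_j => nth 0 (s1 ++ (x + y) :: s2) i >> -
    << fun i : 'I_j => nth 0 (s1 ++ x :: s2) i >> -
    << fun i : 'I_j => nth 0 (s1 ++ y :: s2) i >>) = 0.
    by rewrite !raddfB -addrA -opprD subr_eq0 => /eqP.
  apply/pi_ext_rel/(ExtAdd (i := Ordinal s1_lt)) => [|l il] /=.
    by rewrite !nth_cat ltnn subnn.
  have {il} : l != size s1 :> nat by apply: contraNneq il => lE; apply/eqP/val_inj.
  rewrite !nth_cat; case: ltngtP => // l_gt _.
  by case: (l - _)%N (subn_gt0 (size s1) l) => //; rewrite l_gt.
apply: pi_ext_rel.
have s1_lt : (size s1 < j)%N by rewrite -sj -addSnnS leq_addr.
have s1S_lt : ((size s1).+1 < j)%N by rewrite -sj -!addSnnS leq_addr.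
apply: (ExtAlt (i := Ordinal s1_lt) (l := Ordinal s1S_lt)).
  by rewrite -val_eqE /= neq_ltn ltnSn.
by rewrite /= !nth_cat ltnn subnn ltnNge leqnSn /= subSnn.
Qed.

Lemma ext_power_ind (P : E -> Prop) : P 0 ->
  (forall x y, P x -> P y -> P (x - y)) -> (forall s, size s = j -> P (wdg s)) ->
  forall x, P x.
Proof.
move=> P0 PB Pw; elim/quotW => u; rewrite -[u]freeg_sumE raddf_sum.
have PN x : P x -> P (- x) by move=> Px; rewrite -sub0r; apply: PB.
have PD x y : P x -> P y -> P (x + y).
  by move=> Px Py; rewrite -[y]opprK; apply/PB/PN.
elim/big_rec: _ => // x v _ Pv; apply: (PD) => //.
have -> : << coeff x u *g x >> = << x >> *~ coeff x u.
  by apply/eqP/freeg_eqP => y; rewrite raddfMz /= !coeffU mul1r -mulrzr intz mulrC.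
rewrite raddfMz /=.
have Px : P (\pi_E << x >>).
  have := Pw (lst x) (size_lst x); rewrite /wdg size_lst eqxx.
  by congr (P (\pi << _ >>)); apply/funext => i; rewrite nth_lst.
have PMn n : P ((\pi_E << x >>) *+ n).
  by elim: n => [|n IH]; rewrite ?mulr0n // mulrS; apply: PD.
by case: (coeff x u) => n; [apply: PMn | apply: PN].
Qed.

Section Lift.
Variables (V : zmodType) (b : seq M -> V).

Definition ext_lin (u : {freeg ('I_j -> M)}) : V :=
  fglift (fun x : 'I_j -> M => b (lst x) : zmodule V) u.

Lemma ext_linB : zmod_morphism ext_lin.
Proof.
move=> u v.
exact: (lift_is_additive (fun x : 'I_j -> M => b (lst x) : zmodule V)).
Qed.

Lemma ext_linU x : ext_lin << x >> = b (lst x).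
Proof. by rewrite /ext_lin liftU scale1r. Qed.

Definition ext_map (x : E) : V := ext_lin (repr x).

Hypothesis b_alt : alternating b.

Lemma ext_lin_zspan u : u \in zspan (@ext_rel j M) -> ext_lin u = 0.
Proof.
move=> /asboolP/(_ [pred v | ext_lin v == 0]) uP; apply/eqP/uP.
  split=> [|v w]; rewrite !inE ?(nmod_morph0 ext_linB) //.
  by rewrite ext_linB => /eqP-> /eqP->; rewrite subrr.
have lst_cat (x : 'I_j -> M) (i : 'I_j) :
    lst x = take i (lst x) ++ x i :: drop i.+1 (lst x).
  by rewrite -[LHS](cat_take_drop i) (drop_nth 0) ?size_lst // nth_lst.
have eq_lst (x y : 'I_j -> M) (i : 'I_j) : (forall l, l != i -> x l = y l) ->
    take i (lst x) = take i (lst y) /\ drop i.+1 (lst x) = drop i.+1 (lst y).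
  move=> xy; split; apply: (@eq_from_nth _ 0) => [|l]; rewrite ?size_take ?size_drop ?size_lst //.
    rewrite ltn_ord => l_lt; rewrite !nth_take //.
    have l_j := ltn_trans l_lt (ltn_ord i).
    by rewrite -[l]/(val (Ordinal l_j)) !nth_lst xy // -val_eqE neq_ltn l_lt.
  move=> l_lt; rewrite !nth_drop; have l_j : (i.+1 + l < j)%N by lia.
  rewrite -[(_ + l)%N]/(val (Ordinal l_j)) !nth_lst xy // -val_eqE /=.
  by rewrite neq_ltn addSn ltnS leq_addr orbT.
move=> _ [x y z i xE xl|x i l il xE]; rewrite inE; apply/eqP.
  rewrite !ext_linB !ext_linU (lst_cat x i) (lst_cat y i) (lst_cat z i) xE.
  have [-> ->] := eq_lst x y i (fun l li => (xl l li).1).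
  have [-> ->] : take i (lst z) = take i (lst y) /\
      drop i.+1 (lst z) = drop i.+1 (lst y).
    by apply: eq_lst => l li; rewrite -(xl l li).1 (xl l li).2.
  by rewrite b_alt.1; abel.
rewrite ext_linU; wlog i_lt : i l il xE / (i < l)%N.
  move=> W; have : (i : nat) != l by rewrite val_eqE.
  by rewrite neq_ltn => /orP[/W|/W]; apply; rewrite // eq_sym.
rewrite (lst_cat x i) xE.
have -> : drop i.+1 (lst x) = take (l - i.+1) (drop i.+1 (lst x)) ++
    x l :: drop l.+1 (lst x).
  rewrite -[LHS](cat_take_drop (l - i.+1)) drop_drop subnK //; congr (_ ++ _).
  by rewrite (drop_nth 0) ?size_lst // nth_lst.
exact: alternating_dup.
Qed.

Lemma ext_mapB : zmod_morphism ext_map.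
Proof.
elim/quotW=> u; elim/quotW=> v.
have ext_mapE w : ext_map (\pi_E w) = ext_lin w.
  apply/eqP; rewrite -subr_eq0 -ext_linB; apply/eqP/ext_lin_zspan.
  by rewrite Quotient.idealrBE reprK.
have <- : \pi_E (u - v) = \pi_E u - \pi_E v by rewrite raddfB.
by rewrite !ext_mapE ext_linB.
Qed.

Lemma ext_map_wdg s : size s = j -> ext_map (wdg s) = b s.
Proof.
move=> sj; rewrite /wdg sj eqxx /ext_map.
transitivity (ext_lin << fun i : 'I_j => nth 0 s i >>).
  apply/eqP; rewrite -subr_eq0 -ext_linB; apply/eqP/ext_lin_zspan.
  by rewrite Quotient.idealrBE reprK.
by rewrite ext_linU lst_nth.
Qed.

End Lift.
End ExtPower.

Lemma gact_wdg j (G : groupType) (M : gmodType G) g (s : seq M) :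
  gmod_act g (wdg j s) = wdg j (map (gmod_act g) s).
Proof.
rewrite /wdg size_map; case: eqP => sj; last exact: raddf0.
rewrite [LHS]ext_gact_pi ext_liftU; congr (\pi << _ >>).
by apply/funext => i /=; rewrite (nth_map 0) // sj.
Qed.

(** * Dual bases and the exterior algebra of the dual *)

Fixpoint proj (L : zmodType) (bs : seq (L * {additive L -> int})) (y : L) : L :=
  if bs is (x, c) :: bs' then proj bs' y + x *~ c y else 0.

Definition basis_for (L : zmodType) (bs : seq (L * {additive L -> int})) :=
  forall y, proj bs y = y.

Lemma int_mulrzC (m n : int) : m *~ n = n *~ m.
Proof. by rewrite !mulrzz mulrC. Qed.

Section Pairing.
Variables (G : groupType) (L : gmodType G).
Implicit Types (c : dual L) (us vs : seq (dual L)) (xs : seq L).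
Implicit Types (bs : seq (L * dual L)) (b : seq L -> int).

(* The determinant of (u_i x_k), expanded along its rows. *)
Fixpoint pair us xs : int :=
  if us is u :: us' then lder u (pair us') xs else if nilp xs then 1 else 0.

Lemma alternating_pairr us : alternating (pair us).
Proof.
elim: us => [|u us IH] /=.
  by split=> [[|y s1]|[|y s1]].
by apply: alternating_lder => // x y; apply: raddfD.
Qed.

Lemma alternating_pairl : alternating (pair : seq (dual L) -> (seq L -> int)).
Proof.
split=> [s1 s2 u v|s1 s2 u].
  elim: s1 => [|w s1 IH]; apply/funext => xs /=; first exact: lderDl.
  by rewrite IH lderD.
elim: s1 => [|w s1 IH]; apply/funext => xs /=; first exact: lder_lder.
by rewrite IH lder0.
Qed.

Lemma pair_size us xs : size us != size xs -> pair us xs = 0.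
Proof.
elim: us xs => [|u us IH] [|x xs] // us_xs.
transitivity (lder u (fun=> 0 : int) (x :: xs)); last exact: lder0.
rewrite -[LHS]/(lder u (pair us) (x :: xs)).
by apply: (eq_lder_size (n := size xs)) => // s sn; apply: IH; rewrite sn.
Qed.

(** Expansion of the determinant along its first column rather than its first row. *)
Lemma pair_cons us x xs :
  pair us (x :: xs) = lder (fun u : dual L => u x) (fun vs => pair vs xs) us.
Proof.
elim: us xs => [|u us IH] xs //=; congr (_ - _).
rewrite (eq_lder u (IH : (fun ys => pair us (x :: ys)) =1 _)).
exact: (lder_comm u (fun v : dual L => v x) pair us xs).
Qed.

Definition pr j (u : ext_power j (dual L)) : seq L -> int := ext_map pair u.

Lemma prB j (u v : ext_power j (dual L)) : pr (u - v) = pr u - pr v.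
Proof. exact: ext_mapB alternating_pairl _ _. Qed.

Lemma pr_wdg j us : size us = j -> pr (wdg j us) = pair us.
Proof. exact: ext_map_wdg alternating_pairl _. Qed.

HB.instance Definition _ j :=
  GRing.isZmodMorphism.Build (ext_power j (dual L)) (seq L -> int) (@pr j) (@prB j).

Lemma pr0 j : pr (0 : ext_power j (dual L)) = 0.
Proof. exact: raddf0. Qed.

Lemma prD j (u v : ext_power j (dual L)) : pr (u + v) = pr u + pr v.
Proof. exact: raddfD. Qed.

Lemma prBE j (u v : ext_power j (dual L)) xs : pr (u - v) xs = pr u xs - pr v xs.
Proof. by rewrite prB. Qed.

Lemma prDE j (u v : ext_power j (dual L)) xs : pr (u + v) xs = pr u xs + pr v xs.
Proof. by rewrite prD. Qed.

Lemma prMz j (u : ext_power j (dual L)) xs k : pr (u *~ k) xs = pr u xs *~ k.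
Proof.
by apply: (morph_mulrz (h := fun u => pr u xs)) => v w; apply: prBE.
Qed.

Lemma alternating_pr j (u : ext_power j (dual L)) : alternating (pr u).
Proof.
elim/ext_power_ind: u => [|u v|us usj].
- by rewrite pr0; split=> [s1 s2 x y|].
- by rewrite prB; apply: alternatingB.
- by rewrite pr_wdg //; apply: alternating_pairr.
Qed.

Lemma pr_size j (u : ext_power j (dual L)) xs : size xs != j -> pr u xs = 0.
Proof.
move=> xsj; elim/ext_power_ind: u => [|u v u0 v0|us usj]; first by rewrite pr0.
  by rewrite prBE u0 v0 subrr.
by rewrite pr_wdg // pair_size // usj eq_sym.
Qed.

Lemma pr_gact j g (u : ext_power j (dual L)) xs :
  pr (gmod_act g u) xs = pr u (map (gmod_act g^-1%g) xs).
Proof.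
elim/ext_power_ind: u => [|u v u0 v0|us usj].
- by rewrite raddf0 pr0.
- by rewrite raddfB /= !prBE u0 v0.
- rewrite gact_wdg !pr_wdg ?size_map //.
  elim: us xs {usj} => [|u us IH] xs /=; first by case: xs.
  rewrite -(lder_map (gmod_act g^-1%g)) /=.
  by apply: eq_lder => ys; apply: IH.
Qed.

Definition wcons j c : ext_power j (dual L) -> ext_power j.+1 (dual L) :=
  ext_map (fun us => wdg j.+1 (c :: us)).

Lemma wconsB j c : zmod_morphism (@wcons j c).
Proof. exact/ext_mapB/alternating_cons/alternating_wdg. Qed.

Lemma wcons_wdg j c us : wcons c (wdg j us) = wdg j.+1 (c :: us).
Proof.
have [usj|usj] := eqVneq (size us) j; last first.
  by rewrite !wdg_size // (nmod_morph0 (@wconsB j c)).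
exact/ext_map_wdg/usj/alternating_cons/alternating_wdg.
Qed.

Lemma pr_wcons j c (u : ext_power j (dual L)) : pr (wcons c u) = lder c (pr u).
Proof.
elim/ext_power_ind: u => [|u v u0 v0|us usj].
- rewrite (nmod_morph0 (@wconsB j c)) !pr0.
  by apply/funext => xs; rewrite [RHS]lder0.
- rewrite wconsB !prB u0 v0.
  by apply/funext => xs; rewrite [RHS]lderB.
- by rewrite wcons_wdg !pr_wdg //= usj.
Qed.

(** The element whose coordinates are the values of b on increasing tuples of basis vectors: a tuple
    either avoids x or starts with it. It inverts [pr]. *)
Fixpoint uvec bs j b : ext_power j (dual L) :=
  if bs is (x, c) :: bs' then
    uvec bs' j b + match j with
      | 0 => 0
      | j'.+1 => wcons c (uvec bs' j' (fun s => b (x :: s)))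
      end
  else wdg j [::] *~ b [::].

Lemma uvecB bs j b b' : uvec bs j (fun s => b s - b' s) = uvec bs j b - uvec bs j b'.
Proof.
elim: bs j b b' => [|[x c] bs IH] j b b' /=; first exact: mulrzBr.
case: j => [|j]; first by rewrite IH; abel.
by rewrite !IH wconsB; abel.
Qed.

Lemma lder_kill f b s1 s2 (x : L) : f x = 0 ->
  (forall r1 r2, b (r1 ++ x :: r2) = 0 :> int) ->
  lder f b (s1 ++ x :: s2) = 0.
Proof.
move=> fx; elim: s1 b => [|y s1 IH] b b0 /=.
  rewrite fx mulr0z sub0r (_ : (fun r => b (x :: r)) = fun=> 0) ?lder0 ?oppr0 //.
  by apply/funext => r; apply: (b0 [::]).
by rewrite b0 mul0rz sub0r IH ?oppr0 // => r1 r2; apply: (b0 (y :: r1)).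
Qed.

Lemma lder_all0 (f : L -> int) b s : (forall x, x \in s -> f x = 0) -> lder f b s = 0 :> int.
Proof.
elim: s b => [|x s IH] b //= fs; rewrite fs ?mem_head // mulr0z sub0r IH ?oppr0 //.
by move=> y ys; apply: fs; rewrite inE ys orbT.
Qed.

Lemma pr_uvec_kill bs j b s1 s2 (x : L) :
  all (fun bc : L * dual L => bc.2 x == 0) bs -> pr (uvec bs j b) (s1 ++ x :: s2) = 0.
Proof.
elim: bs j b s1 s2 => [|[y c] bs IH] j b s1 s2 /=.
  move=> _; have [->|s_j] := eqVneq j (size (s1 ++ x :: s2)); last first.
    by rewrite pr_size // eq_sym.
  by rewrite wdg_size ?mul0rz ?pr0 //; case: s1.
case/andP=> /eqP cx bsx.
rewrite prDE IH // add0r.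
case: j => [|j]; first by rewrite pr0.
rewrite pr_wcons; apply: lder_kill => // r1 r2; exact: IH.
Qed.

Lemma pr_uvec bs j b s : dual_system bs -> subseq s (unzip1 bs) -> size s = j ->
  pr (uvec bs j b) s = b s.
Proof.
elim: bs j b s => [|[x c] bs IH] j b s /=.
  move=> _ /eqP -> /= <-; rewrite prMz pr_wdg //=.
  by rewrite -mulrzr mul1r intz.
move=> [/= cx cbs bsd]; rewrite prDE.
have c0 (s' : seq L) : {subset s' <= unzip1 bs} -> forall z, z \in s' -> c z = 0.
  move=> s'bs z /s'bs; elim: bs cbs {IH bsd s'bs} => //= bc bs IHb.
  by case/andP=> /andP[/eqP cb' _] /IHb cbs; rewrite inE => /predU1P[->|/cbs].
case: s => [|y s]; [move=> _ <- | case: eqP => [->|_] ss sj].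
- by rewrite IH ?sub0seq // pr0 addr0.
- rewrite (pr_uvec_kill _ _ [::]); last first.
    by apply: sub_all cbs => bc /andP[].
  rewrite add0r -sj /= pr_wcons /= cx mulr1z IH // (lder_all0 _ (c0 _ (mem_subseq ss))) ?subr0 //.
- rewrite IH // -sj /= pr_wcons (lder_all0 _ (c0 _ (mem_subseq ss))).
  by rewrite addr0.
Qed.

Fixpoint coproj bs (u : dual L) : dual L :=
  if bs is (x, c) :: bs' then coproj bs' u + c *~ u x else 0.

(** Each covector is replaced by its expansion in the dual basis; for a true basis this makes [uvec]
    a left inverse of [pr], whence the injectivity of [pr]. *)
Lemma uvec_pair bs j us : uvec bs j (pair us) = wdg j (map (coproj bs) us).
Proof.
elim: bs j us => [|[x c] bs IH] j us /=.
  case: us => [|u us] /=; first by rewrite mulr1z.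
  by rewrite mulr0z (alternating_0 (alternating_wdg j _) [::]).
rewrite (@alternating_expand _ _ _ (@wdg j _) (fun u : dual L => u x) (coproj bs)
  c us (alternating_wdg j _)) IH; congr (_ + _).
case: j => [|j].
  transitivity (lder (fun u : dual L => u x) (fun=> 0 : ext_power 0 (dual L)) us).
    by rewrite lder0.
  by apply: eq_lder => r; rewrite wdg_size.
have -> : (fun s => pair us (x :: s)) =
    lder (fun u : dual L => u x) (pair : _ -> seq L -> int) us.
  apply/funext => s; rewrite pair_cons.
  by rewrite (lder_hom (h := fun f : seq L -> int => f s)).
have uB : {morph uvec bs j : f h / f - h} by move=> f h; apply: uvecB.
have -> := @lder_hom _ (seq L -> int) _ (uvec bs j) (fun u : dual L => u x)
  pair us uB.
have wB : {morph @wcons j c : u v / u - v} by exact: wconsB.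
have e r : wcons c (uvec bs j (pair r)) = wdg j.+1 (c :: map (coproj bs) r).
  by rewrite IH wcons_wdg.
rewrite -(eq_lder _ e).
exact: (@lder_hom (dual L) (ext_power j (dual L)) (ext_power j.+1 (dual L))
  (@wcons j c) (fun u : dual L => u x) (fun vs => uvec bs j (pair vs)) us wB).
Qed.

Lemma dual_mulrz c k y : (c *~ k : dual L) y = c y *~ k.
Proof. exact: (@morph_mulrz (dual L) int (fun f : dual L => f y)). Qed.

Lemma coproj_id bs u : basis_for bs -> coproj bs u = u.
Proof.
move=> bsP; apply: dualP => y; rewrite -[in RHS](bsP y).
elim: bs {bsP} => [|[x c] bs IH] /=; first exact/esym/(raddf0 (u : {additive L -> int})).
rewrite IH; have -> := dual_mulrz c (u x) y.
rewrite [RHS](raddfD (u : {additive L -> int})); congr (_ + _).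
have uB : {morph u : z t / z - t} by exact: raddfB.
have -> := morph_mulrz uB x (c y).
exact: int_mulrzC.
Qed.

Lemma uvec_pr bs j (u : ext_power j (dual L)) : basis_for bs -> uvec bs j (pr u) = u.
Proof.
move=> bsP; have uB : {morph uvec bs j : f h / f - h} by move=> f h; apply: uvecB.
elim/ext_power_ind: u => [|u v u0 v0|us usj].
- by rewrite pr0 (nmod_morph0 uB).
- by rewrite prB uB u0 v0.
- rewrite pr_wdg // uvec_pair; congr wdg; rewrite -[RHS]map_id.
  by apply: eq_map => u; apply: coproj_id.
Qed.

Lemma pr_inj bs j (u : ext_power j (dual L)) : basis_for bs -> pr u = 0 -> u = 0.
Proof.
move=> bsP u0; rewrite -(uvec_pr u bsP) u0.
have uB : {morph uvec bs j : f h / f - h} by move=> f h; apply: uvecB.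
exact: nmod_morph0 uB.
Qed.

End Pairing.

(** * Cocycles attached to a basis, not yet equivariant *)

Section NaiveSection.
Variables (L : zmodType) (Y : Type) (y0 : Y).
Implicit Types (c : {additive L -> int}) (f : seq (L * Y) -> int).

Definition hcup c f (a : L * Y) (s : seq (L * Y)) : int :=
  if s is a1 :: _ then f s *~ c (a1.1 - a.1) else 0.

(* Cup product with the crossed homomorphism c. *)
Definition ccup c f (s : seq (L * Y)) : int :=
  if s is a :: s' then hcup c f a s' else 0.

Lemma ccup_cocycle c f : f [::] = 0 -> (forall s, ld f s = 0) ->
  forall s, ld (ccup c f) s = 0.
Proof.
move=> f0 fD [|a s] //=; apply/eqP; rewrite subr_eq0 eq_sym; apply/eqP.
case: s => [|a1 s] //=.
rewrite -(ld_hom (h := fun z => z *~ c (a1.1 - a.1))); last first.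
  by move=> x y; apply: mulrzBl.
have -> : ld (fun r => f (a1 :: r)) s = f s := esym (subr0_eq (fD (a1 :: s))).
case: s => [|a2 s] /=; first by rewrite f0 mul0rz subr0.
by rewrite -mulrzBr -raddfB /=; congr (_ *~ c _); abel.
Qed.

Lemma prism_ccup c f x : f [::] = 0 -> prism (tau x) (ccup c f) =
  fun s => f (map (tau x) s) *~ c x - ccup c (prism (tau x) f) s.
Proof.
move=> f0; apply/funext => -[|a s] /=; first by rewrite f0 mul0rz subr0.
rewrite addrK; congr (_ - _); case: s => [|a1 s] //=.
rewrite mulrzBl (prism_hom (h := fun z => z *~ _)) // => u v.
exact: mulrzBl.
Qed.

Lemma levZ xs f k : lev y0 xs (fun s => f s *~ k) = lev y0 xs f *~ k.
Proof.
elim: xs f => [|x xs IH] f //=; rewrite -IH; congr lev; apply/funext => s.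
by rewrite (prism_hom (h := fun z => z *~ k)) // => u v; apply: mulrzBl.
Qed.

Lemma lev_ccup c f xs : f [::] = 0 -> (forall x, tinv x f) ->
  lev y0 xs (ccup c f) = lder c (fun ys => lev y0 ys f) xs.
Proof.
elim: xs f => [|x xs IH] f f0 finv //=.
rewrite prism_ccup // levB levZ IH //; last by move=> y; apply: tinv_prism.
by congr (lev _ _ _ *~ _ - _); apply/funext => s; apply: finv.
Qed.

Lemma tinv_ccup c f x : tinv x f -> tinv x (ccup c f).
Proof.
move=> fx [|a [|a1 s]] //=; rewrite -[tau x a1 :: _]/(map (tau x) (a1 :: s)) fx.
by congr (_ *~ c _); rewrite /tau /=; abel.
Qed.

(** The recursion of [uvec], with the wedge by c turned into the cup product with c; the base case
    is a constant cocycle of degree 0. *)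
Fixpoint nsec (bs : seq (L * {additive L -> int})) (b : seq L -> int) s : int :=
  if bs is (x, c) :: bs' then
    nsec bs' b s + ccup c (nsec bs' (fun r => b (x :: r))) s
  else if size s == 1 then b [::] else 0.

Lemma nsec_nil bs b : nsec bs b [::] = 0.
Proof. by elim: bs b => [|[x c] bs IH] b //=; rewrite IH. Qed.

Lemma nsec_tinv bs b x : tinv x (nsec bs b).
Proof.
elim: bs b => [|[y c] bs IH] b s /=; first by rewrite size_map.
by rewrite IH tinv_ccup //; apply: IH.
Qed.

Lemma nsec_cocycle bs b s : ld (nsec bs b) s = 0.
Proof.
elim: bs b s => [|[y c] bs IH] b s /=.
  case: s => [|a [|a1 [|a2 s]]] //.
    by rewrite /= !subr0 subrr.
  by apply: (ld_eq0_size (n := (size s).+2)) => // r ->.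
by rewrite ldD IH ccup_cocycle ?addr0 //; apply: nsec_nil.
Qed.

Lemma nsecB bs b b' s : nsec bs (fun r => b r - b' r) s = nsec bs b s - nsec bs b' s.
Proof.
elim: bs b b' s => [|[y c] bs IH] b b' s /=; first by case: eqP; rewrite ?subr0.
rewrite IH; have -> : nsec bs (fun r => b (y :: r) - b' (y :: r)) =
    fun s => nsec bs (fun r => b (y :: r)) s - nsec bs (fun r => b' (y :: r)) s.
  by apply/funext => r; apply: IH.
by case: s => [|a [|a1 s]] /=; rewrite ?mulrzBl; abel.
Qed.

Lemma lev_nsec bs b xs : alternating b ->
  lev y0 xs (nsec bs b) = b (map (proj bs) xs).
Proof.
elim: bs b xs => [|[x c] bs IH] b xs ba /=.
  case: xs => [|x xs] //=; rewrite (alternating_0 ba [::]).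
  rewrite (_ : prism _ _ = fun=> 0) ?lev0 //; apply/funext => -[|a s] //.
  rewrite (@prism_eq_size _ _ _ (size (a :: s)) _ (fun=> 0)) ?prism0 //.
  by move=> r ->.
rewrite levD lev_ccup ?nsec_nil //; last exact: nsec_tinv.
rewrite (@alternating_expand _ _ _ b c (proj bs) x xs ba) IH //; congr (_ + _).
by apply: eq_lder => ys; rewrite IH //; apply: alternating_cons.
Qed.

End NaiveSection.

(** * Cochains on a semidirect product *)

(** By multiplicativity the values are 1 or -1. The twist serves the determinant of the regular
    module, on which a generator acts by -1 when p = 2. *)
Record signchar (G : groupType) := SignChar {
  chi :> G -> int;
  chi1 : chi 1%g = 1;
  chiM : forall g h, chi (g * h)%g = chi g * chi h
}.

Definition triv_char (G : groupType) : signchar G :=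
  @SignChar G (fun=> 1) erefl (fun _ _ => erefl).

(* Functions of a list of elements of the semidirect product, with the action
   of G by left translation twisted by X. *)
Definition lfun (G : groupType) (L : gmodType G) (X : signchar G) : Type :=
  seq (L * G) -> int.
HB.instance Definition _ (G : groupType) (L : gmodType G) (X : signchar G) :=
  GRing.Zmodule.copy (lfun L X) (seq (L * G) -> int).

Section ListFunctions.
Variables (G : groupType) (L : gmodType G) (X : signchar G).

Definition gam (g : G) (a : L * G) : L * G := (gmod_act g a.1, (g * a.2)%g).

Lemma gam1 a : gam 1 a = a.
Proof. by case: a => x g; rewrite /gam /= gmod_act1 mul1g. Qed.

Lemma gamM g h a : gam (g * h) a = gam g (gam h a).
Proof. by rewrite /gam /= gmod_actM mulgA. Qed.

Lemma gam_tau g x a : gam g (tau x a) = tau (gmod_act g x) (gam g a).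
Proof. by rewrite /gam /tau /= raddfD. Qed.

Local Notation lfun := (lfun L X).
Implicit Types f h : lfun.

Definition lact g f : lfun := fun s => f (map (gam g^-1) s) *~ X g.

Fact lactD g : {morph lact g : f h / f + h}.
Proof. by move=> f h; apply/funext => s; apply: mulrzDl. Qed.

Fact lact1 f : lact 1 f = f.
Proof.
apply/funext => s; rewrite /lact chi1 mulr1z invg1; congr f.
by rewrite -[RHS]map_id; apply: eq_map => a; rewrite gam1.
Qed.

Fact lactM g k f : lact (g * k) f = lact g (lact k f).
Proof.
apply/funext => s; rewrite /lact chiM mulrC mulrzA -map_comp invMg.
by congr (f _ *~ _ *~ _); apply: eq_map => a; rewrite /= gamM.
Qed.

HB.instance Definition _ := @isGModule.Build G lfun lact lactD lact1 lactM.

Lemma lactE g f s : gmod_act g f s = f (map (gam g^-1) s) *~ X g.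
Proof. by []. Qed.

Definition ldf (f : lfun) : lfun := ld f.

Fact ldf_is_zmod_morphism : zmod_morphism ldf.
Proof. by move=> f h; apply/funext => s; apply: ldB. Qed.

HB.instance Definition _ :=
  GRing.isZmodMorphism.Build lfun lfun ldf ldf_is_zmod_morphism.

Lemma ldfG g f : ldf (gmod_act g f) = gmod_act g (ldf f).
Proof.
apply/funext => s; rewrite lactE /ldf -ld_map.
by rewrite (ld_hom (h := fun z => z *~ X g)) // => u v; apply: mulrzBl.
Qed.

(* With red = true, the functions are also required to vanish on G, viewed as
   a subgroup of the semidirect product. *)
Variable red : bool.

Definition lcochain n f := [/\ f [::] = 0, forall s, size s <> n -> f s = 0,
  forall x, tinv x f & red -> forall s : seq G, f [seq (0, g) | g <- s] = 0].

Lemma lcochain0 n : lcochain n 0.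
Proof. by split. Qed.

Lemma lcochainB n f h : lcochain n f -> lcochain n h -> lcochain n (f - h).
Proof.
move=> [f0 fn fx fr] [h0 hn hx hr]; split=> [|s sn|x s|r s].
- by rewrite -[LHS]/(f [::] - h [::]) f0 h0 subrr.
- by rewrite -[LHS]/(f s - h s) fn // hn // subrr.
- by rewrite -[LHS]/(f (map (tau x) s) - h (map (tau x) s)) fx hx.
- by rewrite -[LHS]/(f [seq (0, g) | g <- s] - h [seq (0, g) | g <- s]) fr // hr ?subrr.
Qed.

Lemma lcochain_act n g f : lcochain n f -> lcochain n (gmod_act g f).
Proof.
move=> [f0 fn fx fr]; split=> [|s sn|x s|r s]; rewrite !lactE.
- by rewrite /= f0 mul0rz.
- by rewrite fn ?mul0rz // size_map.
- rewrite -map_comp -(fx (gmod_act g^-1 x) (map (gam g^-1) s)) -map_comp.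
  by congr (f _ *~ _); apply: eq_map => a; rewrite /= gam_tau.
- rewrite -map_comp (_ : map _ s = [seq (0, k) | k <- map (mulg g^-1) s]).
    by rewrite fr // mul0rz.
  by rewrite -map_comp; apply: eq_map => k; rewrite /gam /= raddf0.
Qed.

Lemma lcochain_ldf n f : lcochain n f -> lcochain n.+1 (ldf f).
Proof.
move=> [f0 fn fx fr]; split=> // [s sn|x|r s].
- case: s sn => // a s sn; apply: (ld_eq0_size (n := size s)) => // r rs.
  by apply: fn => rn; case: sn; rewrite /= -rs rn.
- exact: tinv_ld.
- rewrite /ldf -ld_precomp; transitivity (ld (fun=> 0 : int) s); last exact: ld0.
  by congr ld; apply/funext => q; apply: fr.
Qed.

Lemma lcochain_nil f : lcochain 0 f -> f = 0.
Proof. by move=> [f0 fn _ _]; apply/funext => -[|a s]; [apply: f0 | apply: fn]. Qed.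

(** Such cochains are coinduced: the contracting homotopy prefixes s with the G-component of the
    first vertex of the argument, which translation by G moves along with s. *)
Lemma lcochain_exact n i (c : seq G -> lfun) :
  lequi c -> (forall s, lcochain n (c s)) -> (forall s, size s = i.+2 -> ld c s = 0) ->
  exists a, [/\ lequi a, forall s, lcochain n (a s) &
    forall s, size s = i.+1 -> c s = ld a s].
Proof.
move=> cE cA c0.
have ev_ld (u : seq G -> lfun) r s : ld u s r = ld (fun q => u q r) s.
  by apply: (ld_hom (h := fun f : lfun => f r)).
exists (fun s r => if r is a :: _ then c (a.2 :: s) r else 0); split.
- move=> g s; apply/funext => -[|a r]; first by rewrite lactE /= mul0rz.
  transitivity (gmod_act g (c ((g^-1 * a.2)%g :: s)) (a :: r)) => //.
  by rewrite -cE /= mulKVg.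
- move=> s; split=> //.
  + by case=> [|a r] // rn; have [_ -> ] := cA (a.2 :: s).
  + by move=> x [|a r] //; have [_ _ /(_ x (a :: r)) ] := cA (a.2 :: s).
  + by move=> r [|g q] //; have [_ _ _ /(_ r (g :: q)) ] := cA (g :: s).
- move=> s sn; apply/funext => -[|a r].
    by rewrite ev_ld ld0; case: (cA s).
  have := c0 (a.2 :: s) (congr1 S sn) => /= /(congr1 (fun f : lfun => f (a :: r))).
  by rewrite ev_ld -[LHS]/(c s (a :: r) - ld _ s _) ev_ld => /subr0_eq.
Qed.

End ListFunctions.

Section CocycleClass.
Variables (G : groupType) (L : gmodType G) (X : signchar G).
Variable bs : seq (L * dual L).
Hypotheses (bsP : basis_for bs) (bsd : dual_system bs).
Implicit Types f z : lfun L X.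

Lemma tinv_basis f : (forall b, b \in unzip1 bs -> tinv b f) -> forall x, tinv x f.
Proof.
move=> fb x; rewrite -(bsP x).
have tinv0 : tinv 0 f by move=> s; rewrite map_tau0.
have tinvD y t : tinv y f -> tinv t f -> tinv (y + t) f.
  by move=> fy ft s; rewrite -map_tauD fy ft.
have tinvN y : tinv y f -> tinv (- y) f.
  by move=> fy s; rewrite -[LHS]fy map_tauD subrr map_tau0.
have tinvMn y n : tinv y f -> tinv (y *+ n) f.
  by move=> fy; elim: n => [|n IH] //; rewrite mulrS; apply: tinvD.
elim: bs fb => [|[b c] bs' IH] fb //=; apply: tinvD.
  by apply: IH => y yb; apply: fb; rewrite inE yb orbT.
have fb' : tinv b f by apply: fb; rewrite mem_head.
by case: (c x) => n; [apply: tinvMn | apply/tinvN/tinvMn].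
Qed.

Lemma lcochain_ltrunc (red : bool) n f : (n = 0 -> f [::] = 0) -> (forall x, tinv x f) ->
  (red -> forall s : seq G, f [seq (0, g) | g <- s] = 0) ->
  lcochain red n (ltrunc n f : lfun L X).
Proof.
move=> f0 fx fr; split=> [|s sn|x s|r s]; rewrite /ltrunc ?size_map.
- by case: eqP => // /esym.
- by case: eqP.
- by rewrite fx.
- by rewrite fr //; case: eqP.
Qed.

Lemma lev_lcochain (red : bool) n f xs : lcochain red n f -> (size xs).+1 <> n ->
  lev 1%g xs f = 0.
Proof.
move=> [_ fn _ _] xsn; rewrite (@lev_eq_size _ _ _ xs f (fun=> 0)) ?lev0 //.
by move=> s sn; apply: fn; rewrite sn.
Qed.

Lemma lev_class n z f :
  lcochain false n.+1 z -> lcochain false n.+1 f -> ldf z = 0 -> ldf f = 0 ->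
  (forall xs, subseq xs (unzip1 bs) -> size xs = n -> lev 1%g xs z = lev 1%g xs f) ->
  exists2 a : lfun L X, lcochain false n a & z = ldf a + f.
Proof.
move=> zA fA z0 f0 zf.
have [b _|s|xs xs_bs|a [ainv a0 fa]] := @lev_exact _ _ 1%g bs (fun s => z s - f s) bsd.
- by case: zA => [_ _ zx _]; case: fA => [_ _ fx _]; apply: tinvB.
- have lds (h : lfun L X) : ldf h = 0 -> ld h s = 0.
    by move=> /(congr1 (fun h' : lfun L X => h' s)).
  by rewrite ldB !lds // subrr.
- rewrite levB; have [xsn|xsn] := eqVneq (size xs) n.
    by rewrite zf // subrr.
  by rewrite (lev_lcochain zA) ?(lev_lcochain fA) ?subrr // => -[] /eqP; rewrite (negPf xsn).
exists (ltrunc n a : lfun L X).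
  by apply: lcochain_ltrunc => //; apply: tinv_basis.
apply/funext => s; rewrite -[RHS]/(ld (ltrunc n a) s + f s) ld_ltrunc /ltrunc -fa.
case: zA => [_ zn _ _]; case: fA => [_ fn _ _].
by case: eqP => [|sn]; rewrite ?subrK // zn // fn // addr0.
Qed.

End CocycleClass.

Section Assembly.
Variables (G : groupType) (L : gmodType G).
Variable bs : seq (L * dual L).
Hypotheses (bsP : basis_for bs) (bsd : dual_system bs).
Local Notation C := (lfun L (triv_char G)).
Variable sct : forall j, ext_power j (dual L) -> C.
Hypothesis sctB : forall j, zmod_morphism (@sct j).
Hypothesis sctG : forall j g u, @sct j (gmod_act g u) = gmod_act g (sct u).
Hypothesis sctA : forall j u, lcochain false j.+1 (@sct j u).
Hypothesis ldf_sct : forall j u, ldf (@sct j u) = 0.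
Hypothesis lev_sct : forall j u xs, size xs = j -> lev 1%g xs (@sct j u) = pr u xs.

(** Equivariance under Gamma amounts to invariance under L together with invariance under G acting
    on functions. So cochains of Gamma are the G-invariants of [lcochain false], and the filtered
    splitting applies. *)
Lemma semidirect_splitting k : zmod_isom
    (cohomology (triv_gmod (semidirect L) int) k)
    (dirsum (fun j : 'I_k.+1 => cohomology (ext_power j (dual L)) (k - j))).
Proof.
pose S j : {additive ext_power j (dual L) -> C} :=
  HB.pack (@sct j) (GRing.isZmodMorphism.Build _ _ (@sct j) (@sctB j)).
pose rep (F : C) (x : cohomology (triv_gmod (semidirect L) int) k) :=
  lcochain false k.+1 F /\
  @represents (semidirect L) (triv_gmod (semidirect L) int) k F x.
have gmod_triv (F : C) : (forall g, gmod_act g F = F) <->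
    forall g s, F (map (gam g) s) = F s.
  split=> [FG g s|FG g]; last first.
    by apply/funext => s; rewrite lactE /= mulr1z FG.
  have := congr1 (fun f : C => f s) (FG g^-1%g).
  by rewrite /= lactE /= mulr1z invgK.
have semi_mul (a b : semidirect L) : (a * b)%g = tau a.1 (gam a.2 b) by [].
have lequiP (F : C) : @lequi (semidirect L) (triv_gmod (semidirect L) int) F <->
    (forall x, tinv x F) /\ (forall g s, F (map (gam g) s) = F s).
  split=> [FE|[Fx FG] a s]; last first.
    transitivity (F (map (tau a.1) (map (gam a.2) s))); last by rewrite Fx FG.
    by rewrite -map_comp.
  split=> [x s|g s].
    rewrite -[RHS](FE (x, 1%g)); congr F; apply: eq_map => b /=.
    by rewrite semi_mul gam1.
  rewrite -[RHS](FE (0, g)); congr F; apply: eq_map => b /=.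
  by rewrite semi_mul tau0.
have lequi_trunc n (F : C) : @lequi (semidirect L) (triv_gmod (semidirect L) int) F ->
    (n = 0 -> F [::] = 0) ->
    lcochain false n (ltrunc n F : C) /\ (forall g, gmod_act g (ltrunc n F : C) = ltrunc n F).
  move=> /lequiP[Fx FG] F0; split; first exact: lcochain_ltrunc.
  by apply/gmod_triv => g s; rewrite /ltrunc size_map FG.
apply: (@cohomology_splitting G C (@ldf G L _) (lcochain false) _ _ _ _ _ _ _ _
  (fun j => ext_power j (dual L)) S _ _ _ _ _ k _ rep).
- exact: ldfG.
- by move=> f; apply/funext => s; apply: ld_ld.
- by move=> n; apply: lcochain0.
- by move=> n f h; apply: lcochainB.
- by move=> n g f; apply: lcochain_act.
- by move=> n f; apply: lcochain_ldf.
- by move=> f; apply: lcochain_nil.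
- exact: lcochain_exact.
- exact: sctG.
- exact: sctA.
- exact: ldf_sct.
- move=> l z zA z0; pose u := uvec bs l (fun xs => lev 1%g xs z).
  have [|a aA ->] := lev_class bsP bsd zA (sctA u) z0 (ldf_sct u).
    by move=> xs xs_bs xsl; rewrite lev_sct // pr_uvec.
  by exists a, u.
- move=> l a u [a0 _ ax _] ua; apply: (pr_inj bsP); apply/funext => xs.
  have [xsl|xsl] := eqVneq (size xs) l; last by rewrite pr_size.
  by rewrite -lev_sct // -[sct u]/(S l u) ua lev_ld.
- move=> x; have [f fx] := represents_exists x.
  have [fE [c xc cf]] := fx; have [//|fA fG] := lequi_trunc k.+1 f fE.
  exists (ltrunc k.+1 f).
    split=> //; apply/funext => s; rewrite -[LHS]/(ld (ltrunc k.+1 f) s) ld_ltrunc.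
    by rewrite /ltrunc; case: eqP => // sk; apply: (represents_cocycle fx).
  split=> //; split; first exact: lequi_ltrunc.
  by exists c => // y; rewrite cf /ltrunc size_lst eqxx.
- move=> F [FA Fd FG]; have [_ _ Fx _] := FA.
  have [||x Fx'] := @cocycle_represents (semidirect L) (triv_gmod (semidirect L) int) k F.
  + by apply/lequiP; split=> //; apply/gmod_triv.
  + by move=> s _; have := congr1 (fun f : C => f s) Fd.
  + by exists x.
- move=> F F' x x' [FA Fx] [F'A F'x']; split; first exact: lcochainB.
  exact: representsB.
- move=> F x [FA Fx]; rewrite (represents0P Fx); have [_ Fn _ _] := FA.
  split=> [[h [hE h0 Fh]]|[F' [[F'0 F'n F'x _] F'G] FF']].
    have [//|hA hG] := lequi_trunc k h hE.
    exists (ltrunc k h) => //; apply/funext => s.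
    rewrite -[RHS]/(ld (ltrunc k h) s) ld_ltrunc /ltrunc.
    by case: eqP => [/Fh|/Fn].
  exists F'; split=> // [|s sk]; last by rewrite FF'.
  by apply/lequiP; split=> //; apply/gmod_triv.
Qed.

End Assembly.

(** * The cocycle of successive differences of a form *)

Lemma alternating_scale (X : zmodType) (b : seq X -> int) (k : nat -> int) :
  alternating b -> alternating (fun s => b s *~ k (size s)).
Proof.
move=> [bD b0]; split=> [s1 s2 x y|s1 s2 x]; last by rewrite b0 mul0rz.
by rewrite !size_cat /= bD mulrzDl.
Qed.

Lemma alternating_move (X V : zmodType) (b : seq X -> V) s1 t x s2 :
  alternating b ->
  b (s1 ++ t ++ x :: s2) = b (s1 ++ x :: t ++ s2) *~ (-1) ^+ size t.
Proof.
move=> ba; elim/last_ind: t s2 => [|t y IH] s2; first by rewrite expr0 mulr1z.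
rewrite cat_rcons catA alternating_swap // -catA IH cat_rcons size_rcons exprSr.
by rewrite mulrN1 mulrNz.
Qed.

Section DividedPower.
Variables (L : zmodType) (Y : Type) (y0 : Y).
Implicit Types (b : seq L -> int) (a : L * Y) (s : seq (L * Y)).

Fixpoint steps a s : seq L :=
  if s is a1 :: s' then (a1.1 - a.1) :: steps a1 s' else [::].

Lemma size_steps a s : size (steps a s) = size s.
Proof. by elim: s a => [|a1 s IH] a //=; rewrite IH. Qed.

Lemma steps_tau x a s : steps (tau x a) (map (tau x) s) = steps a s.
Proof.
by elim: s a => [|a1 s IH] a //=; rewrite IH; congr (_ :: _); rewrite /tau /=; abel.
Qed.

Definition pow b s : int := if s is a :: s' then b (steps a s') else 0.

(** Dropping a vertex merges two consecutive steps into their sum, so by additivity of b the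
    alternating sum telescopes. *)
Lemma ld_steps b a s : alternating b -> ld (fun r => b (steps a r)) s = pow b s.
Proof.
elim: s a b => [|a1 s IH] a b ba //=.
rewrite (IH a1 (fun r => b (a1.1 - a.1 :: r))); last exact: alternating_cons.
case: s {IH} => [|a2 s] /=; first exact: subr0.
apply/eqP; rewrite subr_eq addrC -(ba.1 [::]); apply/eqP; congr (b (_ :: _)).
abel.
Qed.

Lemma ld_pow b s : alternating b -> ld (pow b) s = 0.
Proof. by case: s => [|a s] //= ba; rewrite ld_steps // subrr. Qed.

(** Each simplex of the prism contributes b with x inserted among the steps; moving x to the front
    makes all signs agree. This is the origin of the factor j! in [lev_pow]. *)
Lemma prism_steps b a x s : alternating b ->
  prism (tau x) (fun r => b (steps a r)) s = - ((size s)%:Z * b (x :: steps a s)).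
Proof.
elim: s a b => [|a1 s IH] a b ba /=; first by rewrite mul0r oppr0.
rewrite addrK steps_tau (IH a1 (fun r => b (a1.1 - a.1 :: r))); last first.
  exact: alternating_cons.
by rewrite (alternating_swap ba [::]) /= intS; ring.
Qed.

Lemma prism_pow b x : alternating b ->
  prism (tau x) (pow b) = pow (fun r => b (x :: r) *~ (size r).+1).
Proof.
move=> ba; apply/funext => -[|a s] //=.
by rewrite addrK steps_tau prism_steps // size_steps mulrzz intS; ring.
Qed.

Lemma lev_pow b xs : alternating b -> lev y0 xs (pow b) = b xs *~ (size xs)`!.
Proof.
elim: xs b => [|x xs IH] b ba //=; rewrite prism_pow // IH.
  by rewrite -mulrzA factS mulnC PoszM mulrC.
exact: (alternating_scale (fun n => n.+1 : int) (alternating_cons x ba)).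
Qed.

Lemma tinv_pow b x : tinv x (pow b).
Proof. by case=> [|a s] //=; rewrite steps_tau. Qed.

End DividedPower.

(** * Cup products *)

(** The sum of H over the ways to cut s at a vertex shared by both pieces. H is any function of two
    lists, so all bidegrees are treated at once. *)
Fixpoint cup (T : Type) (H : seq T -> seq T -> int) (s : seq T) : int :=
  if s is a :: s' then H [:: a] s + cup (fun u => H (a :: u)) s' else 0.

Lemma cup_map (T U : Type) (t : U -> T) H (s : seq U) :
  cup H (map t s) = cup (fun u v => H (map t u) (map t v)) s.
Proof. by elim: s H => [|a s IH] H //=; rewrite IH. Qed.

Section Cup.
Variable T : Type.
Implicit Types (H : seq T -> seq T -> int) (s u v : seq T).

Lemma cupB H K s : cup (fun u v => H u v - K u v) s = cup H s - cup K s.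
Proof.
elim: s H K => [|a s IH] H K /=; first by rewrite subr0.
by rewrite (IH (fun u => H (a :: u))); abel.
Qed.

Lemma cup0 s : cup (fun _ _ => 0) s = 0.
Proof. by elim: s => [|a s IH] //=; rewrite IH addr0. Qed.

Lemma cupZ k H s : cup (fun u v => k * H u v) s = k * cup H s.
Proof.
elim: s H => [|a s IH] H /=; first by rewrite mulr0.
by rewrite (IH (fun u => H (a :: u))) mulrDr.
Qed.

Lemma eq_cup H K : (forall u v, H u v = K u v) -> cup H =1 cup K.
Proof. by move=> HK; have -> : H = K by apply/funext => u; apply/funext. Qed.

Lemma ldZ k (f : seq T -> int) s : ld (fun r => k * f r) s = k * ld f s.
Proof. by rewrite (ld_hom (h := fun z => k * z)) // => x y; apply: mulrBr. Qed.

(** The Leibniz rule. The two end terms compensate for the augmentation: the differential of a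
    one-vertex factor evaluates H at the empty list. *)
Lemma ld_cup H s : ld (cup H) s =
  cup (fun u v => ld (H^~ v) u - (-1) ^+ size u * ld (H u) v) s -
    H [::] s + (-1) ^+ size s * H s [::].
Proof.
elim: s H => [|a s IH] H; first by rewrite /= mul1r sub0r addNr.
pose D K u v := ld (K^~ v) u - (-1) ^+ size u * ld (K u) v : int.
have DE : cup (fun u => D H (a :: u)) s = cup H s - cup (D (fun u => H (a :: u))) s.
  by rewrite -cupB; apply: eq_cup => u v; rewrite /D /= exprS; ring.
rewrite [LHS]/= (ldD (fun r => H [:: a] (a :: r))) IH.
rewrite -[cup _ (a :: s)]/(D H [:: a] (a :: s) + cup (fun u => D H (a :: u)) s) DE.
by rewrite /D /= subr0 expr1 exprS; ring.
Qed.

Lemma prism_cup t H s : prism t (cup H) s =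
  cup (fun u v => prism t (H^~ (map t v)) u - (-1) ^+ size u * prism t (H u) v) s.
Proof.
elim: s H => [|a s IH] H //.
pose D K u v := prism t (K^~ (map t v)) u - (-1) ^+ size u * prism t (K u) v : int.
have DE : cup (fun u => D H (a :: u)) s =
    cup (fun u v => H [:: a, t a & map t u] (map t v)) s -
    cup (D (fun u => H (a :: u))) s.
  by rewrite -cupB; apply: eq_cup => u v; rewrite /D /= exprS; ring.
rewrite -[RHS]/(D H [:: a] (a :: s) + cup (fun u => D H (a :: u)) s) DE.
rewrite -(cup_map t (fun u v => H [:: a, t a & u] v)).
have prismD f g : prism t (fun r => f r + g r) s = prism t f s + prism t g s :> int.
  rewrite -[in RHS](opprK (prism t g s)) (prism_hom (h := -%R)) => [|x y]; last by abel.
  by rewrite -prismB; congr prism; apply/funext => r; rewrite opprK.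
rewrite [LHS]/= prismD IH /D /= expr1.
ring.
Qed.

End Cup.

(** * Equivariant choices of cocycles *)

Section PairModule.
Variables (G : groupType) (M N : gmodType G).

Definition pair_gact g (x : M * N) := (gmod_act g x.1, gmod_act g x.2).

Fact pair_gactD g : {morph pair_gact g : x y / x + y}.
Proof. by move=> [x x'] [y y']; rewrite /pair_gact /= !gmod_actD. Qed.
Fact pair_gact1 x : pair_gact 1 x = x.
Proof. by case: x => x y; rewrite /pair_gact /= !gmod_act1. Qed.
Fact pair_gactM g h x : pair_gact (g * h) x = pair_gact g (pair_gact h x).
Proof. by rewrite /pair_gact /= !gmod_actM. Qed.

HB.instance Definition _ := @isGModule.Build G (M * N)%type pair_gact
  pair_gactD pair_gact1 pair_gactM.

End PairModule.

(* An equivariant additive choice, for every alternating form b of degree j, of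
   a cocycle whose restriction to L represents m j times b. *)
Record good_section (G : groupType) (L : gmodType G) (m : nat -> int)
    (S : (seq L -> int) -> seq (L * G) -> int) : Prop := GoodSection {
  good_B : forall b b' s, S (fun r => b r - b' r) s = S b s - S b' s;
  good_nil : forall b, S b [::] = 0;
  good_tinv : forall b x, alternating b -> tinv x (S b);
  good_gam : forall b g s, alternating b ->
    S b (map (gam g) s) = S (fun xs => b (map (gmod_act g) xs)) s;
  good_ld : forall b s, alternating b -> ld (S b) s = 0;
  good_lev : forall b xs, alternating b -> lev 1%g xs (S b) = b xs *~ m (size xs)
}.

Section PowerSection.
Variables (G : groupType) (L : gmodType G) (n : nat).
Hypothesis alt0 : forall b : seq L -> int, alternating b ->
  forall xs, (n < size xs)%N -> b xs = 0.

(** The factor n!/j! makes the multiple equal to n! in every degree j, as the construction for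
    direct sums requires; degrees above n do not occur by [alt0]. *)
Definition pow_section (b : seq L -> int) : seq (L * G) -> int :=
  pow (fun xs => b xs *~ (n`! %/ (size xs)`!)%N).

Lemma steps_gam g (a : L * G) s : steps (gam g a) (map (gam g) s) =
  map (gmod_act g) (steps a s).
Proof. by elim: s a => [|a1 s IH] a //=; rewrite IH raddfB. Qed.

Lemma pow_section_good : good_section (fun=> n`!) pow_section.
Proof.
split=> [b b' s|b|b x ba|b g s ba|b s ba|b xs ba].
- by case: s => [|a s] /=; rewrite ?subr0 // mulrzBl.
- by [].
- exact: tinv_pow.
- by case: s => [|a s] //=; rewrite steps_gam size_map.
- exact/ld_pow/(alternating_scale (fun k => (n`! %/ k`!)%N : int)).
- rewrite lev_pow; last exact: (alternating_scale (fun k => (n`! %/ k`!)%N : int)).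
  have [n_lt|le_n] := ltnP n (size xs); first by rewrite alt0 // !mul0rz.
  have dv : ((size xs)`! %| n`!)%N.
    by rewrite -(bin_fact le_n) mulnCA; apply: dvdn_mulr.
  by rewrite -mulrzA -PoszM divnK.
Qed.

End PowerSection.

Section SumSection.
Variables (G : groupType) (M N : gmodType G) (m n : int).
Variables (S : (seq M -> int) -> seq (M * G) -> int).
Variables (T : (seq N -> int) -> seq (N * G) -> int).
Hypotheses (Sg : good_section (fun=> m) S) (Tg : good_section (fun=> n) T).
Implicit Types (b : seq (M * N) -> int) (xs : seq M) (ys : seq N).

Definition inl_ (x : M) : M * N := (x, 0).
Definition inr_ (y : N) : M * N := (0, y).
Lemma inl_D (x y : M) : inl_ (x + y) = inl_ x + inl_ y.
Proof. by rewrite -[RHS]/(x + y, 0 + 0) addr0. Qed.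

Lemma inr_D (x y : N) : inr_ (x + y) = inr_ x + inr_ y.
Proof. by rewrite -[RHS]/(0 + 0, x + y) addr0. Qed.

Definition fst_ (a : (M * N) * G) : M * G := (a.1.1, a.2).
Definition snd_ (a : (M * N) * G) : N * G := (a.1.2, a.2).

Definition prisms (V : zmodType) (Y : Type) (xs : seq V) (f : seq (V * Y) -> int) :=
  foldl (fun f x => prism (tau x) f) f xs.

Lemma prisms_rcons (V : zmodType) (Y : Type) (xs : seq V) x (f : seq (V * Y) -> int) :
  prisms (rcons xs x) f = prism (tau x) (prisms xs f).
Proof. by rewrite /prisms foldl_rcons. Qed.

Lemma prismsB (V : zmodType) (Y : Type) (xs : seq V) (f h : seq (V * Y) -> int) s :
  prisms xs (fun r => f r - h r) s = prisms xs f s - prisms xs h s.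
Proof.
elim/last_ind: xs s => [|xs x IH] s //; rewrite !prisms_rcons -prismB.
by congr prism; apply/funext => r; apply: IH.
Qed.

Lemma lev_prisms (V : zmodType) (Y : Type) (y0 : Y) (xs : seq V) f :
  lev y0 xs f = prisms xs f [:: (0, y0)].
Proof. by elim: xs f => [|x xs IH] f //=; rewrite IH. Qed.

Lemma tinv_prisms (V : zmodType) (Y : Type) (xs : seq V) (f : seq (V * Y) -> int) x :
  tinv x f -> tinv x (prisms xs f).
Proof.
by move=> fx; elim/last_ind: xs => [|xs y IH] //; rewrite prisms_rcons; apply: tinv_prism.
Qed.

Lemma map_fst_tau (x : M * N) u : map fst_ (map (tau x) u) = map (tau x.1) (map fst_ u).
Proof. by rewrite -!map_comp. Qed.

Lemma map_snd_tau (x : M * N) u : map snd_ (map (tau x) u) = map (tau x.2) (map snd_ u).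
Proof. by rewrite -!map_comp. Qed.

Lemma map_fst_gam g u : map fst_ (map (gam g) u) = map (gam g) (map fst_ u).
Proof. by rewrite -!map_comp. Qed.

Lemma map_snd_gam g u : map snd_ (map (gam g) u) = map (gam g) (map snd_ u).
Proof. by rewrite -!map_comp. Qed.

Definition sum_form b xs ys := b (map inl_ xs ++ map inr_ ys).

(** A cross product: T treats the variables in N, and S the form in the variables in M that results.
    The lists xs0 and ys0 record the edges of the cube already used by the evaluation. *)
Definition sum_kernel b (xs0 : seq M) (ys0 : seq N) (u v : seq ((M * N) * G)) :=
  prisms xs0 (S (fun xs => prisms ys0 (T (sum_form b xs)) (map snd_ v))) (map fst_ u).

Definition sum_section b : seq ((M * N) * G) -> int := cup (sum_kernel b [::] [::]).

Lemma good0 (L : gmodType G) k (R : (seq L -> int) -> seq (L * G) -> int) s :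
  good_section k R -> R (fun=> 0) s = 0.
Proof. by move=> Rg; rewrite -[RHS](subrr (R (fun=> 0) s)) -(good_B Rg). Qed.

Lemma alternating_inr b xs : alternating b -> alternating (sum_form b xs).
Proof.
move=> [bD b0]; split=> [s1 s2 x y|s1 s2 x]; rewrite /sum_form !map_cat /= !catA.
  by rewrite inr_D bD.
exact: b0.
Qed.

Lemma alternating_inl b ys0 v : alternating b ->
  alternating (fun xs => prisms ys0 (T (sum_form b xs)) v).
Proof.
move=> [bD b0].
have TE c c' c'' : (forall ys, c ys = c' ys + c'' ys) ->
    prisms ys0 (T c) v = prisms ys0 (T c') v + prisms ys0 (T c'') v.
  move=> cE; apply/eqP; rewrite -subr_eq -prismsB; apply/eqP.
  congr prisms; apply/funext => r; rewrite -(good_B Tg); congr (T _ r).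
  by apply/funext => ys; rewrite cE addrK.
split=> [s1 s2 x y|s1 s2 x].
  apply: TE => ys; by rewrite /sum_form !map_cat /= -!catA /= inl_D bD.
have -> : sum_form b (s1 ++ [:: x, x & s2]) = fun=> 0.
  by apply/funext => ys; rewrite /sum_form !map_cat /= -catA b0.
have T0 : T (fun=> 0) = fun=> 0 by apply/funext => r; apply: good0 Tg.
by have := TE (fun=> 0) (fun=> 0) (fun=> 0) (fun=> esym (addr0 0));
   rewrite -[X in X = _ -> _]addr0 => /addrI.
Qed.

(** The Koszul sign for carrying k prisms on the second factor across u. *)
Definition sgn_kernel k (H : seq ((M * N) * G) -> seq ((M * N) * G) -> int) u v :=
  (-1) ^+ (k * size u) * H u v : int.

Lemma prism_scale (U : Type) t (k : nat -> int) (f : seq U -> int) s :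
  prism t (fun r => k (size r) * f r) s = k (size s).+1 * prism t f s.
Proof.
elim: s k f => [|a s IH] k f /=; first by rewrite mulr0.
by rewrite size_map (IH (fun i => k i.+1)) mulrBr.
Qed.

Lemma prism_sum_kernel1 b xs0 ys0 (x : M * N) u v : alternating b ->
  prism (tau x) (fun w => sum_kernel b xs0 ys0 w (map (tau x) v)) u =
  sum_kernel b (rcons xs0 x.1) ys0 u v.
Proof.
move=> ba; rewrite /sum_kernel prisms_rcons.
rewrite -(@prism_precomp _ _ _ fst_ (tau x) (tau x.1)) //.
congr prism; apply/funext => w; congr (prisms _ (S _) _); apply/funext => xs.
rewrite map_snd_tau.
by apply: tinv_prisms; apply: (good_tinv Tg); apply: alternating_inr.
Qed.

Lemma prism_sum_kernel2 b xs0 ys0 (x : M * N) u v :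
  prism (tau x) (sum_kernel b xs0 ys0 u) v =
  sum_kernel b xs0 (rcons ys0 x.2) u v.
Proof.
rewrite /sum_kernel.
pose h (f : seq M -> int) := prisms xs0 (S f) (map fst_ u).
have hB : {morph h : f g / f - g}.
  move=> f g; rewrite /h -prismsB; congr prisms; apply/funext => r.
  exact: (good_B Sg).
pose Phi w xs := prisms ys0 (T (sum_form b xs)) (map snd_ w).
rewrite -[LHS]/(prism (tau x) (fun w => h (Phi w)) v) -prism_hom //.
congr (prisms _ (S _) _); apply/funext => xs; rewrite prisms_rcons.
rewrite -(@prism_precomp _ _ _ snd_ (tau x) (tau x.2)) //.
by rewrite (prism_hom (h := fun f : seq M -> int => f xs)).
Qed.

(** Each edge x goes to the first factor through x.1 or to the second through x.2. The two
    contributions add up because b is additive in x = (x.1, 0) + (0, x.2), the sign being that of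
    moving (x.1, 0) before ys0. *)
Lemma lev_sum_kernel b xs0 ys0 rest : alternating b ->
  lev 1%g rest (cup (sgn_kernel (size ys0) (sum_kernel b xs0 ys0))) =
  (-1) ^+ size ys0 * (b (map inl_ xs0 ++ map inr_ ys0 ++ rest) * (m * n)).
Proof.
elim: rest xs0 ys0 => [|x rest IH] xs0 ys0 ba /=.
  rewrite addr0 cats0 /sgn_kernel muln1 /sum_kernel /=.
  rewrite -[fst_ _]/(0, 1%g) -[snd_ _]/(0, 1%g); congr (_ * _).
  rewrite -(lev_prisms 1%g); have -> : (fun xs =>
      prisms ys0 (T (sum_form b xs)) [:: (0, 1%g)]) = fun xs => sum_form b xs ys0 *~ n.
    apply/funext => xs; rewrite -(lev_prisms 1%g) (good_lev Tg) //.
    exact: alternating_inr.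
  rewrite (good_lev Sg) -?mulrzA ?mulrzz /sum_form 1?[n * m]mulrC //.
  apply: (alternating_scale (fun=> n)); split=> [s1 s2 y z|s1 s2 y].
    by rewrite !map_cat /= -!catA /= inl_D ba.1.
  by rewrite !map_cat /= -catA ba.2.
have -> : prism (tau x) (cup (sgn_kernel (size ys0) (sum_kernel b xs0 ys0))) =
  fun s => (-1) ^+ size ys0 *
      cup (sgn_kernel (size ys0) (sum_kernel b (rcons xs0 x.1) ys0)) s -
    cup (sgn_kernel (size (rcons ys0 x.2)) (sum_kernel b xs0 (rcons ys0 x.2))) s.
  apply/funext => s; rewrite prism_cup -cupZ -cupB; apply: eq_cup => u v.
  rewrite /sgn_kernel.
  rewrite (prism_scale _ (fun i => (-1) ^+ (size ys0 * i)) (fun w => sum_kernel b xs0 ys0 w _)).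
  rewrite prism_sum_kernel1 //.
  rewrite (prism_scale _ (fun=> (-1) ^+ (size ys0 * size u)) (sum_kernel b xs0 ys0 u)).
  by rewrite prism_sum_kernel2 size_rcons mulnS mulSn !exprD; ring.
have levM c (f : seq ((M * N) * G) -> int) (zs : seq (M * N)) :
    lev 1%g zs (fun s => c * f s) = c * lev 1%g zs f.
  rewrite mulrC -mulrzz -levZ; congr lev; apply/funext => s.
  by rewrite mulrzz mulrC.
rewrite levB levM !IH // size_rcons exprS !map_rcons !cat_rcons.
have xE : x = inl_ x.1 + inr_ x.2.
  by case: x => x y; rewrite -[RHS]/(x + 0, 0 + y) addr0 add0r.
have bx : b (map inl_ xs0 ++ map inr_ ys0 ++ x :: rest) =
    b (map inl_ xs0 ++ map inr_ ys0 ++ inl_ x.1 :: rest) +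
    b (map inl_ xs0 ++ map inr_ ys0 ++ inr_ x.2 :: rest).
  by rewrite [in LHS]xE !catA ba.1.
rewrite bx (alternating_move _ _ (inl_ x.1) _ ba) size_map mulrzz.
ring.
Qed.

Lemma sum_section_good : good_section (fun=> m * n) sum_section.
Proof.
have S0 (f : seq M -> int) s : (forall xs, f xs = 0) -> S f s = 0.
  by move=> f0; rewrite (_ : f = fun=> 0) ?(good0 s Sg) //; apply/funext.
have T0 (f : seq N -> int) s : (forall ys, f ys = 0) -> T f s = 0.
  by move=> f0; rewrite (_ : f = fun=> 0) ?(good0 s Tg) //; apply/funext.
split=> [b b' s|b|b x ba|b g s ba|b s ba|b xs ba].
- rewrite /sum_section -cupB; apply: eq_cup => u v; rewrite /sum_kernel /=.
  rewrite -(good_B Sg); congr (S _ _); apply/funext => xs.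
  by rewrite -(good_B Tg).
- by [].
- move=> s; rewrite /sum_section cup_map; apply: eq_cup => u v.
  rewrite /sum_kernel /= map_fst_tau.
  rewrite (good_tinv Sg); last exact: (alternating_inl [::] _ ba).
  congr (S _ _); apply/funext => xs.
  rewrite map_snd_tau.
  by apply: (good_tinv Tg); apply: alternating_inr.
- rewrite /sum_section cup_map; apply: eq_cup => u v; rewrite /sum_kernel /=.
  rewrite map_fst_gam.
  rewrite (good_gam Sg); last exact: (alternating_inl [::] _ ba).
  congr (S _ _); apply/funext => xs.
  rewrite map_snd_gam.
  rewrite (good_gam Tg); last exact: alternating_inr.
  congr (T _ _); apply/funext => ys; rewrite /sum_form map_cat -!map_comp.
  congr (b (_ ++ _)); apply: eq_map => z /=.
    by rewrite /inl_ -[RHS]/(gmod_act g z, gmod_act g 0) raddf0.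
  by rewrite /inr_ -[RHS]/(gmod_act g 0, gmod_act g z) raddf0.
- rewrite /sum_section ld_cup (_ : sum_kernel _ _ _ [::] _ = 0); last first.
    exact: good_nil Sg _.
  rewrite (_ : sum_kernel _ _ _ s [::] = 0); last first.
    by apply: S0 => xs; apply: good_nil Tg _.
  rewrite subr0 mulr0 addr0 -[RHS](cup0 s); apply: eq_cup => u v.
  rewrite /sum_kernel /= ld_precomp (good_ld Sg); last exact: (alternating_inl [::] _ ba).
  pose h (f : seq M -> int) := S f (map fst_ u).
  have hB : {morph h : f g / f - g} by move=> f g; apply: (good_B Sg).
  pose Phi w xs := T (sum_form b xs) (map snd_ w).
  rewrite -[ld _ v]/(ld (fun w => h (Phi w)) v) -ld_hom // sub0r.
  rewrite [h _]S0 ?mulr0 ?oppr0 // => xs.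
  rewrite (ld_hom (h := fun f : seq M -> int => f xs)) // /Phi ld_precomp.
  by rewrite (good_ld Tg) //; apply: alternating_inr.
- have := lev_sum_kernel [::] [::] xs ba; rewrite expr0 mul1r mulrzz => <-.
  congr lev; apply: funext => s; apply: eq_cup => u v.
  by rewrite /sgn_kernel mul0n expr0 mul1r.
Qed.

End SumSection.

(** Forms are pulled back along i and cocycles along r. Evaluation then sees the vectors i (r x) = k
    x, so the multiple depends on the degree through k^n. *)
Lemma retract_section (G : groupType) (L M : gmodType G) m S
    (i : {additive M -> L}) (r : {additive L -> M}) (k : nat) :
  (forall g x, i (gmod_act g x) = gmod_act g (i x)) ->
  (forall g x, r (gmod_act g x) = gmod_act g (r x)) ->
  (forall x, i (r x) = x *+ k) ->
  @good_section G M m S ->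
  exists T, @good_section G L (fun n => m n * k%:Z ^+ n) T.
Proof.
move=> iG rG ir Sg; pose t (a : L * G) := (r a.1, a.2).
have tE x a : t (tau x a) = tau (r x) (t a) by rewrite /t /tau /= raddfD.
have tG g a : t (gam g a) = gam g (t a) by rewrite /t /gam /= rG.
have bi b : alternating b -> alternating (fun xs => b (map i xs)) :> Prop.
  by apply: alternating_map => x y; apply: raddfD.
exists (fun b s => S (fun xs => b (map i xs)) (map t s)).
split=> [b b' s|b|b x ba|b g s ba|b s ba|b xs ba].
- exact: (good_B Sg).
- exact: (good_nil Sg).
- move=> s; have -> : map t (map (tau x) s) = map (tau (r x)) (map t s).
    by rewrite -!map_comp; apply: eq_map => a; apply: tE.
  by apply: (good_tinv Sg); apply: bi.
- have -> : map t (map (gam g) s) = map (gam g) (map t s).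
    by rewrite -!map_comp; apply: eq_map => a; apply: tG.
  rewrite (good_gam Sg); last exact: bi.
  congr (S _ _); apply/funext => xs; rewrite -!map_comp; congr b.
  by apply: eq_map => x; apply: iG.
- by rewrite (ld_precomp t) (good_ld Sg) //; apply: bi.
- have -> : forall f ys, lev 1%g ys (fun s => f (map t s)) = lev 1%g (map r ys) f.
    move=> f ys; elim: ys f => [|y ys IH] f /=; first by rewrite /t /= raddf0.
    rewrite -IH; congr lev; apply/funext => s.
    by apply: prism_precomp => a; rewrite tE.
  rewrite (good_lev Sg); last exact: bi.
  rewrite size_map mulrC mulrzA -map_comp; congr (_ *~ _).
  have -> : map (i \o r) xs = map (fun x => x *+ k) xs by apply: eq_map.
  rewrite -[b xs]/(b ([::] ++ xs)) -[b (map _ _)]/(b ([::] ++ map _ _)).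
  elim: xs [::] => [|x xs IH] s; first by rewrite expr0 mulr1z.
  rewrite /= -cat_rcons IH cat_rcons pmulrn (alternating_z ba) exprS.
  by rewrite -mulrzA mulrC.
Qed.

(** * Transfer *)

Lemma ld_prism_cocycle (L : zmodType) (Y : Type) x (f : seq (L * Y) -> int) :
  tinv x f -> (forall s, ld f s = 0) -> forall s, ld (prism (tau x) f) s = 0.
Proof.
move=> fx f0 s; have := prism_homotopy (tau x) f s.
have -> : ld f = fun=> 0 by apply/funext.
by rewrite prism0 addr0 fx subrr.
Qed.

(** Translation by h also moves the base point of the cube, from (0, 1) to (0, h); for a cocycle
    this is harmless, since in degree 0 a cocycle is constant. *)
Lemma lev_gam (G : groupType) (L : gmodType G) h xs (f : seq (L * G) -> int) :
  f [::] = 0 -> (forall x, tinv x f) -> (forall s, ld f s = 0) ->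
  lev 1%g xs (fun s => f (map (gam h) s)) = lev 1%g (map (gmod_act h) xs) f.
Proof.
elim: xs f => [|x xs IH] f f0 fx fd /=.
  have := fd [:: gam h (0, 1%g); (0, 1%g)]; rewrite /= !subr0.
  by move/subr0_eq->.
rewrite -IH //; last 2 first.
- by move=> y; apply: tinv_prism.
- exact: ld_prism_cocycle.
congr lev; apply/funext => s; apply: prism_precomp => a; exact: gam_tau.
Qed.

Section Splitting.
Variables (G : finGroupType) (L : gmodType G) (bs : seq (L * dual L)).
Hypotheses (bsP : basis_for bs) (bsd : dual_system bs).
Variables (m : nat -> int) (S : (seq L -> int) -> seq (L * G) -> int).
Hypotheses (Sg : good_section m S) (m_coprime : forall n, coprimez (m n) #|G|).

(** The form is twisted by g and the list by its inverse, so each summand restricts to b itself on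
    L; summing over g restores equivariance at the price of the factor #|G|. *)
Definition transfer (b : seq L -> int) (s : seq (L * G)) : int :=
  \sum_(g : G) nsec bs (fun xs => b (map (gmod_act g) xs)) (map (gam g^-1) s).

Lemma alternating_act b g : alternating b ->
  alternating (fun xs => b (map (gmod_act g : L -> L) xs) : int).
Proof. by apply: alternating_map => x y; apply: gmod_actD. Qed.

Lemma transfer_good : good_section (fun=> #|G|%:Z) transfer.
Proof.
have sum_ld (F : G -> seq (L * G) -> int) s :
    ld (fun r => \sum_g F g r) s = \sum_g ld (F g) s.
  elim: s F => [|a s IH] F /=; first by rewrite big1.
  by rewrite (IH (fun g r => F g (a :: r))) -sumrB.
have sum_prism (F : G -> seq (L * G) -> int) t s :
    prism t (fun r => \sum_g F g r) s = \sum_g prism t (F g) s.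
  elim: s F => [|a s IH] F /=; first by rewrite big1.
  by rewrite (IH (fun g r => F g (a :: r))) -sumrB.
split=> [b b' s|b|b x ba s|b h s ba|b s ba|b xs ba]; rewrite /transfer.
- by rewrite -sumrB; apply: eq_bigr => g _; apply: nsecB.
- by rewrite big1 // => g _; apply: nsec_nil.
- apply: eq_bigr => g _; rewrite -[RHS](nsec_tinv _ _ (gmod_act g^-1 x)).
  congr nsec; rewrite -!map_comp; apply: eq_map => a; exact: gam_tau.
- rewrite (reindex_inj (mulgI h)) /=; apply: eq_bigr => g _.
  rewrite -map_comp; congr nsec; last first.
    by apply: eq_map => a; rewrite /= -gamM invMg mulgKV.
  apply/funext => xs; rewrite -map_comp; congr b.
  by apply: eq_map => x; apply: gmod_actM.
- rewrite sum_ld big1 // => g _; rewrite (ld_precomp (gam g^-1)).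
  exact: nsec_cocycle.
- have lev_sum ys (F : G -> seq (L * G) -> int) :
      lev 1%g ys (fun s => \sum_g F g s) = \sum_g lev 1%g ys (F g).
    elim: ys F => [|y ys IH] F //=.
    by rewrite -IH; congr lev; apply/funext => s; apply: sum_prism.
  rewrite lev_sum.
  rewrite (eq_bigr (fun=> b xs)) => [|g _]; first by rewrite sumr_const pmulrn cardT.
  rewrite lev_gam; last 3 first.
  - exact: nsec_nil.
  - by move=> x; apply: nsec_tinv.
  - by move=> s; apply: nsec_cocycle.
  rewrite lev_nsec; last exact: alternating_act.
  rewrite -!map_comp; congr b; rewrite -[RHS]map_id; apply: eq_map => x /=.
  by rewrite bsP -gmod_actM mulgV gmod_act1.
Qed.

Lemma section_splitting k : zmod_isom
    (cohomology (triv_gmod (semidirect L) int) k)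
    (dirsum (fun j : 'I_k.+1 => cohomology (ext_power j (dual L)) (k - j))).
Proof.
have uvP n : exists uv : int * int, uv.1 * m n + uv.2 * #|G| = 1.
  by have /coprimezP[uv] := m_coprime n; exists uv.
pose a n := (sval (cid (uvP n))).1; pose c n := (sval (cid (uvP n))).2.
have acP n : a n * m n + c n * #|G| = 1 := svalP (cid (uvP n)).
have Tg := transfer_good.
(* The Bezout coefficients depend on the degree because m does; the truncation keeps only degree
   j. *)
pose sct j (u : ext_power j (dual L)) : lfun L (triv_char G) :=
  ltrunc j.+1 (fun s => S (pr u) s *~ a j + transfer (pr u) s *~ c j).
apply: (@semidirect_splitting G L bs bsP bsd sct).
- move=> j u v; apply/funext => s; rewrite -[RHS]/(sct j u s - sct j v s) /sct /ltrunc.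
  case: eqP => _; last by rewrite subr0.
  rewrite prB (good_B Sg) (good_B Tg) !mulrzBl; abel.
- move=> j g u; apply/funext => s; rewrite lactE mulr1z /sct /ltrunc size_map.
  case: eqP => // _; have ua := alternating_pr u.
  rewrite (good_gam Sg) // (good_gam Tg) //.
  by have -> : pr (gmod_act g u) = fun xs => pr u (map (gmod_act g^-1) xs)
    by apply/funext => xs; apply: pr_gact.
- move=> j u; apply: lcochain_ltrunc => // x s; have ua := alternating_pr u.
  by rewrite (good_tinv Sg) // (good_tinv Tg).
- move=> j u; apply/funext => s; have ua := alternating_pr u.
  rewrite -[LHS]/(ld (ltrunc _ _) s) ld_ltrunc /ltrunc; case: eqP => // _.
  have ldZz k' (f : seq (L * G) -> int) : ld (fun r => f r *~ k') s = ld f s *~ k'.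
    by rewrite (ld_hom (h := fun z => z *~ k')) // => x y; apply: mulrzBl.
  by rewrite (ldD (fun r => S (pr u) r *~ a j)) !ldZz (good_ld Sg) // (good_ld Tg) // !mul0rz.
- move=> j u xs xsj; have ua := alternating_pr u.
  transitivity (lev 1%g xs (fun s => S (pr u) s *~ a j + transfer (pr u) s *~ c j)).
    by apply: lev_eq_size => s sn; rewrite /sct /ltrunc sn xsj eqxx.
  rewrite levD !levZ (good_lev Sg) // (good_lev Tg) // xsj -!mulrzA -mulrzDr.
  by rewrite mulrC [X in _ + X]mulrC acP mulr1z.
Qed.

End Splitting.

(** * The regular module *)

Section Generic.
Variables (G : groupType) (L : gmodType G) (X : signchar G) (bs : seq (L * dual L)).
Hypotheses (bsP : basis_for bs) (bsd : dual_system bs).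
Implicit Types z : lfun L X.

Lemma lev_act g z xs : lcochain false (size xs).+1 z -> ldf z = 0 ->
  lev 1%g xs (gmod_act g z) = lev 1%g (map (gmod_act g^-1%g) xs) z *~ X g.
Proof.
move=> [z0 _ zx _] zd; rewrite -lev_gam // -?levZ // => s.
by have := congr1 (fun f : lfun L X => f s) zd.
Qed.

Lemma lcochain_weak n z : lcochain true n z -> lcochain false n z.
Proof. by case. Qed.

Lemma nsec_lcochain b n : lcochain false n (ltrunc n (nsec bs b) : lfun L X).
Proof.
apply: lcochain_ltrunc => // [_|x]; [exact: nsec_nil | exact: nsec_tinv].
Qed.

Lemma ldf_nsec b n : ldf (ltrunc n (nsec bs b) : lfun L X) = 0.
Proof.
apply/funext => s; rewrite -[LHS]/(ld (ltrunc n _) s) ld_ltrunc /ltrunc.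
by rewrite nsec_cocycle; case: eqP.
Qed.

Lemma lev_nsec_ltrunc n b xs : alternating b -> size xs = n ->
  lev 1%g xs (ltrunc n.+1 (nsec bs b) : seq (L * G) -> int) = b xs.
Proof.
move=> ba <-; transitivity (lev 1%g xs (nsec bs b : seq (L * G) -> int)).
  by apply: lev_eq_size => s sn; rewrite /ltrunc sn eqxx.
by rewrite lev_nsec // -[in RHS](map_id xs); congr b; apply: eq_map => x; apply: bsP.
Qed.

Lemma lev_coboundary n z xs : lcochain false n z -> lev 1%g xs (ldf z) = 0.
Proof. by case=> z0 _ zx _; apply: lev_ld. Qed.

Lemma lev_pr n z : lcochain false n.+1 z -> ldf z = 0 ->
  exists u : ext_power n (dual L), forall xs, lev 1%g xs z = pr u xs.
Proof.
move=> zA zd; pose u := uvec bs n (fun xs => lev 1%g xs z); exists u => xs.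
have [xsn|xsn] := eqVneq (size xs) n; last first.
  by rewrite pr_size // (lev_lcochain zA) // => -[] /eqP; rewrite (negPf xsn).
have [ys ysbs ysn|a aA ->] := lev_class bsP bsd zA (nsec_lcochain (pr u) n.+1) zd
    (ldf_nsec (pr u) n.+1).
  by rewrite lev_nsec_ltrunc ?pr_uvec //; apply: alternating_pr.
rewrite levD (lev_coboundary _ aA) add0r lev_nsec_ltrunc //.
exact: alternating_pr.
Qed.

Lemma alternating_lev n z : lcochain false n.+1 z -> ldf z = 0 ->
  alternating (fun xs => lev 1%g xs z).
Proof.
move=> zA zd; have [u zu] := lev_pr zA zd.
have -> : (fun xs => lev 1%g xs z) = pr u by apply/funext.
exact: alternating_pr.
Qed.

Lemma red_lev_class n z : lcochain true n.+1 z -> ldf z = 0 ->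
  (forall xs, size xs = n -> lev 1%g xs z = 0) ->
  exists2 a : lfun L X, lcochain true n a & z = ldf a.
Proof.
move=> zA zd z0; have [||a [a0 an ax _]] :=
  lev_class bsP bsd (lcochain_weak zA) (lcochain0 L X false n.+1) zd.
- exact: raddf0.
- by move=> xs _ xsn; rewrite z0 // [RHS]lev0.
(* t retracts Gamma onto G. As z vanishes on G, subtracting the pullback of a along t does not
   change the differential, and it makes the primitive vanish on G. *)
rewrite addr0 => za; pose t (b : L * G) : L * G := (0, b.2).
exists (fun s => a s - a (map t s)).
  split=> [|s sn|x s|_ s]; rewrite /= ?a0 ?subr0 //.
  - by rewrite !an ?subr0 // size_map.
  - by rewrite ax -map_comp.
  - by rewrite -map_comp subrr.
have [_ _ _ zr] := zA.
apply/funext => s; rewrite -[RHS]/(ld (fun r => a r - a (map t r)) s) ldB ld_map.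
rewrite -[ld a s]/(ldf a s) -[ld a (map t s)]/(ldf a (map t s)) -za.
by rewrite (_ : map t s = [seq (0, g) | g <- map snd s]) ?zr ?subr0 // -map_comp.
Qed.

End Generic.

(** * Forms of degree at least the rank *)

Section TopForm.
Variables (G : groupType) (L : gmodType G).
Implicit Types (bs : seq (L * dual L)) (b : seq L -> int).

Lemma alternating_rank bs b xs : alternating b -> (size bs < size xs)%N ->
  b (map (proj bs) xs) = 0.
Proof.
elim: bs b xs => [|[x c] bs IH] b xs ba /=.
  by case: xs => [|y xs] // _; rewrite (alternating_0 ba [::]).
move=> bs_xs; rewrite (@alternating_expand _ _ _ b c (proj bs) x xs ba).
rewrite IH ?add0r //; last exact: ltnW.
case: xs bs_xs => // y xs bs_xs.
transitivity (lder c (fun=> 0 : int) (y :: xs)); last exact: lder0.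
apply: (eq_lder_size (n := size xs)) => // s sn.
by apply: (IH (fun r => b (x :: r))); [apply: alternating_cons | rewrite sn].
Qed.

Lemma alternating_top bs b xs : alternating b -> size xs = size bs ->
  b (map (proj bs) xs) = b (unzip1 bs) * pair (unzip2 bs) xs.
Proof.
elim: bs b xs => [|[x c] bs IH] b xs ba; first by case: xs => //=; rewrite mulr1.
move=> /= xs_bs; rewrite (@alternating_expand _ _ _ b c (proj bs) x xs ba).
rewrite alternating_rank ?add0r // ?xs_bs //.
rewrite (lder_hom (h := fun z => b (x :: unzip1 bs) * z)) => [|y z]; last exact: mulrBr.
case: xs xs_bs => // y xs [xs_bs].
apply: (eq_lder_size (n := size bs)) => [s sn|]; last by rewrite /= xs_bs.
by rewrite (IH (fun r => b (x :: r))) //; apply: alternating_cons.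
Qed.

Lemma pair_dual bs : dual_system bs -> pair (unzip2 bs) (unzip1 bs) = 1.
Proof.
elim: bs => [|[x c] bs IH] //= [/= cx cbs bsd].
rewrite IH // cx lder_all0 ?subr0 ?mulr1z // => y.
elim: bs cbs {IH bsd} => //= bc bs IHb.
by case/andP=> /andP[/eqP cb' _] /IHb cbs; rewrite inE => /predU1P[->|/cbs].
Qed.

End TopForm.

(** * The regular module and its grading by G *)

Section RegularModule.
Variable G : finGroupType.

Definition regmod : Type := {ffun G -> int}.
HB.instance Definition _ := GRing.Zmodule.on regmod.
Implicit Types x y : regmod.

Definition reg_act (g : G) x : regmod := [ffun h => x (g^-1 * h)%g].

Fact reg_actD g : {morph reg_act g : x y / x + y}.
Proof. by move=> x y; apply/ffunP => h; rewrite !ffunE. Qed.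
Fact reg_act1 x : reg_act 1%g x = x.
Proof. by apply/ffunP => h; rewrite ffunE invg1 mul1g. Qed.
Fact reg_actM g h x : reg_act (g * h)%g x = reg_act g (reg_act h x).
Proof. by apply/ffunP => k; rewrite !ffunE invMg mulgA. Qed.

HB.instance Definition _ := @isGModule.Build G regmod reg_act reg_actD reg_act1 reg_actM.

Lemma reg_actE g x h : (gmod_act g x : regmod) h = x (g^-1 * h)%g.
Proof. by rewrite [LHS]ffunE. Qed.

Definition dl (h : G) : regmod := [ffun k => if k == h then 1 else 0].

Lemma act_dl g h : gmod_act g (dl h) = dl (g * h)%g.
Proof. by apply/ffunP => k; rewrite reg_actE !ffunE -(can2_eq (mulKVg g) (mulKg g)). Qed.

Definition evl (h : G) (x : regmod) : int := x h.
Fact evl_is_zmod_morphism h : zmod_morphism (evl h).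
Proof. by move=> x y; rewrite /evl !ffunE. Qed.
HB.instance Definition _ h := GRing.isZmodMorphism.Build regmod int (evl h)
  (evl_is_zmod_morphism h).

Definition regbasis (s : seq G) : seq (regmod * dual regmod) :=
  [seq (dl h, evl h : dual regmod) | h <- s].

Lemma regmod_mulrz x k h : (x *~ k : regmod) h = x h *~ k.
Proof. by apply: (@morph_mulrz regmod int (evl h)); apply: raddfB. Qed.

Lemma proj_regbasis s x : proj (regbasis s) x = \sum_(h <- s) dl h *~ x h.
Proof.
elim: s => [|h s IH] /=; first by rewrite big_nil.
by rewrite big_cons IH addrC.
Qed.

Lemma regmod_sum x : x = \sum_h dl h *~ x h.
Proof.
apply/ffunP => k; rewrite -[RHS]/(evl k _) raddf_sum /= (bigD1 k) //=.
rewrite /evl regmod_mulrz ffunE eqxx -mulrzr mul1r intz big1 ?addr0 // => h hk.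
by rewrite regmod_mulrz ffunE eq_sym (negPf hk) mul0rz.
Qed.

Lemma regbasis_for : basis_for (regbasis (enum G)).
Proof. by move=> x; rewrite proj_regbasis big_enum -regmod_sum. Qed.

Lemma regbasis_dual s : uniq s -> dual_system (regbasis s).
Proof.
elim: s => [|h s IH] //= /andP[hs s_uniq]; split; last exact: IH.
  by rewrite /evl ffunE eqxx.
elim: s hs {IH s_uniq} => [|k s IH] //=; rewrite inE negb_or => /andP[hk /IH ->].
by rewrite andbT /dual_pair /= /evl !ffunE (eq_sym k h) (negPf hk) eqxx.
Qed.

Section Weights.
Hypothesis mulGC : forall g h : G, (g * h = h * g)%g.
Implicit Types b : seq regmod -> int.

(* The part of weight w of a multilinear form, for the grading of the regular
   module in which dl h has weight h. *)
Fixpoint weight (w : G) b (xs : seq regmod) : int :=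
  if xs is x :: xs' then
    \sum_h weight (h^-1 * w)%g (fun r => b (dl h :: r)) xs' *~ x h
  else if w == 1%g then b [::] else 0.

Lemma weightB w b b' xs :
  weight w (fun r => b r - b' r) xs = weight w b xs - weight w b' xs.
Proof.
elim: xs w b b' => [|x xs IH] w b b' /=; first by case: eqP; rewrite ?subr0.
by rewrite -sumrB; apply: eq_bigr => h _; rewrite IH mulrzBl.
Qed.

Lemma weightN w b xs : weight w (fun r => - b r) xs = - weight w b xs.
Proof.
elim: xs w b => [|x xs IH] w b /=; first by case: eqP; rewrite ?oppr0.
by rewrite -sumrN; apply: eq_bigr => h _; rewrite IH mulNrz.
Qed.

(** As G is commutative, exchanging two basis vectors keeps the total weight and changes the sign of
    b. So the value on a repeated vector equals its opposite, and is zero in Z. *)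
Lemma alternating_weight w b : alternating b -> alternating (weight w b).
Proof.
split.
  move=> s1; elim: s1 w b H => [|y s1 IH] w b ba s2 u v /=.
    by rewrite -big_split; apply: eq_bigr => h _; rewrite ffunE mulrzDr.
  rewrite -big_split; apply: eq_bigr => h _.
  by rewrite IH ?mulrzDl //; apply: alternating_cons.
move=> s1; elim: s1 w b H => [|y s1 IH] w b ba s2 x /=; last first.
  by rewrite big1 // => h _; rewrite IH ?mul0rz //; apply: alternating_cons.
pose B h k := weight (k^-1 * (h^-1 * w))%g (fun r => b [:: dl h, dl k & r]) s2.
have Banti h k : B h k = - B k h.
  rewrite /B -weightN !mulgA [(k^-1 * _)%g]mulGC; congr weight.
  by apply/funext => r; apply: (alternating_swap ba [::]).
set A := \sum_h _; have AE : A = \sum_h \sum_k B h k * (x k * x h).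
  apply: eq_bigr => h _; rewrite mulrzz mulr_suml; apply: eq_bigr => k _.
  by rewrite mulrzz -mulrA.
suff : A = - A by lia.
rewrite {1}AE exchange_big AE -sumrN; apply: eq_bigr => h _.
by rewrite -sumrN; apply: eq_bigr => k _; rewrite Banti; ring.
Qed.

Lemma weight_act w g b xs :
  weight w (fun r => b (map (gmod_act g) r)) (map (gmod_act g^-1%g) xs) =
  weight (g ^+ size xs * w)%g b xs.
Proof.
elim: xs w b => [|x xs IH] w b /=; first by rewrite mul1g.
rewrite (reindex_inj (mulgI g^-1%g)) /=; apply: eq_bigr => h _.
rewrite reg_actE invgK mulKVg act_dl mulKVg; congr (_ *~ _).
rewrite (IH _ (fun r => b (dl h :: r))); congr weight.
by rewrite invMg invgK !mulgA expgSr [(_ * h^-1)%g]mulGC !mulgA.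
Qed.

Lemma sum_weight b xs : alternating b -> \sum_w weight w b xs = b xs.
Proof.
elim: xs b => [|x xs IH] b ba /=; first by rewrite -big_mkcond big_pred1_eq.
rewrite exchange_big /=.
have bB : {morph (fun y => b (y :: xs)) : u v / u - v}.
  move=> u v; apply: (addIr (b (v :: xs))).
  by rewrite -[LHS](ba.1 [::] xs (u - v) v) !subrK.
pose F := GRing.isZmodMorphism.Build regmod int (fun y => b (y :: xs)) bB.
pose fa : {additive regmod -> int} := HB.pack (fun y => b (y :: xs)) F.
rewrite {2}(regmod_sum x) -[RHS]/(fa _) raddf_sum; apply: eq_bigr => h _.
rewrite (morph_mulrz (h := fa)) /=; last exact: bB.
rewrite -(IH (fun r => b (dl h :: r))); last exact: alternating_cons.
rewrite mulrzz mulr_suml (reindex_inj (mulgI h)) /=.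
by apply: eq_bigr => w _; rewrite mulKg mulrzz.
Qed.

End Weights.
End RegularModule.

(** * Vanishing of the obstruction groups *)

Section ReducedCohomology.
Variables (G : finGroupType) (X : signchar G).
Hypotheses (G_prime : prime #|G|) (mulGC : forall g h : G, (g * h = h * g)%g).
Local Notation L := (regmod G).
Local Notation bs := (regbasis (enum G)).
Local Notation C := (lfun L X).
Implicit Types (z : C) (c : seq G -> C).
Let bsP : basis_for bs := @regbasis_for G.
Let bsd : dual_system bs := regbasis_dual (enum_uniq _).

Definition redcocycle n z := lcochain true n z /\ ldf z = 0.

Lemma redcocycleB n z z' : redcocycle n z -> redcocycle n z' -> redcocycle n (z - z').
Proof.
by move=> [zA zd] [z'A z'd]; split; [apply: lcochainB | rewrite raddfB /= zd z'd subrr].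
Qed.

Lemma redcocycle0 n : redcocycle n 0.
Proof. by split; [apply: lcochain0 | apply: raddf0]. Qed.

Lemma redcocycleD n z z' : redcocycle n z -> redcocycle n z' -> redcocycle n (z + z').
Proof.
move=> zZ z'Z; rewrite -[z']opprK -[- z']sub0r.
by apply/redcocycleB/redcocycleB => //; apply: redcocycle0.
Qed.

Lemma redcocycle_act n g z : redcocycle n z -> redcocycle n (gmod_act g z).
Proof.
by move=> [zA zd]; split; [apply: lcochain_act | rewrite ldfG zd raddf0].
Qed.

Lemma weightZ w (b : seq L -> int) k xs :
  weight w (fun r => b r *~ k) xs = weight w b xs *~ k.
Proof.
elim: xs w b => [|x xs IH] w b /=; first by case: eqP; rewrite ?mul0rz.
rewrite mulrzz mulr_suml; apply: eq_bigr => h _.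
by rewrite (IH _ (fun r => b (dl h :: r))) !mulrzz mulrAC.
Qed.

(** All L-components are 0 on G, which kills every cup product; only the constant term in length 1
    survives. *)
Lemma nsec_G (b : seq L -> int) (s : seq G) : (1 < size s)%N ->
  nsec bs b [seq (0, g) | g <- s] = 0.
Proof.
elim: bs b => [|[x c] bs' IH] b s_gt /=; first by rewrite size_map gtn_eqF.
rewrite IH // add0r; case: s s_gt {IH} => [|g [|h s]] //= _.
by rewrite subrr raddf0 mulr0z.
Qed.

Section Average.
Variable n : nat.
Hypotheses (n_gt0 : (0 < n)%N) (n_lt : (n < #|G|)%N).

(** A lift to cocycles of the projection of forms onto weight 1, the neutral element of G. On
    evaluations, its conjugates are the projections onto all weights. *)
Definition weight1 z : C := ltrunc n.+1 (nsec bs (weight 1%g (fun xs => lev 1%g xs z))).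

Lemma weight1_redcocycle z : redcocycle n.+1 (weight1 z).
Proof.
split; last exact: ldf_nsec.
have [zA zn zx _] := nsec_lcochain X bs (weight 1%g (fun xs => lev 1%g xs z)) n.+1.
split=> // _ s; rewrite /weight1 /ltrunc size_map; case: eqP => // sn.
by apply: nsec_G; rewrite sn ltnS.
Qed.

Lemma weight1B : {morph weight1 : z z' / z - z'}.
Proof.
move=> z z'; apply/funext => s.
rewrite -[RHS]/(weight1 z s - weight1 z' s) /weight1 /ltrunc.
case: eqP => _; last by rewrite subr0.
rewrite -nsecB; congr nsec; apply/funext => xs; rewrite -weightB.
by congr weight; apply/funext => ys; apply: levB.
Qed.

Definition conj_weight1 g z : C := gmod_act g (weight1 (gmod_act g^-1%g z)).

Lemma conj_weight1B g : {morph conj_weight1 g : z z' / z - z'}.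
Proof. by move=> z z'; rewrite /conj_weight1 !raddfB weight1B raddfB. Qed.

Lemma lev_conj_weight1 g z xs : redcocycle n.+1 z -> size xs = n ->
  lev 1%g xs (conj_weight1 g z) = weight (g ^+ n)%g (fun ys => lev 1%g ys z) xs.
Proof.
move=> zZ xsn; have [wA wd] := weight1_redcocycle (gmod_act g^-1 z).
have [zA' zd'] := redcocycle_act g^-1 zZ; have [zA zd] := zZ.
rewrite lev_act ?xsn //; last exact: lcochain_weak.
rewrite lev_nsec_ltrunc ?size_map //; last first.
  exact/alternating_weight/(alternating_lev bsP bsd (lcochain_weak zA')).
have -> : (fun ys => lev 1%g ys (gmod_act g^-1 z)) =
    fun ys => lev 1%g (map (gmod_act g) ys) z *~ X g^-1%g.
  apply/funext => ys; have [ysn|ysn] := eqVneq (size ys) n.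
    by rewrite lev_act ?ysn ?invgK //; apply: lcochain_weak.
  have ysn' : (size ys).+1 <> n.+1 by case=> /eqP; rewrite (negPf ysn).
  by rewrite (lev_lcochain zA') // (lev_lcochain zA) ?size_map // mul0rz.
rewrite weightZ (weight_act mulGC 1%g g (fun r => lev 1%g r z)) xsn mulg1 -mulrzA -chiM mulVg chi1.
by rewrite mulr1z.
Qed.

Lemma sum_conj_weight1 z xs : redcocycle n.+1 z -> size xs = n ->
  lev 1%g xs (\sum_g conj_weight1 g z) = lev 1%g xs z.
Proof.
move=> zZ xsn; have [zA zd] := zZ.
have -> : lev 1%g xs (\sum_g conj_weight1 g z) = \sum_g lev 1%g xs (conj_weight1 g z).
  rewrite (big_morph (fun f : C => lev 1%g xs f) (id1 := 0) (op1 := +%R)) //.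
    by move=> f h; apply: levD.
  exact: lev0.
rewrite -[RHS](sum_weight (b := fun ys => lev 1%g ys z)); last first.
  exact: (alternating_lev bsP bsd (lcochain_weak zA) zd).
(* Raising to the power n permutes G since 0 < n < p, so every weight is reached exactly once. *)
rewrite [RHS](reindex_inj (h := fun g => g ^+ n)%g) /=.
  by apply: eq_bigr => g _; apply: lev_conj_weight1.
have nG : coprime #|[set: G]| n by rewrite cardsT prime_coprime // gtnNdvd.
by move=> g h gh; rewrite -(expgK nG (in_setT g)) gh (expgK nG (in_setT h)).
Qed.

End Average.

(** For a projection pi with sum_g g pi g^-1 = 1, the cochain sum_g g pi g^-1 c(g :: s) is a
    primitive of c. Here that identity holds only after evaluation, and so does the conclusion. *)
Lemma average n i c : (n < #|G|)%N -> lequi c ->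
  (forall s, size s = i.+1 -> redcocycle n.+1 (c s)) ->
  (forall s, size s = i.+2 -> ld c s = 0) ->
  exists b, [/\ lequi b, forall s, redcocycle n.+1 (b s) &
    forall s xs, size s = i.+1 -> size xs = n -> lev 1%g xs (c s - ld b s) = 0].
Proof.
move=> n_lt cE cZ c0; case: (posnP n) => [n0|n_gt0].
  (* In degree 0 the evaluation is the value at (0, 1), which is zero because reduced cochains
     vanish on G. *)
  exists (fun=> 0); split=> [g s|s|s xs sn xsn].
  - by rewrite raddf0.
  - exact: redcocycle0.
  - rewrite ld0 subr0; move: xsn; rewrite n0 => /size0nil ->.
    by have [[_ _ _ /(_ isT [:: 1%g])]] := cZ s sn.
have sumZ k (F : G -> C) : (forall g, redcocycle k (F g)) -> redcocycle k (\sum_g F g).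
  move=> FZ; elim/big_rec: _ => [|g x _ xZ]; first exact: redcocycle0.
  exact: redcocycleD.
exists (fun s => \sum_g conj_weight1 n g (c (g :: s))); split.
- move=> h s; rewrite (reindex_inj (mulgI h)) raddf_sum; apply: eq_bigr => g _.
  rewrite -[_ :: _]/(map (mulg h) (g :: s)) cE /conj_weight1.
  by rewrite invMg !gmod_actM -(gmod_actM h^-1%g) mulVg gmod_act1.
- by move=> s; apply: sumZ => g; apply/redcocycle_act/weight1_redcocycle.
- move=> s xs sn xsn; have cs := cZ s sn.
  have -> : ld (fun r => \sum_g conj_weight1 n g (c (g :: r))) s =
      \sum_g conj_weight1 n g (c s).
    have sum_ld (F : G -> seq G -> C) r :
        ld (fun q => \sum_g F g q) r = \sum_g ld (F g) r.
      elim: r F => [|a r IH] F /=; first by rewrite big1.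
      by rewrite (IH (fun g q => F g (a :: q))) -sumrB.
    rewrite sum_ld.
    apply: eq_bigr => g _.
    rewrite -(ld_hom (h := conj_weight1 n g)); last exact: conj_weight1B.
    by congr conj_weight1; apply/esym/subr0_eq/(c0 (g :: s)); rewrite /= sn.
  by rewrite levB sum_conj_weight1 // subrr.
Qed.

Lemma lcochain_ld n c s : (forall s, lcochain true n (c s)) -> lcochain true n (ld c s).
Proof.
elim: s c => [|g s IH] c cA /=; first exact: lcochain0.
by apply: lcochainB => //; apply: IH.
Qed.

Lemma red_lift n i c : lequi c ->
  (forall s, size s = i.+1 -> redcocycle n.+1 (c s)) ->
  (forall s xs, size s = i.+1 -> size xs = n -> lev 1%g xs (c s) = 0) ->
  exists a, [/\ lequi a, forall s, lcochain true n (a s) &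
    forall s, size s = i.+1 -> c s = ldf (a s)].
Proof.
move=> cE cZ c0.
have [||a [aE aR a0]] := @lequi_lift G C C
    (fun x y => lcochain true n y /\ x = ldf y) i c cE.
- by move=> g x y [yA ->]; rewrite ldfG; split=> //; apply: lcochain_act.
- move=> s sn; have [sA sd] := cZ s sn.
  have [|a aA sa] := red_lev_class bsP bsd sA sd; last by exists a.
  by move=> xs; apply: c0.
exists a; split=> // [s|s /aR[]//].
by have [/aR[]//|/eqP/a0->] := eqVneq (size s) i.+1; apply: lcochain0.
Qed.

(** Dimension shifting. Length n + 1 means forms of degree n < p, so after [average] c becomes ldf
    a. Then [ld a] is a G-cocycle of the next degree with values in reduced cocycles of length n; by
    induction it bounds, and a can be corrected by the acyclicity of the cochains. *)
Lemma red_vanish n i c : (n <= #|G|)%N -> lequi c ->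
  (forall s, size s = i.+2 -> redcocycle n (c s)) ->
  (forall s, size s = i.+3 -> ld c s = 0) ->
  exists b, [/\ lequi b, forall s, redcocycle n (b s) &
    forall s, size s = i.+2 -> c s = ld b s].
Proof.
elim: n i c => [|n IH] i c n_le cE cZ c0.
  exists (fun=> 0); split=> [g s|s|s sn]; rewrite ?raddf0 ?ld0 //.
    exact: redcocycle0.
  by apply: lcochain_nil (cZ s sn).1.
have [b0 [b0E b0Z cb0]] := average n_le cE cZ c0.
have [|||a [aE aA ca]] := @red_lift n i.+1 (fun s => c s - ld b0 s).
- by apply: lequiB => //; apply: lequi_ld.
- move=> s sn; apply: redcocycleB; first exact: cZ.
  split; first by apply: lcochain_ld => r; case: (b0Z r).
  rewrite /= (ld_hom (h := @ldf G L X)); last exact: raddfB.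
  by rewrite -[RHS](ld0 C s); congr ld; apply/funext => r; case: (b0Z r).
- by move=> s xs; apply: cb0.
have lda s : size s = i.+3 -> ld (fun r => ldf (a r)) s = 0.
  move=> sn; rewrite -(ld_eq_size (n := i.+2) (f1 := fun r => c r - ld b0 r)) //.
  by rewrite ldB c0 // ld_ld subr0.
have [||b1 [b1E b1Z ab1]] := IH i.+1 (ld a) (ltnW n_le) (lequi_ld aE).
- move=> s sn; split; first exact: lcochain_ld.
  by rewrite (ld_hom (h := @ldf G L X)) ?lda //; apply: raddfB.
- by move=> s _; apply: ld_ld.
have [||a' [a'E a'A aba']] := @lcochain_exact G L X true n i.+1
    (fun s => a s - b1 s) (lequiB aE b1E).
- by move=> s; apply: lcochainB => //; case: (b1Z s).
- by move=> s sn; rewrite ldB ab1 // subrr.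
exists (fun s => b0 s + ldf (a' s)); split=> [g s|s|s sn].
- by rewrite b0E a'E ldfG raddfD.
- apply: redcocycleD => //; split; first exact: lcochain_ldf.
  by apply/funext => r; apply: ld_ld.
rewrite ldD -(ld_hom (h := @ldf G L X)) ?[X in _ + X]/=; last exact: raddfB.
rewrite -aba' // raddfB /= (b1Z s).2 subr0 -ca // addrC subrK //.
Qed.

End ReducedCohomology.

(** * A good section for the regular module *)

Section RegularGood.
Variable G : finGroupType.
Hypotheses (G_prime : prime #|G|) (mulGC : forall g h : G, (g * h = h * g)%g).
Local Notation L := (regmod G).
Local Notation bs := (regbasis (enum G)).
Let bsP : basis_for bs := @regbasis_for G.
Let bsd : dual_system bs := regbasis_dual (enum_uniq _).
Implicit Types b : seq L -> int.

Definition top_form : seq L -> int := pair (unzip2 bs).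
Definition top_tuple : seq L := unzip1 bs.

Lemma size_regbasis : size bs = #|G|.
Proof. by rewrite size_map cardE. Qed.

Lemma alternating_top_form : alternating top_form.
Proof. exact: alternating_pairr. Qed.

Lemma size_top_tuple : size top_tuple = #|G|.
Proof. by rewrite size_map size_regbasis. Qed.

Lemma top_form_tuple : top_form top_tuple = 1.
Proof. exact: pair_dual. Qed.

Lemma top_formP b xs : alternating b -> size xs = #|G| ->
  b xs = b top_tuple * top_form xs.
Proof.
move=> ba xsn; rewrite -alternating_top ?size_regbasis //.
by congr b; rewrite -[LHS]map_id; apply: eq_map => x; rewrite bsP.
Qed.

Lemma above_top b xs : alternating b -> (#|G| < size xs)%N -> b xs = 0.
Proof.
move=> ba xsn; rewrite -(@alternating_rank _ _ bs b xs) ?size_regbasis //.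
by congr b; rewrite -[LHS]map_id; apply: eq_map => x; rewrite bsP.
Qed.

(** The sign of translation by g as a permutation of G. *)
Definition top_chi (g : G) : int := top_form (map (gmod_act g) top_tuple).

Lemma top_form_act g xs : size xs = #|G| ->
  top_form (map (gmod_act g) xs) = top_chi g * top_form xs.
Proof.
move=> xsn; rewrite (@top_formP (fun xs => top_form (map (gmod_act g) xs))) //.
exact: alternating_act alternating_top_form.
Qed.

Fact top_chi1 : top_chi 1%g = 1.
Proof.
rewrite /top_chi -[RHS]top_form_tuple; congr top_form; rewrite -[RHS]map_id.
by apply: eq_map => x; apply: gmod_act1.
Qed.

Fact top_chiM g h : top_chi (g * h)%g = top_chi g * top_chi h.
Proof.
transitivity (top_form (map (gmod_act g) (map (gmod_act h) top_tuple))).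
  rewrite -map_comp; congr top_form.
  by apply: eq_map => x; apply: gmod_actM.
by rewrite top_form_act // size_map size_top_tuple.
Qed.

Definition top_char : signchar G := SignChar top_chi1 top_chiM.
Local Notation C := (lfun L top_char).

(* The obstruction to making the naive cocycle of the determinant invariant
   lies in a group which vanishes by red_vanish. *)
Lemma top_class : exists f : C, [/\ redcocycle #|G|.+1 f,
  forall g, gmod_act g f = f &
  forall xs, size xs = #|G| -> lev 1%g xs f = top_form xs].
Proof.
pose z : C := ltrunc #|G|.+1 (nsec bs top_form).
have zZ : redcocycle #|G|.+1 z.
  split; last exact: ldf_nsec.
  have [z0 zn zx _] := nsec_lcochain top_char bs top_form #|G|.+1.
  split=> // _ s; rewrite /z /ltrunc size_map; case: eqP => // sn.
  by apply: nsec_G; rewrite sn ltnS prime_gt0.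
have [zA zd] := zZ.
have lev_z xs : size xs = #|G| -> lev 1%g xs z = top_form xs.
  move=> xsn; rewrite /z lev_nsec_ltrunc //; exact: alternating_top_form.
have lev_gz g xs : size xs = #|G| -> lev 1%g xs (gmod_act g z) = top_form xs.
  move=> xsn; rewrite lev_act ?xsn //; last exact: lcochain_weak.
  rewrite lev_z ?size_map // top_form_act // mulrzz mulrC mulrA.
  by rewrite -[top_char g]/(top_chi g) -top_chiM mulgV top_chi1 mul1r.
(* The cochain of degree 0 formed by the translates of z; [ld k] measures the failure of z to be
   invariant. *)
pose k (s : seq G) : C := if s is g :: _ then gmod_act g z else 0.
have kE : lequi k by move=> g [|h s] /=; rewrite ?raddf0 ?gmod_actM.
have kZ s : redcocycle #|G|.+1 (k s).
  by case: s => [|g s] /=; [apply: redcocycle0 | apply: redcocycle_act].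
have lev_k (s : seq G) xs : size s = 1 -> size xs = #|G| -> lev 1%g xs (k s) = top_form xs.
  by case: s => [|g s] //= _; apply: lev_gz.
have ldkZ s : redcocycle #|G|.+1 (ld k s).
  elim: s (k) kZ => [|g s IH] q qZ /=; first exact: redcocycle0.
  by apply: redcocycleB => //; apply: IH.
have [||a [aE aA ka]] := @red_lift G top_char #|G| 1 (ld k) (lequi_ld kE).
- by move=> s _; apply: ldkZ.
- case=> [|g [|h []]] // xs _ xsn.
  by rewrite /= !subr0 levB !lev_gz // subrr.
have ldda s : ldf (ld a s) = ld (fun r => ldf (a r)) s.
  by apply: (ld_hom (h := @ldf G L top_char)); apply: raddfB.
have [||b [bE bZ ab]] :=
    @red_vanish G top_char G_prime mulGC #|G| 1 (ld a) (leqnn _) (lequi_ld aE).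
- move=> s sn; split; first exact: lcochain_ld.
  by rewrite ldda -(ld_eq_size (n := 2) (f1 := ld k)) // ld_ld.
- by move=> s _; apply: ld_ld.
have [||a' [a'E a'A aba']] := @lcochain_exact G L top_char true #|G| 1
    (fun s => a s - b s) (lequiB aE bE).
- by move=> s; apply: lcochainB => //; case: (bZ s).
- by move=> s sn; rewrite ldB ab // subrr.
(* Since [ld q] vanishes in length 2, q is constant on lists of length 1. Its value there is
   invariant, and coboundaries do not affect the evaluations. *)
pose q s : C := k s - ldf (a' s).
have qE : lequi q by apply: lequiB => // g s; rewrite a'E ldfG.
have q0 s : size s = 2 -> ld q s = 0.
  move=> sn; rewrite ldB ka // -[X in _ - X](ld_hom (h := @ldf G L top_char)).
    by rewrite -aba' // raddfB /= (bZ s).2 subr0 subrr.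
  exact: raddfB.
have q1 g : q [:: g] = q [:: 1%g].
  by have := q0 [:: 1%g; g] erefl; rewrite /= !subr0 => /subr0_eq.
exists (q [:: 1%g]); split=> [|g|xs xsn].
- apply: redcocycleB => //; split; first exact: lcochain_ldf.
  by apply/funext => s; apply: ld_ld.
- by rewrite -qE /= q1.
- by rewrite levB lev_k // (lev_coboundary _ (lcochain_weak (a'A _))) subr0.
Qed.

(** In degree j < p the successive differences carry the factor (p-1)!/j!. In degree p the integer
    quotient of (p-1)! by p! is 0, and the invariant cocycle of the determinant takes over. *)
Lemma regmod_good : exists S, @good_section G L (fun=> (#|G|.-1)`!) S.
Proof.
have [f [[fA fd] fG flev]] := top_class.
have [f0 fn fx _] := fA; set n := #|G|.-1.
have nG : #|G| = n.+1 by rewrite prednK // prime_gt0.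
pose D b : seq (L * G) -> int := pow (fun xs => b xs *~ (n`! %/ (size xs)`!)%N).
have top_chiV g : top_chi g^-1 * top_chi g = 1 by rewrite -top_chiM mulVg top_chi1.
have fgam g s : f (map (gam g) s) = top_chi g * f s.
  rewrite -{1}(fG g) lactE mulrzz mulrC; congr (_ * f _).
  rewrite -map_comp -[RHS]map_id; apply: eq_map => a /=.
  by rewrite -gamM mulVg gam1.
have ba_scale b : alternating b -> alternating (fun xs => b xs *~ (n`! %/ (size xs)`!)%N).
  exact: (alternating_scale (fun k => (n`! %/ k`!)%N : int)).
exists (fun b s => D b s + (b top_tuple * n`!) * f s).
split=> [b b' s|b|b x ba s|b g s ba|b s ba|b xs ba].
- rewrite /D; case: s => [|a s] /=; rewrite ?mulrzBl; ring.
- by rewrite f0 mulr0.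
- by rewrite /D tinv_pow fx.
- have -> : b (map (gmod_act g) top_tuple) = b top_tuple * top_chi g.
    by rewrite top_formP // size_map size_top_tuple.
  rewrite fgam; congr (_ + _); last by ring.
  by case: s => [|a s] //=; rewrite steps_gam size_map.
- rewrite ldD ld_pow; last exact: ba_scale.
  rewrite ldZ; have := congr1 (fun h : C => h s) fd; rewrite -[LHS]/(ld f s) => ->.
  by rewrite mulr0.
- rewrite levD lev_pow; last exact: ba_scale.
  have levM c (h : seq (L * G) -> int) ys : lev 1%g ys (fun s => c * h s) = c * lev 1%g ys h.
    rewrite mulrC -mulrzz -levZ; congr lev; apply/funext => s.
    by rewrite mulrzz mulrC.
  rewrite levM; case: (ltngtP (size xs) #|G|) => [xs_lt|xs_gt|xsn].
  + rewrite (lev_lcochain (lcochain_weak fA)) ?mulr0 ?addr0; last first.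
      by case=> xsn; rewrite xsn ltnn in xs_lt.
    have le_n : (size xs <= n)%N by rewrite -ltnS -nG.
    have dv : ((size xs)`! %| n`!)%N.
      by rewrite -(bin_fact le_n) mulnCA; apply: dvdn_mulr.
    by rewrite -mulrzA -PoszM divnK.
  + rewrite above_top // !mul0rz add0r (lev_lcochain (lcochain_weak fA)) ?mulr0 //.
    by case=> xsn; rewrite xsn ltnn in xs_gt.
  + rewrite flev // divn_small ?mulr0z ?mul0rz ?add0r; last first.
      by rewrite xsn nG factS ltn_Pmull ?fact_gt0 // -nG prime_gt1.
    by rewrite mulrAC -top_formP // mulrzz.
Qed.

End RegularGood.

(** * Splitting lattices up to factors prime to p *)

Definition dual_bases (M : zmodType) n (e : 'I_n -> M) (c : 'I_n -> {additive M -> int}) :=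
  (forall y, y = \sum_i e i *~ c i y) /\ (forall i j, c i (e j) = (i == j)%:Z).

Definition torsion_free (M : zmodType) := forall (x : M) n, (0 < n)%N -> x *+ n = 0 -> x = 0.

Lemma additive_mulrz (M N : zmodType) (f : {additive M -> N}) x k : f (x *~ k) = f x *~ k.
Proof. by apply: (@morph_mulrz M N f); apply: raddfB. Qed.

Section Lattice.
Variables (p : nat) (p_prime : prime p) (M : zmodType) (n : nat).
Variables (e : 'I_n -> M) (c : 'I_n -> {additive M -> int}).
Hypothesis ec : dual_bases e c.

Let coordP : forall y, y = \sum_i e i *~ c i y := ec.1.

Lemma coords_inj (x y : M) : (forall i, c i x = c i y) -> x = y.
Proof. by move=> xy; rewrite (coordP x) (coordP y); apply: eq_bigr => i _; rewrite xy. Qed.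

Lemma coord_sum i a : c i (\sum_j e j *~ a j) = a i.
Proof.
rewrite raddf_sum (bigD1 i) //= additive_mulrz ec.2 eqxx mulrzz mul1r.
rewrite big1 ?addr0 // => j ji; rewrite additive_mulrz ec.2 eq_sym (negPf ji).
by rewrite mulrzz mul0r.
Qed.

Lemma coordMn i (x : M) k : c i (x *+ k) = c i x * k%:Z.
Proof. by rewrite pmulrn additive_mulrz mulrzz. Qed.

Lemma dual_bases_torsion_free : torsion_free M.
Proof.
move=> x k k_gt0 xk; apply: coords_inj => i; rewrite raddf0.
have := congr1 (c i) xk; rewrite coordMn raddf0 => /eqP.
by rewrite mulf_eq0 => /orP[/eqP //|]; rewrite eqz_nat gtn_eqF.
Qed.

Lemma dvd_coords (q : nat) (x : M) : (forall i, (q %| c i x)%Z) -> exists y, x = y *+ q.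
Proof.
move=> qx; exists (\sum_i e i *~ (c i x %/ q)%Z); apply: coords_inj => i.
by rewrite coordMn coord_sum divzK.
Qed.

Lemma separating_coord (q : nat) (x : M) : ~ (exists y, x = y *+ q) -> exists i, ~~ (q %| c i x)%Z.
Proof.
move=> qx; apply: contrapT => qc; apply: qx; apply: dvd_coords => i.
by apply: contrapT => /negP ci; apply: qc; exists i.
Qed.

Lemma max_pow_divisor (x : M) : x != 0 ->
  exists a y, x = y *+ (p ^ a) /\ ~ exists z, y = z *+ p.
Proof.
move=> x0; have [i cx0] : exists i, c i x != 0.
  apply: contrapT => cx; move/eqP: x0; apply; apply: coords_inj => i.
  by rewrite raddf0; apply/eqP; apply: contrapT => /negP ci; apply: cx; exists i.
elim: {x}_.+1 {-2}x (ltnSn `|c i x|) x0 cx0 => // m IH x xm x0 cx0.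
have [[y xy]|nx] := EM (exists y, x = y *+ p); last first.
  by exists 0%N, x; rewrite mulr1n.
have cxy : c i x = c i y * p by rewrite xy coordMn.
have cy0 : c i y != 0 by apply: contraNneq cx0; rewrite cxy => ->; rewrite mul0r.
have [||a [z [yz nz]]] := IH y _ _ cy0.
- apply: leq_trans _ (xm : (`|c i x| <= m)%N); rewrite cxy abszM absz_nat.
  by rewrite ltn_Pmulr ?prime_gt1 // absz_gt0.
- by apply: contraNneq cy0 => ->; rewrite raddf0.
- by exists a.+1, z; split=> //; rewrite xy yz -mulrnA expnSr.
Qed.

Let Fp_dvd (m : int) : (p %| m)%Z = (m%:~R == 0 :> 'F_p) := dvdz_pcharf (pchar_Fp p_prime) m.

(* The adjugate of the matrix of z, with the sign of its determinant. *)
Lemma quasi_inverse (z : {additive M -> M}) :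
  (forall x y, z x = y *+ p -> exists y', x = y' *+ p) ->
  exists (w : {additive M -> M}) k, [/\ coprime p k,
    forall x, w (z x) = x *+ k & forall x, z (w x) = x *+ k].
Proof.
move=> z_inj; pose A : 'M[int]_n := \matrix_(i, j) c j (z (e i)).
pose v x : 'rV[int]_n := \row_j c j x.
have vA x : v (z x) = v x *m A.
  apply/rowP=> j; rewrite !mxE {1}[x]coordP raddf_sum /= raddf_sum.
  by apply: eq_bigr => i _; rewrite !mxE !additive_mulrz mulrzz mulrC.
have vB : {morph v : x y / x - y} by move=> x y; apply/rowP=> j; rewrite !mxE raddfB.
have v_inj x y : v x = v y -> x = y.
  by move=> xy; apply: coords_inj => i; have /rowP/(_ i) := xy; rewrite !mxE.
pose s := sgz (\det A).
pose w x := \sum_j e j *~ ((v x *m \adj A) 0 j * s).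
have vw x : v (w x) = s *: (v x *m \adj A).
  by apply/rowP=> j; rewrite [RHS]mxE [LHS]mxE coord_sum mulrC.
have wB : zmod_morphism w.
  move=> x y; apply: v_inj; rewrite vB !vw vB mulmxBl scalerBr //.
pose W : {additive M -> M} := HB.pack w (GRing.isZmodMorphism.Build M M w wB).
have kP x : v (x *+ `|\det A|%N) = s *: (v x *m (\det A)%:M).
  apply/rowP=> j; rewrite mul_mx_scalar !mxE coordMn abszEsg; ring.
exists W, `|\det A|%N; split=> [|x|x]; last 2 first.
- by apply: v_inj; rewrite vw vA kP -mulmxA mul_mx_adj.
- by apply: v_inj; rewrite vA vw kP -scalemxAl -mulmxA mul_adj_mx.
rewrite prime_coprime //; apply/negP => p_det.
(* If p divided the determinant, a kernel vector of A modulo p would lift to some x not divisible by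
   p with z x divisible by p. *)
have : \det (map_mx (intr : int -> 'F_p) A) == 0.
  by rewrite det_map_mx -Fp_dvd.
case/det0P=> u /negP u0 uA; apply: u0; apply/eqP/rowP => j; rewrite mxE.
pose x := \sum_j e j *~ (val (u 0 j) : int).
have ux i : (c i x)%:~R = u 0 i by rewrite coord_sum; apply: natr_Zp.
have [i|y zxy] := @dvd_coords p (z x).
  rewrite Fp_dvd; have /rowP/(_ i) := vA x; rewrite !mxE => ->.
  have /rowP/(_ i) := uA; rewrite !mxE => uAi.
  rewrite rmorph_sum -[X in _ == X]uAi; apply/eqP/eq_bigr => l _.
  by rewrite !mxE rmorphM /= ux.
have [y' xy'] := z_inj _ _ zxy; apply/eqP.
by rewrite -ux -Fp_dvd xy' coordMn dvdz_mull.
Qed.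

(** A certificate of independence modulo p: the matrix of values is triangular with an invertible
    diagonal. It bounds the number of summands that can be split off. *)
Fixpoint triangular (s : seq (M * {additive M -> int})) : Prop :=
  if s is xf :: s' then
    [/\ ~~ (p %| xf.2 xf.1)%Z, all (fun yf => xf.2 yf.1 == 0) s' & triangular s']
  else True.

Lemma triangular_nth d s i j : triangular s -> (i <= j < size s)%N ->
  if i == j then ~~ (p %| (nth d s i).2 (nth d s j).1)%Z
  else (nth d s i).2 (nth d s j).1 == 0.
Proof.
elim: s i j => [|xf s IH] i j; first by rewrite ltn0 andbF.
case: i j => [|i] [|j] //=; first by case.
  by case=> _ /(all_nthP d) s0 _; apply: s0.
by case=> _ _ /IH; apply.
Qed.

Lemma triangular_size s : triangular s -> (size s <= n)%N.
Proof.
move=> s_tri; case sE: s => [|d s'] //; rewrite -{s'}sE.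
pose F : 'M['F_p]_(size s, n) := \matrix_(i, l) ((nth d s i).2 (e l))%:~R.
pose X : 'M['F_p]_(n, size s) := \matrix_(l, j) (c l (nth d s j).1)%:~R.
have FX i j : (F *m X) i j = ((nth d s i).2 (nth d s j).1)%:~R.
  rewrite !mxE [(nth d s j).1 in RHS]coordP raddf_sum rmorph_sum; apply: eq_bigr => l _.
  by rewrite !mxE additive_mulrz mulrzz rmorphM.
have FX_unit : F *m X \in unitmx.
  rewrite unitmxE det_trig ?unitfE; last first.
    apply/is_trig_mxP => i j ij; rewrite FX.
    have := @triangular_nth d s i j s_tri; rewrite ltn_eqF // => /(_ _)/eqP-> //.
    by rewrite ltnW //=.
  apply/prodf_neq0 => i _; rewrite FX -Fp_dvd.
  by have := @triangular_nth d s i i s_tri; rewrite eqxx leqnn; apply; rewrite /=.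
by have := mulmx_max_rank F X; rewrite mxrank_unit.
Qed.

End Lattice.

Lemma proj_sum (M : zmodType) (bs : seq (M * {additive M -> int})) y :
  proj bs y = \sum_(b <- bs) b.1 *~ b.2 y.
Proof.
elim: bs => [|[x c] bs IH] /=; first by rewrite big_nil.
by rewrite big_cons IH addrC.
Qed.

Lemma dual_bases_seq (M : zmodType) (bs : seq (M * {additive M -> int})) :
  basis_for bs -> dual_system bs ->
  dual_bases (fun i => (tnth (in_tuple bs) i).1) (fun i => (tnth (in_tuple bs) i).2).
Proof.
move=> bsP bsd; split=> [y|i j]; first by rewrite -{1}(bsP y) proj_sum big_tnth.
pose d := tnth (in_tuple bs) i; rewrite !(tnth_nth d) /= -val_eqE /=.
move: d (val i) (val j) (ltn_ord i) (ltn_ord j) => d {}i {}j.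
elim: bs i j bsd {bsP} => [|bc bs IH] i j //= [b1 /(all_nthP d) b0 bsd].
case: i j => [|i] [|j] //= ilt jlt.
- by have /andP[/eqP-> _] := b0 j jlt.
- by have /andP[_ /eqP->] := b0 i ilt.
- exact: IH.
Qed.

(** * Norm and difference operators of a cyclic group *)

Section CyclicOperators.
Variables (G : finGroupType) (sg : G).
Hypotheses (G_prime : prime #|G|) (mulGC : forall g h : G, (g * h = h * g)%g).
Hypothesis sg_gen : forall g : G, exists k, g = (sg ^+ k)%g.
Local Notation p := #|G|.

Section Operators.
Variable M : gmodType G.
Implicit Types x y : M.

Definition gdiff x : M := gmod_act sg x - x.
Definition gnorm x : M := \sum_g gmod_act g x.
(* (g - 1) / (sg - 1), where sg generates G *)
Definition gpsum g x : M := \sum_(i < sval (cid (sg_gen g))) gmod_act (sg ^+ i)%g x.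

Fact gdiffB : zmod_morphism gdiff.
Proof. by move=> x y; rewrite /gdiff raddfB; abel. Qed.
HB.instance Definition _ := GRing.isZmodMorphism.Build M M gdiff gdiffB.

Fact gnormB : zmod_morphism gnorm.
Proof. by move=> x y; rewrite /gnorm -sumrB; apply: eq_bigr => g _; rewrite raddfB. Qed.
HB.instance Definition _ := GRing.isZmodMorphism.Build M M gnorm gnormB.

Fact psumB g : zmod_morphism (gpsum g).
Proof. by move=> x y; rewrite /gpsum -sumrB; apply: eq_bigr => i _; rewrite raddfB. Qed.
HB.instance Definition _ g := GRing.isZmodMorphism.Build M M (gpsum g) (psumB g).

Lemma actC g h x : gmod_act g (gmod_act h x) = gmod_act h (gmod_act g x).
Proof. by rewrite -!gmod_actM mulGC. Qed.

Lemma gnorm_act g x : gnorm (gmod_act g x) = gnorm x.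
Proof.
rewrite /gnorm [RHS](reindex_inj (mulIg g)) /=; apply: eq_bigr => h _.
by rewrite gmod_actM.
Qed.

Lemma act_gnorm g x : gmod_act g (gnorm x) = gnorm x.
Proof. by rewrite -[RHS](gnorm_act g) /gnorm raddf_sum; apply: eq_bigr => h _; apply: actC. Qed.

Lemma gdiff_psum g x : gdiff (gpsum g x) = gmod_act g x - x.
Proof.
rewrite [in RHS](svalP (cid (sg_gen g))) /gpsum.
elim: (sval _) => [|k IH]; first by rewrite big_ord0 raddf0 expg0 gmod_act1 subrr.
by rewrite big_ord_recr /= raddfD /= IH /gdiff -gmod_actM -expgS; abel.
Qed.

Lemma act_gdiff_psum g x : gmod_act g x = x + gdiff (gpsum g x).
Proof. by rewrite gdiff_psum; abel. Qed.

Lemma gdiff_act g x : gdiff (gmod_act g x) = gmod_act g (gdiff x).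
Proof. by rewrite /gdiff raddfB actC. Qed.

Lemma psum_gdiff g x : gpsum g (gdiff x) = gdiff (gpsum g x).
Proof. by rewrite /gpsum raddf_sum; apply: eq_bigr => i _; rewrite /= gdiff_act. Qed.

Lemma act_pow_gdiff k x : gmod_act (sg ^+ k)%g x = \sum_(i < k.+1) iter i gdiff x *+ 'C(k, i).
Proof.
elim: k => [|k IH]; first by rewrite big_ord1 bin0 expg0 gmod_act1.
rewrite expgS gmod_actM IH raddf_sum /=.
transitivity (\sum_(i < k.+1) iter i gdiff x *+ 'C(k, i) +
              \sum_(i < k.+1) iter i.+1 gdiff x *+ 'C(k, i)).
  by rewrite -big_split; apply: eq_bigr => i _ /=; rewrite raddfMn -mulrnDl /gdiff addrC subrK.
rewrite [RHS]big_ord_recl [X in X + _]big_ord_recl /= !bin0 -addrA; congr (_ + _).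
under [in RHS]eq_bigr => i _ do rewrite /bump /= add1n binS mulrnDr.
rewrite big_split /=; congr (_ + _); rewrite [RHS]big_ord_recr /= bin_small //.
by rewrite mulr0n addr0.
Qed.

(** Expand sg^p = 1 in powers of sg - 1: the binomial coefficients other than the extreme ones are
    divisible by p. *)
Lemma gdiff_nilpotent x : exists y, iter p gdiff x = y *+ p.
Proof.
have: gmod_act (sg ^+ p)%g x = x.
  by rewrite -cardsT expg_cardG ?inE // gmod_act1.
rewrite act_pow_gdiff; case: p G_prime => // q q_prime.
rewrite big_ord_recl big_ord_recr /= !add0n bin0 binn !mulr1n -[X in _ = X]addr0.
move/addrI/eqP; rewrite addrC addr_eq0 => /eqP->.
exists (- \sum_(i < q) iter i.+1 gdiff x *+ ('C(q.+1, i.+1) %/ q.+1)).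
rewrite mulNrn -sumrMnl; congr (- _); apply: eq_bigr => i _.
rewrite -mulrnA divnK //; apply: prime_dvd_bin => //=.
by rewrite /= ltnS ltn_ord.
Qed.

End Operators.

Lemma hom_gnorm (M N : gmodType G) (f : {additive M -> N}) x :
  (forall g x, f (gmod_act g x) = gmod_act g (f x)) -> f (gnorm x) = gnorm (f x).
Proof. by move=> fG; rewrite /gnorm raddf_sum; apply: eq_bigr => g _; rewrite fG. Qed.

Lemma hom_gdiff (M N : gmodType G) (f : {additive M -> N}) x :
  (forall g x, f (gmod_act g x) = gmod_act g (f x)) -> f (gdiff x) = gdiff (f x).
Proof. by move=> fG; rewrite /gdiff raddfB fG. Qed.

Lemma hom_psum (M N : gmodType G) (f : {additive M -> N}) g x :
  (forall g x, f (gmod_act g x) = gmod_act g (f x)) -> f (gpsum g x) = gpsum g (f x).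
Proof. by move=> fG; rewrite /gpsum raddf_sum; apply: eq_bigr => i _; rewrite fG. Qed.

(* As gdiff is nilpotent modulo p, a nonzero kernel modulo p meets the kernel of gdiff. *)
Lemma injective_mod (M N : gmodType G) (z : {additive M -> N}) :
  (forall g x, z (gmod_act g x) = gmod_act g (z x)) ->
  (forall x y y', z x = y *+ p -> gdiff x = y' *+ p -> exists x', x = x' *+ p) ->
  forall x y, z x = y *+ p -> exists x', x = x' *+ p.
Proof.
move=> zG z_inj; suff H k x y y' : z x = y *+ p -> iter k (@gdiff M) x = y' *+ p ->
    exists x', x = x' *+ p.
  by move=> x y xy; have [y' xy'] := gdiff_nilpotent x; apply: H xy xy'.
elim: k x y y' => [|k IH] x y y' xy; first by exists y'.
rewrite iterSr => txk; have ztx : z (gdiff x) = gdiff y *+ p by rewrite hom_gdiff // xy raddfMn.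
by have [x' tx] := IH _ _ _ ztx txk; apply: z_inj xy tx.
Qed.

End CyclicOperators.

Lemma rank_good (G : groupType) (L : gmodType G) (bs : seq (L * dual L)) :
  basis_for bs -> exists S, @good_section G L (fun=> (size bs)`!) S.
Proof.
move=> bsP; eexists; apply: pow_section_good => b ba xs xs_gt.
rewrite -(@alternating_rank _ _ bs b xs) //.
by congr b; rewrite -[LHS]map_id; apply: eq_map => x; rewrite bsP.
Qed.

(** * The augmentation ideal, of rank p - 1 *)

Section AugmentationModule.
Variable G : finGroupType.

Definition augmentation : {pred regmod G} := fun x => \sum_g x g == 0.

Fact augmentation_zmod_closed : zmod_closed augmentation.
Proof.
split=> [|x y /eqP x0 /eqP y0]; apply/eqP.
  by rewrite big1 // => g _; rewrite ffunE.
transitivity (\sum_g (x g - y g)); last by rewrite sumrB x0 y0 subrr.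
by apply: eq_bigr => g _; rewrite -[LHS]/(evl g (x - y)) raddfB.
Qed.
HB.instance Definition _ := GRing.isZmodClosed.Build _ augmentation
  augmentation_zmod_closed.

Record augmod := AugMod { augmod_val :> regmod G; _ : augmod_val \in augmentation }.
HB.instance Definition _ := [isSub for augmod_val].
HB.instance Definition _ := [Choice of augmod by <:].
HB.instance Definition _ := [SubChoice_isSubZmodule of augmod by <:].
Implicit Types x y : augmod.

Lemma augmod_sum x : \sum_g augmod_val x g = 0.
Proof. by case: x => x /= /eqP. Qed.

Fact aug_act_subproof g x : (gmod_act g (augmod_val x) : regmod G) \in augmentation.
Proof.
apply/eqP; rewrite -[RHS](augmod_sum x) (reindex_inj (mulgI g)) /=.
by apply: eq_bigr => h _; rewrite reg_actE mulKg.
Qed.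
Definition aug_act g x := AugMod (aug_act_subproof g x).

Fact aug_actD g : {morph aug_act g : x y / x + y}.
Proof. by move=> x y; apply: val_inj; apply: gmod_actD. Qed.
Fact aug_act1 x : aug_act 1%g x = x.
Proof. by apply: val_inj; apply: gmod_act1. Qed.
Fact aug_actM g h x : aug_act (g * h)%g x = aug_act g (aug_act h x).
Proof. by apply: val_inj; apply: gmod_actM. Qed.
HB.instance Definition _ := @isGModule.Build G augmod aug_act aug_actD aug_act1 aug_actM.

Fact aug_dl_subproof h : dl h - dl 1%g \in augmentation.
Proof.
have dl1 k : \sum_g dl k g = 1 :> int.
  rewrite (bigD1 k) //= ffunE eqxx big1 ?addr0 // => g gk.
  by rewrite ffunE (negPf gk).
apply/eqP; transitivity (\sum_g (dl h g - dl 1%g g) : int).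
  by apply: eq_bigr => g _; rewrite -[LHS]/(evl g (dl h - dl 1%g)) raddfB.
by rewrite sumrB !dl1 subrr.
Qed.
Definition aug_dl h := AugMod (aug_dl_subproof h).

Definition aug_evl h x : int := augmod_val x h.
Fact aug_evl_is_zmod_morphism h : zmod_morphism (aug_evl h).
Proof. by move=> x y; rewrite /aug_evl -[RHS](raddfB (@evl G h)) //. Qed.
HB.instance Definition _ h := GRing.isZmodMorphism.Build augmod int (aug_evl h)
  (aug_evl_is_zmod_morphism h).

Definition augbasis (s : seq G) : seq (augmod * dual augmod) :=
  [seq (aug_dl h, aug_evl h : dual augmod) | h <- s].
Definition nontrivial := rem 1%g (enum G).

Lemma augmod_inj x y : (forall h, h != 1%g -> augmod_val x h = augmod_val y h) -> x = y.
Proof.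
move=> xy; apply: val_inj; apply/ffunP => h /=.
have [->|/xy //] := eqVneq h 1%g; have := etrans (augmod_sum x) (esym (augmod_sum y)).
rewrite (bigD1 1%g) //= [in RHS](bigD1 1%g) //= (eq_bigr _ xy).
by move/addIr.
Qed.

Lemma aug_evl_dl h k : h != 1%g -> aug_evl h (aug_dl k) = (h == k)%:Z.
Proof.
move=> h1.
transitivity (dl k h - dl 1%g h); first exact: (raddfB (@evl G h)).
by rewrite !ffunE (negPf h1) subr0; case: eqP.
Qed.

Lemma augbasis_for : basis_for (augbasis nontrivial).
Proof.
move=> x; apply: augmod_inj => h h1; rewrite proj_sum /augbasis big_map /=.
rewrite -[LHS]/(aug_evl h _) raddf_sum (bigD1_seq h) ?rem_uniq ?enum_uniq //=; last first.
  by rewrite mem_rem_uniq ?enum_uniq // !inE h1 mem_enum.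
rewrite big1_seq ?addr0 => [|k /andP[kh _]]; rewrite (additive_mulrz (@aug_evl h)) /=.
  by rewrite aug_evl_dl // eqxx mulrzz mul1r.
by rewrite aug_evl_dl // eq_sym (negPf kh) mul0rz.
Qed.

Lemma augbasis_dual : dual_system (augbasis nontrivial).
Proof.
have: all (fun h : G => h != 1%g) nontrivial.
  by apply/allP => h; rewrite mem_rem_uniq ?enum_uniq // !inE => /andP[].
have: uniq nontrivial by rewrite rem_uniq ?enum_uniq.
elim: nontrivial => [|h s IH] //= /andP[hs us] /andP[h1 s1].
split; [by rewrite aug_evl_dl ?eqxx | | exact: IH].
rewrite all_map; apply/allP => k ks /=; have k1 : k != 1%g by have /allP := s1; apply.
have hk : h != k by apply: contraNneq hs => ->.
by rewrite /dual_pair /= !aug_evl_dl // (eq_sym k) (negPf hk).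
Qed.

Lemma size_augbasis : size (augbasis nontrivial) = #|G|.-1.
Proof. by rewrite size_map size_rem ?mem_enum // cardE. Qed.

Lemma augmod_good : exists S, @good_section G augmod (fun=> (#|G|.-1)`!) S.
Proof. by rewrite -size_augbasis; apply: rank_good augbasis_for. Qed.

End AugmentationModule.

Lemma coprime_divisible (M : zmodType) (p k : nat) (x y : M) :
  coprime p k -> x *+ k = y *+ p -> exists x', x = x' *+ p.
Proof.
move=> pk xy; have /coprimezP[[u v] /= uv] : coprimez p k by [].
exists (x *~ u + y *~ v).
rewrite mulrnDl -[x in LHS]mulr1z -uv mulrzDr mulrzA -pmulrn; congr (_ + _).
by rewrite mulrC mulrzA -pmulrn xy !pmulrn -!mulrzA mulrC.
Qed.

(** * Summands up to a factor prime to p *)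

Section Splittings.
Variables (G : finGroupType).
Hypothesis G_prime : prime #|G|.
Local Notation p := #|G|.
Variables (L : gmodType G) (n : nat) (e : 'I_n -> L) (c : 'I_n -> {additive L -> int}).
Hypothesis ec : dual_bases e c.

(* Up to the factor sm_mul, prime to p, a direct summand of L. *)
Record summand := Summand {
  sm_mod : gmodType G;
  sm_sec : (seq sm_mod -> int) -> seq (sm_mod * G) -> int;
  sm_const : nat;
  sm_in : {additive sm_mod -> L};
  sm_out : {additive L -> sm_mod};
  sm_mul : nat;
  _ : coprime p sm_const;
  _ : good_section (fun=> sm_const%:Z) sm_sec;
  _ : torsion_free sm_mod;
  _ : forall g x, sm_in (gmod_act g x) = gmod_act g (sm_in x);
  _ : forall g x, sm_out (gmod_act g x) = gmod_act g (sm_out x);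
  _ : coprime p sm_mul;
  _ : forall x, sm_out (sm_in x) = x *+ sm_mul
}.

Lemma sm_const_coprime Q : coprime p (sm_const Q). Proof. by case: Q. Qed.
Lemma sm_good Q : good_section (fun=> (sm_const Q)%:Z) (@sm_sec Q). Proof. by case: Q. Qed.
Lemma sm_torsion_free Q : torsion_free (sm_mod Q). Proof. by case: Q. Qed.
Lemma sm_in_act Q g x : sm_in Q (gmod_act g x) = gmod_act g (sm_in Q x).
Proof. by case: Q x. Qed.
Lemma sm_out_act Q g x : sm_out Q (gmod_act g x) = gmod_act g (sm_out Q x).
Proof. by case: Q. Qed.
Lemma sm_mul_coprime Q : coprime p (sm_mul Q). Proof. by case: Q. Qed.
Lemma sm_out_in Q x : sm_out Q (sm_in Q x) = x *+ sm_mul Q. Proof. by case: Q x. Qed.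

(** [sm_mul Q] times the projection onto the complement, which is the kernel of [sm_out Q]. *)
Definition sm_pi Q (x : L) : L := x *+ sm_mul Q - sm_in Q (sm_out Q x).

Fact sm_piB Q : zmod_morphism (sm_pi Q).
Proof. by move=> x y; rewrite /sm_pi (raddfB (sm_out Q)) (raddfB (sm_in Q)) mulrnBl; abel. Qed.
HB.instance Definition _ Q := GRing.isZmodMorphism.Build L L (sm_pi Q) (@sm_piB Q).

Lemma sm_pi_act Q g x : sm_pi Q (gmod_act g x) = gmod_act g (sm_pi Q x).
Proof. by rewrite /sm_pi sm_out_act sm_in_act raddfB raddfMn. Qed.

Lemma sm_pi_in Q x : sm_pi Q (sm_in Q x) = 0.
Proof. by rewrite /sm_pi sm_out_in raddfMn subrr. Qed.

Lemma sm_out_pi Q x : sm_out Q (sm_pi Q x) = 0.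
Proof. by rewrite /sm_pi raddfB raddfMn sm_out_in subrr. Qed.

Lemma sm_pi_ker Q x : sm_out Q x = 0 -> sm_pi Q x = x *+ sm_mul Q.
Proof. by rewrite /sm_pi => ->; rewrite raddf0 subr0. Qed.

(** The vectors of s lie, up to a factor prime to p, in the part already split off; the length of s
    measures progress. *)
Definition witnessed Q (s : seq (L * {additive L -> int})) : Prop :=
  triangular p s /\ all (fun xf => sm_pi Q xf.1 == 0) s.

(** The maps i and r are orthogonal to Q, and injectivity of r o i modulo p gives a quasi-inverse w
    with constant k. So P + Q is again a summand, with factor k K. The vector q produces the new
    witness. *)
Lemma extend_summand Q s (P : gmodType G) (S : (seq P -> int) -> seq (P * G) -> int) (m : nat) nP (eP : 'I_nP -> P)
    (cP : 'I_nP -> {additive P -> int}) (i : {additive P -> L})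
    (r : {additive L -> P}) (q : P) :
  witnessed Q s -> dual_bases eP cP -> coprime p m ->
  good_section (fun=> m%:Z) S ->
  (forall g x, i (gmod_act g x) = gmod_act g (i x)) ->
  (forall g x, r (gmod_act g x) = gmod_act g (r x)) ->
  (forall x, sm_out Q (i x) = 0) -> (forall x, r (sm_in Q x) = 0) ->
  (forall x y, r (i x) = y *+ p -> exists y', x = y' *+ p) ->
  ~ (exists y, q = y *+ p) ->
  exists Q' xf, witnessed Q' (xf :: s).
Proof.
move=> [s_tri s_pi] ecP pm Sg iG rG Qi ri ri_inj q_div.
have TP := dual_bases_torsion_free ecP.
pose z : {additive P -> P} := r \o i.
have zG g x : z (gmod_act g x) = gmod_act g (z x) by rewrite /= iG rG.
have [w [k [pk wz zw]]] := quasi_inverse G_prime ecP (z := z) ri_inj.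
have k_gt0 : (0 < k)%N by case: k pk {wz zw} => //; rewrite /coprime gcdn0 gtn_eqF ?prime_gt1.
(* The two sides agree after multiplication by k, and P is torsion-free. *)
have wG g x : w (gmod_act g x) = gmod_act g (w x).
  apply/eqP; rewrite -subr_eq0; apply/eqP; apply: (TP _ _ k_gt0).
  by rewrite -wz (raddfB z) zw zG zw -(raddfMn (gmod_act g)) subrr raddf0.
pose K := sm_mul Q.
pose i' (x : P * sm_mod Q) : L := i x.1 + sm_in Q x.2.
pose r' (x : L) : P * sm_mod Q := (w (r x) *+ K, sm_out Q x *+ k).
have i'B : zmod_morphism i' by move=> x y; rewrite /i' (raddfB i) (raddfB (sm_in Q)); abel.
have r'B : zmod_morphism r' by move=> x y; rewrite /r' (raddfB r) (raddfB w) (raddfB (sm_out Q)) !mulrnBl.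
pose I' : {additive (P * sm_mod Q)%type -> L} :=
  HB.pack i' (GRing.isZmodMorphism.Build _ _ i' i'B).
pose R' : {additive L -> (P * sm_mod Q)%type} :=
  HB.pack r' (GRing.isZmodMorphism.Build _ _ r' r'B).
have Q'P : exists Q', forall x, sm_pi Q' x = x *+ (k * K) - i' (r' x).
  have Q'TF : torsion_free (P * sm_mod Q)%type.
    move=> [x y] a a_gt0 xya; suff [-> ->] : x = 0 /\ y = 0 by []; split.
      apply: (TP _ _ a_gt0); rewrite -[LHS]/((x, y).1 *+ a) -(raddfMn fst) xya //.
    apply: (sm_torsion_free a_gt0); rewrite -[LHS]/((x, y).2 *+ a) -(raddfMn snd) xya //.
  have g' := sum_section_good Sg (sm_good Q).
  unshelve eexists (@Summand _ _ (m * sm_const Q)%N I' R' (k * K)%N _ g' Q'TF _ _ _ _) => //=.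
  - by rewrite coprimeMr pm sm_const_coprime.
  - by move=> g x; rewrite /i' raddfD /= iG sm_in_act.
  - by move=> g x; rewrite /r' rG wG sm_out_act -!(raddfMn (gmod_act g)).
  - by rewrite coprimeMr pk sm_mul_coprime.
  - move=> x; rewrite /r' /i' (raddfD r) (raddfD (sm_out Q)) /= ri addr0 wz Qi add0r sm_out_in.
    by rewrite -!mulrnA (mulnC K k) [RHS]surjective_pairing (raddfMn fst) (raddfMn snd).
have [Q' piE] := Q'P.
have [l cl] : exists l, ~~ (p %| c l (i q))%Z.
  apply: (separating_coord ec) => -[y iq]; apply: q_div.
  by apply: (@coprime_divisible _ p k _ (w (r y))) => //; rewrite -wz /= iq !raddfMn.
(* f kills the earlier witnesses, which [sm_pi Q] kills; on i q, which lies in the complement, it is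
   c l multiplied by an integer prime to p. *)
pose f : {additive L -> int} := c l \o sm_pi Q.
exists Q', (i q, f); split=> /=.
  split=> //.
    rewrite sm_pi_ker // (coordMn c) Gauss_dvdzl //; apply: sm_mul_coprime.
  by move: s_pi; apply: sub_all => yf /= /eqP->; rewrite raddf0.
apply/andP; split.
  rewrite piE /i' /r' /= Qi mul0rn raddf0 addr0 wz -mulrnA raddfMn subrr //.
move: s_pi; apply: sub_all => yf /= /eqP yf0; rewrite piE /i' /r' /=.
have yE : yf.1 *+ K = sm_in Q (sm_out Q yf.1) by apply/eqP; rewrite -subr_eq0; apply/eqP.
have -> : w (r yf.1) *+ K = 0 by rewrite -!raddfMn yE ri raddf0.
by rewrite raddf0 add0r raddfMn -yE -mulrnA mulnC subrr.
Qed.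

End Splittings.

Lemma prime_dvdzM p (a b : int) : prime p -> (p %| a * b)%Z = (p %| a)%Z || (p %| b)%Z.
Proof. by move=> p_prime; rewrite !dvdzE abszM Euclid_dvdM. Qed.

Lemma dvdz_congr (x y z : int) (p k : nat) :
  (x + y *+ p) *+ k = z * p -> (p %| x * k)%Z.
Proof.
rewrite !pmulrn !mulrzz => xyz; rewrite (_ : x * k = (z - y * k) * p) ?dvdz_mull //.
by rewrite mulrBl -xyz; ring.
Qed.

Lemma coprime_fact p : prime p -> coprime p (p.-1)`!.
Proof.
move=> p_prime; have : (p.-1 < p)%N by rewrite prednK ?prime_gt0.
elim: p.-1 => [|n IH] np; first by rewrite coprimen1.
rewrite factS coprimeMr IH ?(ltnW np) // andbT prime_coprime //.
by apply/negP => /(dvdn_leq (ltn0Sn n)); rewrite leqNgt np.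
Qed.

(** * Splitting off copies of ZG, Z and the augmentation ideal *)

Section Pieces.
Variables (G : finGroupType) (sg : G).
Hypotheses (G_prime : prime #|G|) (mulGC : forall g h : G, (g * h = h * g)%g).
Hypothesis sg_gen : forall g : G, exists k, g = (sg ^+ k)%g.
Local Notation p := #|G|.
Local Notation delta := (@gdiff G sg _).
Local Notation psum := (gpsum sg_gen).
Variables (L : gmodType G) (n : nat) (e : 'I_n -> L) (c : 'I_n -> {additive L -> int}).
Hypothesis ec : dual_bases e c.
Implicit Types (Q : @summand G L) (s : seq (L * {additive L -> int})) (x y : L).
Implicit Types a b : regmod G.

Lemma regmod_const_mod a b : delta a = b *+ p -> exists k : G -> int, forall g, a g = a 1%g + k g * p.
Proof.
move=> ab; exists (fun g => - evl g (psum g b)) => g.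
have /(congr1 (evl g)) : gmod_act g a - a = psum g b *+ p.
  by rewrite -(gdiff_psum sg_gen) -(psum_gdiff mulGC) ab raddfMn.
rewrite (raddfB (evl g)) (raddfMn (evl g)) /=.
have -> : evl g (gmod_act g a) = a 1%g by rewrite /evl reg_actE mulVg.
have -> : evl g a = a g by [].
rewrite -mulr_natr => ag; rewrite mulNr -natz -ag; ring.
Qed.

Lemma dvd_regmod a : (forall g, (p %| a g)%Z) -> exists b, a = b *+ p.
Proof.
move=> pa; exists [ffun g => (a g %/ p)%Z]; apply/ffunP => g.
rewrite pmulrn regmod_mulrz ffunE mulrzz divzK //.
Qed.

Lemma regmodB a b g : (a - b) g = a g - b g.
Proof. exact: (raddfB (evl g)). Qed.

Lemma regmodMn a k g : (a *+ k) g = a g * k%:Z.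
Proof. by rewrite pmulrn regmod_mulrz mulrzz. Qed.

Definition orbit_map x a : L := \sum_g gmod_act g x *~ a g.

Fact orbit_mapB x : zmod_morphism (orbit_map x).
Proof.
move=> a b; rewrite /orbit_map -sumrB; apply: eq_bigr => g _.
by rewrite -mulrzBr regmodB.
Qed.
HB.instance Definition _ x := GRing.isZmodMorphism.Build (regmod G) L (orbit_map x)
  (@orbit_mapB x).

Lemma orbit_map_act g x a : orbit_map x (gmod_act g a) = gmod_act g (orbit_map x a).
Proof.
rewrite /orbit_map raddf_sum [LHS](reindex_inj (mulgI g)); apply: eq_bigr => h _ /=.
by rewrite reg_actE mulKg gmod_actM additive_mulrz.
Qed.

Definition matrix_coef (f : {additive L -> int}) x : regmod G :=
  [ffun g => f (gmod_act g^-1%g x)].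

Fact matrix_coefB f : zmod_morphism (matrix_coef f).
Proof.
by move=> x y; apply/ffunP => g; rewrite regmodB !ffunE (raddfB (gmod_act _)) (raddfB f).
Qed.
HB.instance Definition _ f := GRing.isZmodMorphism.Build L (regmod G) (matrix_coef f)
  (@matrix_coefB f).

Lemma matrix_coef_act f g x : matrix_coef f (gmod_act g x) = gmod_act g (matrix_coef f x).
Proof. by apply/ffunP => h; rewrite reg_actE !ffunE invMg invgK gmod_actM. Qed.

Lemma orbit_map_const_mod x a (k : G -> int) : (forall g, a g = a 1%g + k g * p) ->
  orbit_map x a = gnorm x *~ a 1%g + (\sum_g gmod_act g x *~ k g) *+ p.
Proof.
move=> ak; rewrite /orbit_map /gnorm -sumrMnl mulrz_suml -big_split; apply: eq_bigr => g _ /=.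
by rewrite {1}ak mulrzDr mulrzA pmulrn.
Qed.

(** Choose a coordinate c l not divisible by p on the norm of x and let r be its matrix coefficient
    on the complement. By nilpotence of sg - 1 modulo p, injectivity need only be tested on
    functions constant modulo p, where r o [orbit_map x] is multiplication by c l (gnorm x) and
    [sm_mul Q]. *)
Lemma extend_regular Q s x : witnessed Q s -> sm_out Q x = 0 ->
  ~ (exists y, gnorm x = y *+ p) -> exists Q' xf, @witnessed G L Q' (xf :: s).
Proof.
move=> Qs Qx /(separating_coord ec)[l cl].
have [S Sg] := regmod_good G_prime mulGC.
have ecP := dual_bases_seq (@regbasis_for G) (regbasis_dual (enum_uniq G)).
pose r : {additive L -> regmod G} := matrix_coef (c l) \o sm_pi Q.
apply: (extend_summand G_prime ec (P := regmod G) (S := S) (i := orbit_map x) (r := r)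
  (q := dl 1%g) Qs ecP (coprime_fact G_prime) Sg).
- by move=> g a; apply: orbit_map_act.
- by move=> g y; rewrite /r /= sm_pi_act matrix_coef_act.
- move=> a; rewrite /orbit_map raddf_sum big1 // => g _.
  by rewrite additive_mulrz sm_out_act Qx raddf0 mul0rz.
- by move=> y; rewrite /r /= sm_pi_in raddf0.
- pose z : {additive regmod G -> regmod G} := r \o orbit_map x.
  apply: (@injective_mod G sg G_prime _ _ z).
    by move=> g a; rewrite /z /r /= orbit_map_act sm_pi_act matrix_coef_act.
  move=> a b b' zab ttab; have [k ak] := regmod_const_mod ttab.
  apply: dvd_regmod => g; rewrite ak rpredD ?dvdz_mull //.
  have /ffunP/(_ 1%g) := zab; rewrite regmodMn.
  rewrite /z /r /= ffunE invg1 gmod_act1 sm_pi_ker; last first.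
    rewrite /orbit_map raddf_sum big1 // => h _.
    by rewrite additive_mulrz sm_out_act Qx raddf0 mul0rz.
  rewrite (orbit_map_const_mod _ ak) (raddfMn (c l)) (raddfD (c l)) (raddfMn (c l)).
  rewrite additive_mulrz mulrzz => E.
  have : (p %| (c l (gnorm x) * a 1%g) * sm_mul Q)%Z.
    exact: dvdz_congr E.
  rewrite !prime_dvdzM // (negPf cl) /= => /orP[//|].
  by have := sm_mul_coprime Q; rewrite prime_coprime // dvdzE /= => /negPf->.
- case=> b /ffunP/(_ 1%g); rewrite regmodMn ffunE eqxx => b1.
 have := prime_gt1 G_prime.
  have : (p %| (1%R : int))%Z by rewrite b1 dvdz_mull.
  by rewrite dvdzE /= dvdn1 => /eqP ->.
Qed.

End Pieces.

Section Pieces.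
Variables (G : finGroupType) (sg : G).
Hypotheses (G_prime : prime #|G|) (mulGC : forall g h : G, (g * h = h * g)%g).
Hypothesis sg_gen : forall g : G, exists k, g = (sg ^+ k)%g.
Local Notation p := #|G|.
Local Notation delta := (@gdiff G sg _).
Local Notation psum := (gpsum sg_gen).
Variables (L : gmodType G) (n : nat) (e : 'I_n -> L) (c : 'I_n -> {additive L -> int}).
Hypothesis ec : dual_bases e c.
Implicit Types (Q : @summand G L) (s : seq (L * {additive L -> int})) (x y : L).
Implicit Types a b : regmod G.

(** Removing powers of p from the norm of x leaves y, still fixed since L is torsion-free. All norms
    in the complement being divisible by p, r can be divided by p: as gnorm y = p y, its value on y
    is c l y times [sm_mul Q], prime to p. *)
Lemma extend_trivial Q s x : witnessed Q s ->
  (forall y, sm_out Q y = 0 -> exists y', gnorm y = y' *+ p) ->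
  sm_out Q x = 0 -> gnorm x != 0 -> exists Q' xf, @witnessed G L Q' (xf :: s).
Proof.
move=> Qs Np Qx /(max_pow_divisor G_prime ec)[a [y [xy]]].
move=> /(separating_coord ec)[l cl]; have TL := dual_bases_torsion_free ec.
have pa_gt0 : (0 < p ^ a)%N by rewrite expn_gt0 prime_gt0.
have Qy : sm_out Q y = 0.
  apply: (sm_torsion_free pa_gt0); rewrite -(raddfMn (sm_out Q)) -xy.
  rewrite hom_gnorm ?Qx ?(raddf0 (@gnorm G _)) // => g w; exact: sm_out_act.
have yG g : gmod_act g y = y.
  apply/eqP; rewrite -subr_eq0; apply/eqP; apply: (TL _ _ pa_gt0).
  by rewrite mulrnBl -(raddfMn (gmod_act g)) -xy /= act_gnorm // subrr.
have Ny : gnorm y = y *+ p by rewrite /gnorm; under eq_bigr do rewrite yG; rewrite sumr_const.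
pose r w := (c l (gnorm (sm_pi Q w)) %/ p)%Z.
have rE w : r w * p = c l (gnorm (sm_pi Q w)).
  rewrite divzK //; have [w' ->] := Np _ (sm_out_pi Q w).
  by rewrite (coordMn c) dvdz_mull.
have rB : zmod_morphism (r : L -> triv_gmod G int).
  move=> w w'; have p0 : (p%:Z != 0) by rewrite eqz_nat -lt0n prime_gt0.
  apply: (mulIf p0); rewrite [RHS]mulrBl !rE.
  by rewrite (raddfB (sm_pi Q)) (raddfB (@gnorm G _)) (raddfB (c l)).
pose R : {additive L -> triv_gmod G int} :=
  HB.pack (r : L -> triv_gmod G int) (GRing.isZmodMorphism.Build _ _ _ rB).
pose i (m : triv_gmod G int) := y *~ m.
have iB : zmod_morphism i by move=> m m'; apply: mulrzBr.
pose I : {additive triv_gmod G int -> L} :=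
  HB.pack i (GRing.isZmodMorphism.Build _ _ _ iB).
pose one : triv_gmod G int := 1%Z.
pose bs : seq (triv_gmod G int * dual (triv_gmod G int)) := [:: (one, (idfun : {additive int -> int}) : dual (triv_gmod G int))].
have bsP : basis_for bs by move=> m; rewrite /= add0r [LHS]mulrzz mul1r.
have bsd : dual_system bs by [].
have [S Sg] := rank_good bsP.
have piy m : sm_pi Q (y *~ m) = y *+ sm_mul Q *~ m.
  by rewrite (additive_mulrz (sm_pi Q)) /= sm_pi_ker.
apply: (extend_summand G_prime ec (P := triv_gmod G int) (S := S) (m := 1%N) (i := I) (r := R)
  (q := one) Qs (dual_bases_seq bsP bsd) (coprimen1 _) Sg).
- by move=> g m; rewrite [RHS](additive_mulrz (gmod_act g)) /= yG.
- move=> g w; rewrite [LHS]/(r _) /r sm_pi_act gnorm_act //.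
- by move=> m; rewrite [I m]/(y *~ m) (additive_mulrz (sm_out Q)) Qy mul0rz.
- by move=> w; rewrite [LHS]/(r _) /r sm_pi_in (raddf0 (@gnorm G _)) (raddf0 (c l)) div0z.
- move=> m b Rm; exists (m %/ p)%Z; rewrite pmulrn [RHS]mulrzz divzK //.
  have E : c l y * m * sm_mul Q = b * p.
    have p0 : (p%:Z != 0) by rewrite eqz_nat -lt0n prime_gt0.
    apply: (mulIf p0); have -> : b * p = r (y *~ m) by rewrite -[RHS]/(R (I m)) Rm pmulrn mulrzz.
    rewrite rE piy (additive_mulrz (@gnorm G _)) (raddfMn (@gnorm G _)) /= Ny (additive_mulrz (c l)).
    by rewrite !(coordMn c) mulrzz; ring.
  have : (p %| c l y * m * sm_mul Q)%Z by rewrite E dvdz_mull.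
  rewrite !prime_dvdzM // (negPf cl) /= => /orP[//|].
  by have := sm_mul_coprime Q; rewrite prime_coprime // dvdzE /= => /negPf->.
- case=> b; rewrite pmulrn [RHS]mulrzz => b1; have := prime_gt1 G_prime.
  have : (p %| one)%Z by rewrite b1 dvdz_mull.
  by rewrite dvdzE /= dvdn1 => /eqP ->.
Qed.

End Pieces.

Section Pieces.
Variables (G : finGroupType) (sg : G).
Hypotheses (G_prime : prime #|G|) (mulGC : forall g h : G, (g * h = h * g)%g).
Hypothesis sg_gen : forall g : G, exists k, g = (sg ^+ k)%g.
Local Notation p := #|G|.
Local Notation delta := (@gdiff G sg _).
Local Notation psum := (gpsum sg_gen).
Variables (L : gmodType G) (n : nat) (e : 'I_n -> L) (c : 'I_n -> {additive L -> int}).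
Hypothesis ec : dual_bases e c.
Implicit Types (Q : @summand G L) (s : seq (L * {additive L -> int})) (x y : L).
Implicit Types a b : regmod G.

(** The action on x of (sum_g a_g g) / (sg - 1), a quotient that makes sense because the a_g sum to
    0. *)
Definition psum_map x (a : augmod G) : L := \sum_g psum g x *~ augmod_val a g.

Fact psum_mapB x : zmod_morphism (psum_map x).
Proof.
move=> a b; rewrite /psum_map -sumrB; apply: eq_bigr => g _.
by rewrite -mulrzBr -regmodB.
Qed.
HB.instance Definition _ x := GRing.isZmodMorphism.Build (augmod G) L (psum_map x)
  (@psum_mapB x).

Lemma gdiff_psum_map x (a : augmod G) : delta (psum_map x a) = orbit_map x (augmod_val a).
Proof.
transitivity (orbit_map x (augmod_val a) - x *~ \sum_g augmod_val a g); last first.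
  by rewrite augmod_sum subr0.
rewrite /psum_map raddf_sum mulrz_sumr -sumrB; apply: eq_bigr => g _.
by rewrite (additive_mulrz (@gdiff G sg L)) /= gdiff_psum mulrzBl.
Qed.

(** The norm vanishes on the complement, so matrix coefficients land in the augmentation ideal and
    delta is injective there: a fixed d has p d = gnorm d = 0. Injectivity is what makes
    [psum_map x] equivariant. *)
Lemma extend_augmentation Q s x : witnessed Q s ->
  (forall y, sm_out Q y = 0 -> gnorm y = 0) -> sm_out Q x = 0 ->
  ~ (exists2 y, sm_out Q y = 0 & x = delta y) -> exists Q' xf, @witnessed G L Q' (xf :: s).
Proof.
move=> Qs N0 Qx xt; have TL := dual_bases_torsion_free ec.
have p_gt0 := prime_gt0 G_prime.
have Qpart g y : sm_out Q y = 0 -> sm_out Q (psum g y) = 0.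
  move=> Qy; rewrite hom_psum ?Qy ?(raddf0 (gpsum sg_gen g)) // => h w.
  exact: sm_out_act.
have gdiff_inj y y' : sm_out Q y = 0 -> sm_out Q y' = 0 -> delta y = delta y' -> y = y'.
  move=> Qy Qy' yy'; apply/eqP; rewrite -subr_eq0; apply/eqP; set d := y - y'.
  have td : delta d = 0 by rewrite /d (raddfB (@gdiff G sg L)) /= yy' subrr.
  have dG g : gmod_act g d = d.
    by rewrite (act_gdiff_psum sg_gen) -(psum_gdiff mulGC) td (raddf0 (gpsum sg_gen g)) addr0.
  apply: (TL _ _ p_gt0); rewrite -[RHS](N0 d) ?/d ?(raddfB (sm_out Q)) ?Qy ?Qy' ?subrr // -/d.
  by rewrite /gnorm; under eq_bigr do rewrite dG; rewrite sumr_const.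
(* u plays the role of p x / (sg - 1). If it were p y, then x would be delta y, which is excluded;
   this provides the coordinate c l. *)
pose u := - \sum_g psum g x.
have Qu : sm_out Q u = 0.
  rewrite /u raddfN raddf_sum big1 ?oppr0 // => g _; exact: Qpart.
have tu : delta u = x *+ p.
  rewrite /u (raddfN (@gdiff G sg L)) raddf_sum /=.
  under eq_bigr do rewrite gdiff_psum.
  rewrite sumrB sumr_const; have := N0 _ Qx; rewrite /gnorm => ->.
  by rewrite sub0r opprK.
have /(separating_coord ec)[l cl] : ~ exists y, u = y *+ p.
  case=> y uy; apply: xt; exists y.
    by apply: (sm_torsion_free p_gt0); rewrite -(raddfMn (sm_out Q)) -uy.
  apply/eqP; rewrite -subr_eq0; apply/eqP; apply: (TL _ _ p_gt0).
  by rewrite mulrnBl -tu uy (raddfMn (@gdiff G sg L)) subrr.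
have r_aug w : matrix_coef (c l) (sm_pi Q w) \in @augmentation G.
  apply/eqP; transitivity (c l (gnorm (sm_pi Q w))); last by rewrite N0 ?sm_out_pi ?raddf0.
  rewrite /gnorm raddf_sum [RHS](reindex_inj invg_inj); apply: eq_bigr => g _.
  by rewrite ffunE.
pose r w := AugMod (r_aug w).
have rB : zmod_morphism r.
  by move=> w w'; apply: val_inj; rewrite /= (raddfB (sm_pi Q)) (raddfB (matrix_coef (c l))).
pose R : {additive L -> augmod G} := HB.pack r (GRing.isZmodMorphism.Build _ _ r rB).
have Qi (a : augmod G) : sm_out Q (psum_map x a) = 0.
  rewrite /psum_map raddf_sum big1 // => g _.
  by rewrite (additive_mulrz (sm_out Q)) Qpart ?mul0rz.
have iG g (a : augmod G) : psum_map x (gmod_act g a) = gmod_act g (psum_map x a).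
  apply: gdiff_inj; rewrite ?sm_out_act ?Qi ?raddf0 //.
  by rewrite gdiff_act // !gdiff_psum_map -orbit_map_act.
have rG g w : r (gmod_act g w) = gmod_act g (r w).
  by apply: val_inj; rewrite /= sm_pi_act matrix_coef_act.
have [S Sg] := augmod_good G.
have [h h1] : exists h : G, h != 1%g.
  apply: contrapT => nh; move: (G_prime); rewrite (_ : #|G| = 1%N) //.
  apply: (@eq_card1 _ 1%g) => g; rewrite !inE; apply/esym/eqP; apply: contrapT => /eqP g1.
  by apply: nh; exists g.
have ecP := dual_bases_seq (@augbasis_for G) (@augbasis_dual G).
apply: (extend_summand G_prime ec (P := augmod G) (S := S) (i := psum_map x) (r := R)
  (q := aug_dl h) Qs ecP (coprime_fact G_prime) Sg iG rG Qi).
- by move=> w; apply: val_inj; rewrite /= sm_pi_in (raddf0 (matrix_coef (c l))).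
- pose z : {additive augmod G -> augmod G} := R \o psum_map x.
  apply: (@injective_mod G sg G_prime _ _ z).
    by move=> g a; rewrite /z /= iG rG.
  move=> a b b' zab ttab.
  have ttval : delta (augmod_val a) = augmod_val b' *+ p.
    by rewrite -(raddfMn (\val : augmod G -> regmod G)) -ttab.
  have [k ak] := regmod_const_mod mulGC sg_gen ttval.
  have sum_k : \sum_g k g = - augmod_val a 1%g.
    have p0 : (p%:Z != 0) by rewrite eqz_nat -lt0n.
    apply: (mulIf p0); apply/eqP; rewrite mulNr -addr_eq0 mulr_suml.
    have := augmod_sum a; under eq_bigr do rewrite ak.
    rewrite big_split sumr_const /= => sE; apply/eqP.
    by rewrite addrC -[RHS]sE pmulrn mulrzz.
  (* Modulo p, a is the constant a 1, and the constant function 1 contributes - u. *)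
  have ia : psum_map x a = u *~ (- augmod_val a 1%g) + (\sum_g psum g x *~ k g) *+ p.
    apply: gdiff_inj; rewrite ?Qi //.
      rewrite raddfD (additive_mulrz (sm_out Q)) Qu mul0rz add0r (raddfMn (sm_out Q)).
      rewrite raddf_sum big1 ?mul0rn // => g _.
      by rewrite (additive_mulrz (sm_out Q)) Qpart ?mul0rz.
    rewrite gdiff_psum_map (orbit_map_const_mod _ ak) N0 // mul0rz add0r.
    rewrite (raddfD (@gdiff G sg L)) (raddfMn (@gdiff G sg L)).
    rewrite (additive_mulrz (@gdiff G sg L)) /= tu raddf_sum -sum_k mulrz_sumr.
    rewrite -!sumrMnl -big_split; apply: eq_bigr => g _ /=.
    rewrite (additive_mulrz (@gdiff G sg L)) /= gdiff_psum (act_gdiff_psum sg_gen) gdiff_psum.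
    by rewrite mulrzBl mulrnBl addrC !pmulrn -!mulrzA mulrC; abel.
  have pa1 : (p %| augmod_val a 1%g)%Z.
    have /(congr1 (\val : augmod G -> regmod G))/ffunP/(_ 1%g) := zab.
    rewrite (raddfMn (\val : augmod G -> regmod G)) regmodMn /= ffunE invg1 gmod_act1.
    rewrite sm_pi_ker // ia (raddfMn (c l)) (raddfD (c l)) (raddfMn (c l)).
    rewrite (additive_mulrz (c l)) mulrzz => /dvdz_congr.
    rewrite !prime_dvdzM // (negPf cl) /= rpredN => /orP[//|].
    by have := sm_mul_coprime Q; rewrite prime_coprime // dvdzE /= => /negPf->.
  have [a' aa'] : exists a', augmod_val a = a' *+ p.
    by apply: dvd_regmod => g; rewrite ak rpredD ?dvdz_mull.
  have a'_aug : a' \in @augmentation G.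
    have p0 : (p%:Z != 0) by rewrite eqz_nat -lt0n.
    apply/eqP; apply: (mulIf p0); rewrite mul0r -[RHS](augmod_sum a) mulr_suml.
    by apply: eq_bigr => g _; rewrite aa' regmodMn.
  exists (AugMod a'_aug); apply: val_inj.
  by rewrite (raddfMn (\val : augmod G -> regmod G)).
- case=> b /(congr1 (@aug_evl G h)); rewrite aug_evl_dl // eqxx (raddfMn (@aug_evl G h)).
  rewrite pmulrn mulrzz => b1; have := prime_gt1 G_prime.
  have : (p %| 1%Z)%Z by rewrite b1 dvdz_mull.
  by rewrite dvdzE /= dvdn1 => /eqP ->.
Qed.

End Pieces.

(** * Finite dual bases of a lattice *)

Section FreeAbelian.
Variables (L : zmodType) (K : choiceType) (f : {additive {freeg K} -> L}).
Variable g : L -> {freeg K}.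
Hypotheses (fK : cancel f g) (gK : cancel g f).

Fact free_invB : zmod_morphism g.
Proof. by move=> x y; apply: (can_inj fK); rewrite raddfB !gK. Qed.
Let g' : {additive L -> {freeg K}} := HB.pack g (GRing.isZmodMorphism.Build _ _ g free_invB).

Definition free_basis (ks : seq K) : seq (L * {additive L -> int}) :=
  [seq (f << k >>, (coeff k \o g' : {additive L -> int})) | k <- ks].

Lemma free_basis_dual ks : uniq ks -> dual_system (free_basis ks).
Proof.
have fE k l : coeff k (g (f << l >>)) = (l == k)%:Z.
  by rewrite fK coeffU mul1r eq_sym; case: eqP.
elim: ks => //= k ks IH /andP[kks uks]; split; [by rewrite /= fE eqxx | | exact: IH].
rewrite all_map; apply/allP => l lks /=; rewrite /dual_pair /= !fE.
have lk : l != k by apply: contraNneq kks => <-.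
by rewrite (eq_sym k) (negPf lk).
Qed.

Lemma free_basis_for ks : uniq ks ->
  (forall x k, k \notin ks -> coeff k (g x) = 0) -> basis_for (free_basis ks).
Proof.
move=> uks gks y; rewrite proj_sum big_map; apply: (can_inj gK).
rewrite -[g _]/(g' _) raddf_sum; apply/eqP/freeg_eqP => k; rewrite raddf_sum /=.
have E l : coeff k (g' (f << l >> *~ coeff l (g y))) = if l == k then coeff l (g y) else 0.
  rewrite (additive_mulrz g') /= fK (additive_mulrz (coeff k)) /= coeffU mul1r.
  by rewrite mulrzz eq_sym; case: eqP; rewrite ?mul1r ?mul0r.
under eq_bigr do rewrite E.
have [kks|kks] := boolP (k \in ks); last first.
  rewrite gks // big1_seq // => l /andP[_ lks].
  by case: eqP lks kks => // -> ->.
by rewrite (bigD1_seq k) //= eqxx big1 ?addr0 // => l /negPf->.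
Qed.

End FreeAbelian.

(** Finite generation is over ZG, so ks gathers the supports of all translates of the generators,
    finitely many as G is finite. The vectors all of whose translates are supported in ks form a
    submodule. *)
Lemma lattice_basis (G : finGroupType) (L : gmodType G) :
  free_abelian L -> finitely_generated L ->
  exists2 bs : seq (L * {additive L -> int}), basis_for bs & dual_system bs.
Proof.
move=> [K [f [g fK gK]]] [s sP].
pose ks := undup (flatten [seq dom (g (gmod_act h x)) | h <- enum G, x <- s]).
have uks : uniq ks := undup_uniq _.
exists (free_basis fK gK ks); last exact: free_basis_dual.
apply: free_basis_for => // x k kks; rewrite -[x](gmod_act1 (G := G)).
pose S : {pred L} := fun x => `[< forall (h : G) k, k \notin ks ->
  coeff k (g (gmod_act h x)) = 0 >].
have gB := free_invB fK gK.
suff /asboolP : x \in S by apply.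
apply: sP => {x k kks}.
- split=> [|x y /asboolP xS /asboolP yS]; apply/asboolP => h k kks.
    by rewrite raddf0 -(subrr (0 : L)) gB subrr raddf0.
  by rewrite (raddfB (gmod_act h)) gB (raddfB (coeff k)) /= xS // yS // subrr.
- move=> h x /asboolP xS; apply/asboolP => h' k kks.
  by rewrite -gmod_actM xS.
- move=> x xs; apply/asboolP => h k kks; apply: coeff_outdom.
  apply: contra kks; rewrite mem_undup => kx; apply/flattenP.
  exists (dom (g (gmod_act h x))) => //; apply/allpairsP; exists (h, x).
  by rewrite mem_enum.
Qed.

(** * Exhausting the lattice *)

Section Decomposition.
Variables (G : finGroupType) (sg : G).
Hypotheses (G_prime : prime #|G|) (mulGC : forall g h : G, (g * h = h * g)%g).
Hypothesis sg_gen : forall g : G, exists k, g = (sg ^+ k)%g.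
Local Notation p := #|G|.
Local Notation delta := (@gdiff G sg _).
Variables (L : gmodType G) (n : nat) (e : 'I_n -> L) (c : 'I_n -> {additive L -> int}).
Hypothesis ec : dual_bases e c.
Implicit Types (Q : @summand G L) (s : seq (L * {additive L -> int})) (x y : L).

(** If none of the three extensions applies, delta maps the complement onto itself. Then every
    vector there is a p-th iterate of delta, hence divisible by p, and the complement is zero, a
    nonzero vector having only finitely many factors p. *)
Lemma extend_witnessed Q s : witnessed Q s ->
  (forall x, sm_pi Q x = 0) \/ exists Q' xf, @witnessed G L Q' (xf :: s).
Proof.
move=> Qs.
have [[x [Qx Nx]]|noV] := EM (exists x, sm_out Q x = 0 /\ ~ exists y, gnorm x = y *+ p).
  by right; apply: (extend_regular G_prime mulGC sg_gen ec Qs Qx Nx).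
have Np y : sm_out Q y = 0 -> exists y', gnorm y = y' *+ p.
  by move=> Qy; apply: contrapT => Ny; apply: noV; exists y.
have [[x [Qx Nx]]|noA] := EM (exists x, sm_out Q x = 0 /\ gnorm x != 0).
  by right; apply: (extend_trivial G_prime mulGC ec Qs Np Qx Nx).
have N0 y : sm_out Q y = 0 -> gnorm y = 0.
  by move=> Qy; apply: contrapT => /eqP Ny; apply: noA; exists y.
have [[x [Qx xt]]|noB] := EM (exists x, sm_out Q x = 0 /\
    ~ exists2 y, sm_out Q y = 0 & x = delta y).
  by right; apply: (extend_augmentation G_prime mulGC sg_gen ec Qs N0 Qx xt).
have ker_gdiff k x : sm_out Q x = 0 -> exists2 y, sm_out Q y = 0 & x = iter k (fun y => delta y) y.
  move=> Qx; elim: k => [|k [y Qy ->]]; first by exists x.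
  have [z Qz ->] : exists2 z, sm_out Q z = 0 & y = delta z.
    by apply: contrapT => yt; apply: noB; exists y.
  by exists z; rewrite // -iterSr.
left=> x; apply: contrapT => /eqP /(max_pow_divisor G_prime ec)[a [y [xy]]]; case.
have Qy : sm_out Q y = 0.
  have pa_gt0 : (0 < p ^ a)%N by rewrite expn_gt0 prime_gt0.
  by apply: (sm_torsion_free pa_gt0); rewrite -(raddfMn (sm_out Q)) -xy; apply: sm_out_pi.
have [z _ ->] := ker_gdiff p y Qy; exact: gdiff_nilpotent.
Qed.

Definition zero_module := triv_gmod G 'rV[int]_0.

Lemma zero_module_eq (x y : zero_module) : x = y.
Proof. by rewrite [x]thinmx0 [y]thinmx0. Qed.

Lemma zero_summand : exists Q, @witnessed G L Q [::].
Proof.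
have bsP : basis_for ([::] : seq (zero_module * dual zero_module)).
  by move=> y; apply: zero_module_eq.
have [S Sg] := rank_good bsP.
have TF : torsion_free zero_module by move=> x *; apply: zero_module_eq.
unshelve eexists (@Summand G L zero_module S 1%N \0 \0 1%N _ Sg TF _ _ _ _).
- exact: coprimen1.
- by move=> g x; rewrite /= raddf0.
- by move=> g x; apply: zero_module_eq.
- exact: coprimen1.
- by move=> x; apply: zero_module_eq.
by split.
Qed.

(** d bounds the number of extensions left: witnesses are independent modulo p, so there are at most
    n of them. *)
Lemma lattice_splits d Q s : witnessed Q s -> (n < d + size s)%N ->
  exists Q', forall x, sm_pi Q' x = 0.
Proof.
elim: d Q s => [|d IH] Q s Qs sd.
  by have := triangular_size G_prime ec Qs.1; rewrite leqNgt sd.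
have [Q0|[Q' [xf Qs']]] := extend_witnessed Qs; first by exists Q.
by apply: IH Qs' _; rewrite /= addnS.
Qed.

End Decomposition.

Lemma lattice_good (G : finGroupType) (sg : G) (L : gmodType G) n
    (e : 'I_n -> L) (c : 'I_n -> {additive L -> int}) :
  prime #|G| -> (forall g h : G, (g * h = h * g)%g) ->
  (forall g : G, exists k, g = (sg ^+ k)%g) -> dual_bases e c ->
  exists m S, (forall n, coprimez (m n) #|G|) /\ @good_section G L m S.
Proof.
move=> G_prime mulGC sg_gen ec; have [Q0 Qs] := @zero_summand G L.
have [|Q Q_pi] := lattice_splits G_prime mulGC sg_gen ec (d := n.+1) Qs.
  by rewrite addn0.
have inK x : sm_in Q (sm_out Q x) = x *+ sm_mul Q.
  by apply/esym/eqP; rewrite -subr_eq0; apply/eqP/Q_pi.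
have [S Sg] := retract_section (@sm_in_act _ _ Q) (@sm_out_act _ _ Q) inK (@sm_good _ _ Q).
do 2!eexists; split; last exact: Sg.
move=> k; rewrite /= coprimez_sym coprimezMr.
by rewrite coprimezXr ?andbT; [apply: sm_const_coprime | apply: sm_mul_coprime].
Qed.

Theorem theorem1p1 (p : nat) (p_prime : prime p) (L : gmodType 'Z_p)
    (L_free : free_abelian L) (L_fg : finitely_generated L) (k : nat) :
  zmod_isom
    (cohomology (triv_gmod (semidirect L) int) k)
    (dirsum (fun j : 'I_k.+1 => cohomology (ext_power j (dual L)) (k - j))).
Proof.
have Zp_prime : prime #|'Z_p| by rewrite card_ord Zp_cast ?prime_gt1.
have [bs bsP bsd] := lattice_basis L_free L_fg.
have [||m [S [m_coprime Sg]]] :=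
  lattice_good (sg := Zp1 : 'Z_p) Zp_prime _ _ (dual_bases_seq bsP bsd).
- by move=> g h; apply: Zp_mulgC.
- by move=> g; exists g; rewrite Zp1_expgz.
exact: (section_splitting bsP bsd Sg m_coprime).
Qed.
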